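(* Let $n=2m$ be an even positive integer and let $\lambda=(n-k,k)$, $n-k\ge k\ge 1$, be a two-row partition of $n$ such that either $n-k=k=m$, or both $n-k$ and $k$ are odd. Then the set $\{K_a \mid a\in I^{\mathrm D}_{n-k,k}\}$ forms the complete list of irreducible components of the two-row Springer fiber $\mathcal B^{\mathrm D}_{n-k,k}$ of type D.
   Context: **Space, nilpotent and form.** For $\lambda=(n-k,k)$ as in the claim ($n=2m$), let $V_\lambda$ be the complex vector space with ordered basis $e_1,\dots,e_{n-k},f_1,\dots,f_k$. Let $x=x_\lambda$ be the nilpotent endomorphism with $x e_i=e_{i-1}$, $x f_i=f_{i-1}$, where $e_0=f_0=0$. Let $J_r$ be the $r\times r$ antidiagonal matrix whose $(i,r+1-i)$ entry is $(-1)^{i-1}$. Let $\beta=\beta_\lambda$ be the non-degenerate symmetric bilinear form on $V_\lambda$ whose matrix in the ordered basis (first the $e$'s, then the $f$'s) is $\begin{pmatrix}0&J_m\\ J_m^t&0\end{pmatrix}$ if $n-k=k=m$, and $\begin{pmatrix}J_{n-k}&0\\0&J_k\end{pmatrix}$ if $n-k>k$. Orthogonal complements $\perp$ are taken with respect to $\beta$. **Springer fiber.** $\mathcal B^{\mathrm D}_{n-k,k}$ is the projective variety of all complete flags $F_\bullet=(\{0\}=F_0\subsetneq F_1\subsetneq\dots\subsetneq F_n=V_\lambda)$ that are isotropic, i.e. $F_{n-i}=F_i^\perp$ for $0\le i\le n$, and satisfy $xF_i\subseteq F_{i-1}$ for $1\le i\le n$. (The orthogonal, not special orthogonal, group is used,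 so this variety has two connected components.) **Marked cup diagrams.** Fix a rectangle in the plane with evenly spaced vertices $1,2,\dots,m$ (from left to right) on its top horizontal edge. A cup diagram is a non-intersecting arrangement (considered up to planar isotopy) of cups (arcs joining two vertices) and vertical rays (from a vertex to the bottom edge) inside the rectangle such that each vertex is connected to exactly one endpoint of either a cup or a ray. A cup or ray is accessible from the right if it can be connected to the right vertical edge of the rectangle by a path which does not intersect any other cup or ray. A marked cup diagram is a cup diagram in which any cup or ray accessible from the right is allowed to be decorated with a single marker. $I^{\mathrm D}_{n-k,k}$ denotes the set of all marked cup diagrams on $m$ vertices with exactly $\lfloor k/2\rfloor$ cups. **The subsets $K_a$.** For a subspace $U$ and $r\ge 0$, $x^{-r}U$ denotes the preimage of $U$ under $x^r$. For a vertex $i$ connected to a ray, $c(i)$ is the number of cups to the left of $i$. For $a\in I^{\mathrm D}_{n-k,k}$, $K_a\subseteq\mathcal B^{\mathrm D}_{n-k,k}$ is the subset of all flags $F_\bullet$ satisfying: (i) if vertices $i<j$ are connected by an unmarked cup, then $F_j=x^{-\frac12(j-i+1)}F_{i-1}$; (ii) if vertices $i<j$ are connected by a marked cup, then $F_{i-1}+x^{\frac12(j-i+1)}F_j=F_i$ and $F_j^\perp=x^{-\frac12(n-2j)}F_j$; and, in case $n-k=k$: (iii) if vertex $i$ is connected to a marked ray, then $F_i=\langle e_1,\dots,e_{\frac12(i-1)},f_1,\dots,f_{\frac12(i+1)}\rangle$; (iv) if vertex $i$ is connected to an unmarked ray, then $F_i=\langle e_1,\dots,e_{\frac12(i+1)},f_1,\dots,f_{\frac12(i-1)}\rangle$;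 while, in case $n-k>k$, instead of (iii), (iv): (iii') if vertex $i$ is connected to a marked ray, then $F_i=\langle e_1,\dots,e_{i-c(i)-1},f_1,\dots,f_{c(i)},f_{c(i)+1}+e_{i-c(i)}\rangle$; (iv') if vertex $i$ is connected to the rightmost ray and this ray is unmarked, then $F_i=\langle e_1,\dots,e_{i-c(i)-1},f_1,\dots,f_{c(i)},f_{c(i)+1}-e_{i-c(i)}\rangle$; (v') if vertex $i$ is connected to an unmarked ray that is not the rightmost ray, then $F_i=\langle e_1,\dots,e_{i-c(i)},f_1,\dots,f_{c(i)}\rangle$.
   Formalization: For n-k>k and m odd, the coefficients ±1 of e_{i-c(i)} in (iii') and (iv') are replaced by ±√-1: with ±1 the middle vector is not isotropic and some K_a are empty (e.g. (5,1): β(f_1±e_3,f_1±e_3)=2), so the claim as printed is false there. *)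

(* Defs.v *)
From HB Require Import structures.
From mathcomp Require Import all_boot all_order all_algebra.
From mathcomp Require Import complex.
From mathcomp Require Import boolp classical_sets reals.
From mathcomp Require Import mpoly.

Set Implicit Arguments.
Unset Strict Implicit.
Unset Printing Implicit Defensive.

Import GRing.Theory.
Local Open Scope classical_set_scope.
Local Open Scope ring_scope.

Section Irreducible.
Variables (T : Type) (closed : set T -> Prop).

Definition irreducible (A : set T) : Prop :=
  A !=set0 /\
  forall Z1 Z2 : set T, closed Z1 -> closed Z2 ->
    A `<=` Z1 `|` Z2 -> A `<=` Z1 \/ A `<=` Z2.

(* Maximal irreducible subsets of the subspace X of T.  The closed sets of X    *)
(* are the X `&` Z with Z closed in T, so irreducibility of a subset of X can   *)
(* be tested with the closed sets of T.                                         *)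
Definition irreducible_components (X : set T) : set (set T) :=
  [set A | [/\ A `<=` X, irreducible A &
    forall A' : set T, A' `<=` X -> irreducible A' -> A `<=` A' -> A' = A]].

End Irreducible.

(* The vertices 1, ..., m are encoded by 'I_m, with i : 'I_m standing for       *)
(* vertex i.+1.  Up to planar isotopy a cup diagram is the non-crossing         *)
(* matching [partner], whose fixed points are the vertices on rays; rays reach  *)
(* the bottom edge, so no ray starts under a cup.                               *)

(* The cup or ray at i is cut off from the right edge exactly by the rays to    *)
(* the right of it and by the cups it is nested in (one can pass below any      *)
(* other cup).                                                                  *)
Definition accessible (m : nat) (partner : 'I_m -> 'I_m) (i : 'I_m) : Prop :=
  (forall j : 'I_m, (maxn i (partner i) < j)%N -> partner j != j) /\
  (forall l : 'I_m,
     ~ ((l < minn i (partner i))%N /\ (maxn i (partner i) < partner l)%N)).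

Record marked_cup_diagram (m : nat) := MarkedCupDiagram {
  partner : 'I_m -> 'I_m;
  marked : {set 'I_m};  (* the vertices lying on a marked cup or ray *)
  partnerK : involutive partner;
  no_ray_under_cup : forall i j : 'I_m,
    (i < j < partner i)%N -> partner j != j;
  non_crossing : forall i j : 'I_m,
    (i < j < partner i)%N -> (i < partner j < partner i)%N;
  marked_partner : forall i : 'I_m, i \in marked -> partner i \in marked;
  marked_accessible : forall i : 'I_m, i \in marked -> accessible partner i
}.

Definition num_cups (m : nat) (a : marked_cup_diagram m) : nat :=
  #|[pred l : 'I_m | (l < partner a l)%N]|.

Definition num_cups_left (m : nat) (a : marked_cup_diagram m) (i : 'I_m) : nat :=
  #|[pred l : 'I_m | (l < partner a l < i)%N]|.

Section TwoRow.
Variables (R : realType) (p k : nat).  (* lambda = (p, k), p = n - k *)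
Local Notation C := R[i].
Local Notation n := (p + k)%N.
Local Notation V := 'rV[C]_n.

(* evec 1, ..., evec p, fvec 1, ..., fvec k is the standard basis of row        *)
(* vectors; evec 0 = fvec 0 = 0.                                                *)
Definition evec (i : nat) : V := row_mx (\row_(j < p) (j.+1 == i)%:R) 0.
Definition fvec (i : nat) : V := row_mx 0 (\row_(j < k) (j.+1 == i)%:R).

Definition shift_mx (r : nat) : 'M[C]_r := \matrix_(i, j) (i == j.+1 :> nat)%:R.
Definition nilp_mx : 'M[C]_n := block_mx (shift_mx p) 0 0 (shift_mx k).

(* x ^ r, acting on row vectors by right multiplication.                        *)
Definition xpow (r : nat) : 'End(V) := linfun (mulmxr (nilp_mx ^+ r)).

(* The matrix J_r, for r = s.                                                   *)
Definition antidiag_mx (r s : nat) : 'M[C]_(r, s) :=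
  \matrix_(i, j) if (i + j).+1 == r then (-1) ^+ i else 0.

Definition beta_mx : 'M[C]_n :=
  if p == k then block_mx 0 (antidiag_mx p k) (antidiag_mx p k)^T 0
  else block_mx (antidiag_mx p p) 0 0 (antidiag_mx k k).

Definition beta (u v : V) : C := (u *m beta_mx *m v^T) 0 0.

(* See mem_perpP below.                                                         *)
Definition perp (U : {vspace V}) : {vspace V} :=
  (\bigcap_(i < \dim U) lker (linfun (fun v : V => beta (vbasis U)`_i v : C^o)))%VS.

Definition flag := n.+1.-tuple {vspace V}.

Definition step (F : flag) (i : nat) : {vspace V} := nth 0%VS F i.

Definition is_flag (F : flag) : Prop :=
  [/\ step F 0 = 0%VS,
      forall i, (i < n)%N -> (step F i <= step F i.+1)%VS /\ step F i <> step F i.+1 &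
      step F n = fullv].

Definition springer_fiber : set flag :=
  [set F | [/\ is_flag F,
    forall i, (i <= n)%N -> step F (n - i) = perp (step F i) &
    forall i, (1 <= i <= n)%N -> (xpow 1 @: step F i <= step F i.-1)%VS]].

(* The Zariski topology on complete flags, via the Plücker embedding into       *)
(* the product of the projective spaces P(Λ^i V), 0 <= i <= n.  The coordinates *)
(* on Λ^i V are indexed by the sets S of i columns.                             *)
Definition plucker_coords (F : flag) (c : {set 'I_n} -> C) : Prop :=
  exists B : forall i : nat, 'M[C]_(i, n),
    (forall i, (i <= n)%N -> basis_of (step F i) [seq row r (B i) | r <- enum 'I_i]) /\
    forall S : {set 'I_n},
      c S = \det (colsub (fun j : 'I_#|S| => enum_val j) (B #|S|)).

Definition nvars := #|{: {set 'I_n}}|.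

Definition multihomogeneous (P : {mpoly C[nvars]}) : Prop :=
  exists d : nat -> nat, forall mon : 'X_{1..nvars}, mon \in msupp P ->
    forall i, (\sum_(s < nvars | #|enum_val s : {set 'I_n}| == i)
                 mon s)%N = d i.

Definition plucker_zero (P : {mpoly C[nvars]}) (F : flag) : Prop :=
  forall c, plucker_coords F c ->
    P.@[fun s => c (enum_val s)] = 0.

Definition zariski_closed (Z : set flag) : Prop :=
  exists Ps : set {mpoly C[nvars]},
    Ps `<=` [set P | multihomogeneous P] /\
    Z = [set F | is_flag F /\ forall P, Ps P -> plucker_zero P F].

Local Notation m := (n./2).

(* < e_1, ..., e_r, f_1, ..., f_s, the elements of w >                          *)
Definition span_ef (r s : nat) (w : seq V) : {vspace V} :=
  <<[seq evec l | l <- iota 1 r] ++ [seq fvec l | l <- iota 1 s] ++ w>>%VS.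

(* The coefficient of e_{i-c(i)} for a marked ray and, up to sign, for an       *)
(* unmarked rightmost ray.  For even m it is 1.  For odd m the coefficient 1,   *)
(* found in the literature, is incompatible with the form beta: by              *)
(* beta_middle below, when p > k are odd, f_{(k+1)/2} + z e_{(p+1)/2} is        *)
(* isotropic iff z ^ 2 = (-1) ^ m.  With coefficient 1 and m odd the sets       *)
(* [component a] do not cover the fiber: for (p, k) = (5, 1) all of them are    *)
(* empty.  The choice of the square root only exchanges marked and unmarked     *)
(* rightmost rays.                                                              *)
Definition ray_coef : C := if odd m then ('i)%C else 1.

Section Component.
Variables (a : marked_cup_diagram m) (F : flag).

Definition unmarked_cups_cond : Prop :=
  forall i0 j0 : 'I_m, (i0 < j0)%N -> partner a i0 = j0 -> i0 \notin marked a ->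
  let i := i0.+1 in let j := j0.+1 in
  step F j = (xpow ((j - i + 1)./2) @^-1: step F (i - 1))%VS.

Definition marked_cups_cond : Prop :=
  forall i0 j0 : 'I_m, (i0 < j0)%N -> partner a i0 = j0 -> i0 \in marked a ->
  let i := i0.+1 in let j := j0.+1 in
  (step F (i - 1) + xpow ((j - i + 1)./2) @: step F j)%VS = step F i /\
  perp (step F j) = (xpow ((n - 2 * j)./2) @^-1: step F j)%VS.

Definition rays_cond_eq : Prop :=
  forall i0 : 'I_m, partner a i0 = i0 ->
  let i := i0.+1 in
  (i0 \in marked a -> step F i = span_ef ((i - 1)./2) ((i + 1)./2) [::]) /\
  (i0 \notin marked a -> step F i = span_ef ((i + 1)./2) ((i - 1)./2) [::]).

Definition rightmost_ray (i0 : 'I_m) : Prop :=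
  forall j0 : 'I_m, partner a j0 = j0 -> (j0 <= i0)%N.

Definition rays_cond_gt : Prop :=
  forall i0 : 'I_m, partner a i0 = i0 ->
  let i := i0.+1 in let c := num_cups_left a i0 in
  [/\ i0 \in marked a ->
        step F i = span_ef (i - c - 1) c [:: fvec c.+1 + ray_coef *: evec (i - c)],
      i0 \notin marked a -> rightmost_ray i0 ->
        step F i = span_ef (i - c - 1) c [:: fvec c.+1 - ray_coef *: evec (i - c)] &
      i0 \notin marked a -> ~ rightmost_ray i0 ->
        step F i = span_ef (i - c) c [::]].

End Component.

Definition diagrams : set (marked_cup_diagram m) := [set a | num_cups a = k./2].

Definition component (a : marked_cup_diagram m) : set flag :=
  [set F | [/\ springer_fiber F, unmarked_cups_cond a F, marked_cups_cond a F,
    (p = k -> rays_cond_eq a F) & ((k < p)%N -> rays_cond_gt a F)]].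

Lemma mem_perpP (U : {vspace V}) (v : V) :
  reflect (forall u, u \in U -> beta u v = 0) (v \in perp U).
Proof.
have lin (u : V) : linear (beta u : V -> C^o).
  by move=> c v1 v2; rewrite /beta linearP /= mulmxDr -scalemxAr !mxE.
have betaE (u w : V) : linfun (fun v : V => beta u v : C^o) w = beta u w.
  pose bl := GRing.isLinear.Build _ _ _ _ (beta u : V -> C^o) (lin u).
  pose f : {linear V -> C^o} := HB.pack (beta u : V -> C^o) bl.
  by rewrite -[LHS]/(linfun f w) lfunE.
apply: (iffP idP) => [|vU].
  rewrite memvE => /subv_bigcapP vU u uU.
  rewrite (coord_vbasis uU) /beta !mulmx_suml summxE big1 // => i _.
  rewrite -!scalemxAl mxE.
  have := vU i isT; rewrite -memvE memv_ker betaE /beta => /eqP ->.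
  by rewrite mulr0.
rewrite memvE; apply/subv_bigcapP => i _.
rewrite -memvE memv_ker betaE; apply/eqP/vU/vbasis_mem.
by apply: mem_nth; rewrite size_tuple.
Qed.

Lemma xpow1_evec (i : nat) : (i <= p)%N -> xpow 1 (evec i) = evec i.-1.
Proof.
move=> ip; rewrite /xpow lfunE /= expr1 /evec /nilp_mx mul_row_block.
rewrite !mulmx0 !mul0mx !addr0; congr row_mx.
apply/rowP => j; rewrite !mxE.
under eq_bigr do rewrite !mxE -natrM mulnb.
case: i ip => [|i] ip /=; first by rewrite big1 //.
rewrite (bigD1 (Ordinal ip)) //= eqxx /= big1 ?addr0 1?eq_sym// => l.
by rewrite -val_eqE /= eqSS => /negPf ->.
Qed.

Lemma xpow1_fvec (i : nat) : (i <= k)%N -> xpow 1 (fvec i) = fvec i.-1.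
Proof.
move=> ip; rewrite /xpow lfunE /= expr1 /fvec /nilp_mx mul_row_block.
rewrite !mulmx0 !mul0mx !add0r; congr row_mx.
apply/rowP => j; rewrite !mxE.
under eq_bigr do rewrite !mxE -natrM mulnb.
case: i ip => [|i] ip /=; first by rewrite big1 //.
rewrite (bigD1 (Ordinal ip)) //= eqxx /= big1 ?addr0 1?eq_sym// => l.
by rewrite -val_eqE /= eqSS => /negPf ->.
Qed.

Lemma beta_middle (z : C) : odd p -> odd k -> (k < p)%N ->
  let w := fvec (k./2).+1 + z *: evec (p./2).+1 in
  beta w w = (-1) ^+ k./2 + z ^+ 2 * (-1) ^+ p./2.
Proof.
move=> op ok kp w.
have mid r : odd r -> (r./2 < r)%N /\ (r./2 + r./2).+1 = r.
  move=> rodd; have rE := odd_double_half r; rewrite rodd -addnn add1n in rE.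
  by split=> //; rewrite -[ltnRHS]rE ltnS leq_addr.
have row_mid r (rodd : odd r) :
    (\row_(j < r) (j.+1 == (r./2).+1)%:R : 'rV[C]_r) =
      delta_mx 0 (Ordinal (mid r rodd).1).
  by apply/rowP => j; rewrite !mxE eqxx eqSS.
have diag r (rodd : odd r) :
    antidiag_mx r r (Ordinal (mid r rodd).1) (Ordinal (mid r rodd).1) =
      (-1) ^+ r./2.
  by rewrite mxE /= (mid r rodd).2 eqxx.
have -> : w = row_mx (z *: delta_mx 0 (Ordinal (mid p op).1))
                     (delta_mx 0 (Ordinal (mid k ok).1)).
  by rewrite /w /fvec /evec !row_mid scale_row_mx add_row_mx scaler0 add0r addr0.
rewrite /beta /beta_mx ifN ?gtn_eqF // mul_row_block !mulmx0 add0r addr0.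
rewrite tr_row_mx mul_row_col mxE addrC; congr (_ + _).
  by rewrite -rowE trmx_delta -colE !mxE /= (mid k ok).2 eqxx.
rewrite linearZ /= -scalemxAr -!scalemxAl -rowE trmx_delta -colE !mxE /=.
by rewrite (mid p op).2 eqxx mulrA expr2.
Qed.

End TwoRow.

(* Main.v *)
Require Import Defs.
From mathcomp Require Import all_boot all_order all_algebra.
From mathcomp Require Import complex.
From mathcomp Require Import reals.
From mathcomp Require Import mpoly.
From mathcomp Require Import perm zify ring.
From mathcomp Require Import boolp classical_sets.

Set Implicit Arguments.
Unset Strict Implicit.
Unset Printing Implicit Defensive.

Import GRing.Theory Num.Theory.
Local Open Scope ring_scope.

Set Default Proof Using "All".

(** Let m = n/2.  An isotropic flag is determined by its steps F_0, ..., F_m, and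
    the conditions of a diagram a at the vertices up to i only concern the steps
    up to F_i.  So K_a is studied by choosing F_1, F_2, ... in turn.

    Let rho(i) be the number of cups of a starting after vertex i.  The invariant
    is that F_i lies in the image of x^rho(i) and that the preimage
    x^(-rho(i)) F_i is isotropic ([half_xim_iso]).  It makes every line of
    x^(-1) F_(i-1) / F_(i-1) available at the left endpoint i of a cup, so there
    the choice is a projective line, while right endpoints and rays leave no
    choice ([fits_unique], [fits_vary]).  At a marked cup this rests on the fact
    that I^perp / I is a hyperbolic plane when I is a hyperplane of a Lagrangian:
    exactly two Lagrangians contain I ([two_lag]).  The condition of the unmarked
    cup takes the one attached to the left endpoint, that of the marked cup the
    other one.

    Irreducible.  Two flags F, G of K_a are joined step by step by vectors b_s(t)
    polynomial in t, spanning F at t = 0, G at t = 1 and a flag of K_a for almost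
    all t ([curve]).  If multihomogeneous P and Q did not vanish at F and at G
    respectively, then neither would vanish at almost all members of the family
    ([zariski_irreducible]).

    Closed.  Apart from marked cups, the conditions are equalities that can be
    read as incidences L F_i <= F_j for a fixed linear map L, hence closed.  At a
    marked cup one has to exclude the Lagrangian attached to the left endpoint.
    Lagrangians fall into two families, according to the parity of the dimension
    of intersections ([lag_parity]), and adjacent Lagrangians lie in different
    ones.  On K_a the family at the left endpoint is constant ([same_family]), so
    the new Lagrangian stays in the opposite family.  If a flag violates the
    condition, choose a Lagrangian E transversal to the Lagrangian of that flag:
    all Lagrangians of the opposite family meet E nontrivially, and this is the
    vanishing of a determinant of pairings ([separation]).  By Cramer's rule
    incidences and determinants of pairings are multihomogeneous in the Pluecker
    coordinates ([mhom_incidence], [mhom_pairing]).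

    Covering.  For a flag F of the Springer fiber let nu_i be the nilpotency order
    of x on F_i^perp / F_i.  This space carries the form (u, v) |-> beta u (x^r v),
    alternating for odd r, so an even order forces two Jordan blocks of that size
    and then nu_i = m - i ([even_order_dim]).  Therefore nu_i - (m - i) + 1, set
    to 0 when nu_i is even, is a lattice path with steps +1 and -1; matching up
    steps with down steps gives the cups, the unmatched down steps carry the rays,
    and F satisfies the conditions of that diagram for suitable marks
    ([coverage]).

    Minimal.  If K_a is contained in K_b, then every left endpoint of a is one of
    b, as F_i can be varied there; the numbers of cups being equal, a and b have
    the same left endpoints, hence the same cups, and then the same marks
    ([diagrams_agree]).  A finite cover by closed irreducible sets without
    inclusions consists of the irreducible components ([finite_components]). *)

(** * Cup diagrams with natural vertices *)

(** Partner functions are extended to all natural numbers, vertex i.+1 being i, so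
    that endpoints and midpoints can be computed without casts. *)
Record cups (m : nat) (mate : nat -> nat) : Prop := Cups {
  mate_lt : forall v, (v < m)%N -> (mate v < m)%N;
  mateK : forall v, (v < m)%N -> mate (mate v) = v;
  cups_no_ray : forall v u, (v < m)%N -> (v < u < mate v)%N -> mate u <> u;
  cups_nest : forall v u, (v < m)%N -> (v < u < mate v)%N -> (v < mate u < mate v)%N
}.

Definition marking (m : nat) (mate : nat -> nat) (mk : nat -> bool) : Prop :=
  forall v, (v < m)%N -> mk v ->
  [/\ mk (mate v),
      forall u, (u < m)%N -> (maxn v (mate v) < u)%N -> mate u <> u &
      forall u, (u < m)%N -> ~ ((u < minn v (mate v))%N /\ (maxn v (mate v) < mate u)%N)].

Section Cups.
Variable mate : nat -> nat.

(** An opener is the left endpoint of a cup; [nop s t] and [nray s t] count the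
    openers and the rays among s, ..., t-1. *)
Definition opener v := (v < mate v)%N.
Definition ray v := mate v == v.
Definition nop s t := count opener (iota s (t - s)).
Definition nray s t := count ray (iota s (t - s)).

Lemma nop0 s : nop s s = 0%N. Proof. by rewrite /nop subnn. Qed.
Lemma nray0 s : nray s s = 0%N. Proof. by rewrite /nray subnn. Qed.

Lemma nop_cat s t u : (s <= t)%N -> (t <= u)%N -> nop s u = (nop s t + nop t u)%N.
Proof.
move=> st tu; rewrite /nop; have -> : (u - s = (t - s) + (u - t))%N by lia.
by rewrite iotaD subnKC // count_cat.
Qed.
Lemma nray_cat s t u : (s <= t)%N -> (t <= u)%N -> nray s u = (nray s t + nray t u)%N.
Proof.
move=> st tu; rewrite /nray; have -> : (u - s = (t - s) + (u - t))%N by lia.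
by rewrite iotaD subnKC // count_cat.
Qed.

Lemma nop1 s : nop s s.+1 = opener s.
Proof. by rewrite /nop subSnn /= addn0. Qed.
Lemma nray1 s : nray s s.+1 = ray s.
Proof. by rewrite /nray subSnn /= addn0. Qed.

Lemma nray_eq0 s t : (forall u, (s <= u < t)%N -> mate u <> u) -> nray s t = 0%N.
Proof.
move=> h; apply/eqP; rewrite -leqn0 leqNgt -has_count; apply/hasPn => u.
by rewrite mem_iota => hu; apply/eqP/h; lia.
Qed.

Variable m : nat.
Hypothesis D : cups m mate.

(** Intervals closed under the matching are the pieces over which the conditions
    are composed. *)
Definition closedI s t := (s <= t)%N && (t <= m)%N /\
  forall u, (s <= u < t)%N -> (s <= mate u < t)%N.

Lemma closedI_inside v : (v < m)%N -> (v < mate v)%N -> closedI v.+1 (mate v).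
Proof.
move=> vm vw; have := mate_lt D vm; split=> [|u hu]; first by lia.
by apply: (cups_nest D); lia.
Qed.

Lemma closedI_cup v : (v < m)%N -> (v < mate v)%N -> closedI v (mate v).+1.
Proof.
move=> vm vw; have wm := mate_lt D vm; split=> [|u hu]; first by lia.
have := closedI_inside vm vw; have [->|nv] := eqVneq u v; first by lia.
have [->|nw] := eqVneq u (mate v); first by rewrite (mateK D) //; lia.
by case=> _ /(_ u); lia.
Qed.

Lemma closedI0m : closedI 0 m.
Proof. by split=> [|u hu]; [lia|have := mate_lt D (v := u); lia]. Qed.

Lemma closedI_rest s t u : closedI s u -> closedI s t -> (t <= u)%N -> closedI t u.
Proof.
move=> [h1 c1] [h2 c2] tu; split=> [|l hl]; first by lia.
have := c1 l; have := c2 (mate l); rewrite (mateK D); lia.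
Qed.

Lemma closedI_rest_l s t u : closedI s u -> closedI t u -> (s <= t)%N -> closedI s t.
Proof.
move=> [h1 c1] [h2 c2] tu; split=> [|l hl]; first by lia.
have := c1 l; have := c2 (mate l); rewrite (mateK D); lia.
Qed.

Lemma closedI_ray w : (w < m)%N -> mate w = w -> closedI 0 w.
Proof.
move=> wm ww; split=> [|u hu]; first by lia.
have um : (u < m)%N by lia.
have := mate_lt D um; have := mateK D um; have := cups_no_ray D um (u := w).
by have [E|ne] := eqVneq (mate u) w; [rewrite E; lia|move: ne ww hu; lia].
Qed.

Lemma closedI_rayS w : (w < m)%N -> mate w = w -> closedI 0 w.+1.
Proof.
move=> wm ww; have [h c] := closedI_ray wm ww; split=> [|u hu]; first by lia.
by have [->|ne] := eqVneq u w; [lia|have := c u; lia].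
Qed.

(** Induction on a closed interval by splitting off its first ray or first cup. *)
Lemma closedI_ind (P : nat -> nat -> Prop) :
  (forall s, (s <= m)%N -> P s s) ->
  (forall s t, (s < t)%N -> closedI s t -> closedI s.+1 t -> mate s = s -> P s.+1 t -> P s t) ->
  (forall s t, (s < mate s)%N -> (mate s < t)%N -> closedI s t -> closedI s.+1 (mate s) ->
     closedI (mate s).+1 t -> P s.+1 (mate s) -> P (mate s).+1 t -> P s t) ->
  forall s t, closedI s t -> P s t.
Proof.
move=> P0 Pr Pc s t; have [d] := ubnP (t - s); elim: d s t => // d IH s t hd cst.
have [/andP[st tm] c] := cst; have [E|ne] := eqVneq s t; first by rewrite E; apply: P0.
have lt : (s < t)%N by lia.
have hs := c s; have [E|ne'] := eqVneq (mate s) s.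
  have c1 : closedI s.+1 t.
    split=> [|u hu]; first by lia.
    have := c u; suff : mate u <> s by lia.
    by move=> Eu; have := mateK D (v := u); rewrite Eu E; lia.
  by apply: Pr => //; apply: IH => //; lia.
have op : (s < mate s)%N by lia.
have sm : (s < m)%N by lia.
have c1 := closedI_inside sm op.
have c2 : closedI (mate s).+1 t.
  by apply: closedI_rest (closedI_cup sm op) _ => //; lia.
by apply: Pc => //; [lia|apply: IH; [lia|]|apply: IH; [lia|]].
Qed.

Lemma closedI_count s t : closedI s t -> ((nop s t).*2 + nray s t)%N = (t - s)%N.
Proof.
move: s t; apply: closedI_ind => [s _|s t st cst c1 ms IH|s t sw wt cst c1 c2 IH1 IH2].
- by rewrite nop0 nray0 subnn.
- have [/andP[h1 h2] _] := c1.
  rewrite (@nop_cat s s.+1) // (@nray_cat s s.+1) // nop1 nray1 /opener /ray ms ltnn eqxx /=.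
  by move: IH; lia.
- have [/andP[h1 h2] _] := c1; have [/andP[h3 h4] _] := c2; have [/andP[h5 h6] _] := cst.
  have sm : (s < m)%N by lia. have st : (s < t)%N by lia. have wt' : (mate s <= t)%N by lia.
  rewrite (@nop_cat s s.+1) // (@nray_cat s s.+1) // (@nop_cat s.+1 (mate s)) // (@nray_cat s.+1 (mate s)) //.
  rewrite (@nop_cat (mate s) (mate s).+1) // (@nray_cat (mate s) (mate s).+1) //.
  rewrite !nop1 !nray1 /opener /ray (mateK D) // sw ltnNge (ltnW sw) /=.
  have -> : (mate s == s) = false by lia.
  have -> : (s == mate s) = false by lia.
  by move: IH1 IH2; lia.
Qed.

Lemma nray_cup v : (v < m)%N -> (v < mate v)%N -> nray v.+1 (mate v) = 0%N.
Proof. by move=> vm vw; apply: nray_eq0 => u hu; apply: (cups_no_ray D vm); lia. Qed.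

Lemma cup_inside_count v : (v < m)%N -> (v < mate v)%N ->
  (nop v.+1 (mate v)).*2 = (mate v - v.+1)%N.
Proof. by move=> vm vw; rewrite -(closedI_count (closedI_inside vm vw)) nray_cup // addn0. Qed.

Lemma nop_cupE v : (v < m)%N -> (v < mate v)%N -> nop v (mate v).+1 = (mate v - v).+1./2.
Proof.
move=> vm vw; have wm := mate_lt D vm; have e := cup_inside_count vm vw.
rewrite (@nop_cat v v.+1) //; last by rewrite ltnS ltnW.
rewrite (@nop_cat v.+1 (mate v)) // !nop1 /opener (mateK D) // vw ltnNge (ltnW vw).
by have -> : (mate v - v = (mate v - v.+1).+1)%N; [|rewrite -e]; lia.
Qed.

Lemma nop_cup v : (v < m)%N -> (v < mate v)%N ->
  nop v m = ((mate v - v).+1./2 + nop (mate v).+1 m)%N.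
Proof.
move=> vm vw; have wm := mate_lt D vm.
by rewrite (@nop_cat v (mate v).+1) ?nop_cupE //; apply: leqW (ltnW vw).
Qed.

Section Marking.
Variables (mk : nat -> bool).
Hypothesis Mk : marking m mate mk.

(** As nothing encloses a marked cup or ray, no arc passes over its left end. *)
Lemma marked_outer v : (v < m)%N -> mk v -> (v <= mate v)%N -> closedI 0 v.
Proof.
move=> vm kv vw; have [_ a1 a2] := Mk vm kv.
split=> [|u hu]; first by lia.
have um : (u < m)%N by lia.
have h1 := mateK D um; have h2 := mate_lt D um; have h3 := mateK D vm; have wm := mate_lt D vm.
have n1 : mate u <> v.
  by move=> E; have : u = mate v by [rewrite -E h1]; lia.
have n2 : mate u <> mate v.
  by move=> E; have : v = u by [rewrite -h3 -E h1]; lia.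
have n3 : ~ (v < mate u < mate v)%N by move=> h; have := cups_nest D vm h; rewrite h1; lia.
by have := a2 u um; lia.
Qed.

Lemma marked_late v u : (v < m)%N -> mk v -> (v < mate v)%N -> (v <= u < m)%N -> mate u <> u.
Proof.
move=> vm kv vw hu; have [_ a1 a2] := Mk vm kv.
have [/eqP -> |ne] := boolP (u == v); first by lia.
have [E|ne'] := eqVneq u (mate v); first by rewrite E (mateK D) //; lia.
by have := a1 u; have := cups_no_ray D vm (u := u); lia.
Qed.

Lemma unmarked_inside v u : (v < m)%N -> (v < u < mate v)%N -> mk u = false.
Proof.
move=> vm hu; apply/negP => ku; have wm := mate_lt D vm.
have um : (u < m)%N by lia.
have [_ _ a2] := Mk um ku; have := cups_nest D vm hu => hm.
by apply: (a2 v vm); split; lia.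
Qed.

Lemma unmarked_before_ray w u : (w < m)%N -> mate w = w -> (u < w)%N -> mk u = false.
Proof.
move=> wm ww uw; apply/negP => ku; have um : (u < m)%N by lia.
have [_ a1 _] := Mk um ku; have [_ /(_ u)] := closedI_ray wm ww => h.
by apply: (a1 w wm) => //; lia.
Qed.

End Marking.
End Cups.

(** A diagram is determined by its left endpoints: the right endpoint of a cup
    is matched with the nearest unmatched left endpoint. *)
Lemma cups_opener_closer m mate mate' : cups m mate -> cups m mate' ->
  (forall v, (v < m)%N -> (v < mate v)%N = (v < mate' v)%N) ->
  forall w, (w < m)%N -> (mate w < w)%N -> mate' w = mate w.
Proof.
move=> D D' op w; have [d] := ubnP w; elim: d w => // d IH w hd wm; set v := mate w => vw.
have vm : (v < m)%N by lia.
have mv : mate v = w by rewrite (mateK D).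
have ov' : (v < mate' v)%N by rewrite -op // mv.
set w' := mate' v in ov'; have w'm : (w' < m)%N := mate_lt D' vm.
have mw' : mate' w' = v by rewrite (mateK D').
suff -> : w = w' by [].
case: (ltngtP w w') => // lt.
- (* w is under the cup v-w' of the second diagram *)
  have h : (v < w < mate' v)%N by rewrite vw.
  have := cups_nest D' vm h; have := cups_no_ray D' vm h; have := op w wm.
  set v2 := mate' w => o1 n1 n2; have v2m : (v2 < m)%N by lia.
  have e2 : mate' v2 = w by rewrite (mateK D').
  have v2w : (v2 < w)%N by lia.
  have h2 : (v < v2 < mate v)%N by rewrite mv; lia.
  have := cups_nest D vm h2; have := op v2 v2m; rewrite e2 mv v2w => o2 n3.
  have em : mate (mate v2) = v2 by rewrite (mateK D).
  have e3 : mate' (mate v2) = mate (mate v2) by apply: IH; rewrite ?em; lia.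
  by move: (mateK D' (mate_lt D v2m)); rewrite e3 em e2 => E; lia.
- have h : (v < w' < mate v)%N by rewrite mv ov'.
  have := cups_nest D vm h; have := cups_no_ray D vm h; have := op w' w'm; rewrite mw' => o1 n1 n2.
  have e : mate' w' = mate w' by apply: IH; lia.
  by move: n2; rewrite -e mw'; lia.
Qed.

Lemma cups_opener_eq m mate mate' : cups m mate -> cups m mate' ->
  (forall v, (v < m)%N -> (v < mate v)%N = (v < mate' v)%N) ->
  forall w, (w < m)%N -> mate' w = mate w.
Proof.
move=> D D' op w wm.
have C1 := cups_opener_closer D D' op.
have C2 := cups_opener_closer D' D (fun v vm => esym (op v vm)).
case: (ltngtP (mate w) w) => h; first exact: C1.
  have := C1 (mate w); rewrite (mateK D) // => /(_ (mate_lt D wm) h) e.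
  by have := mateK D' (mate_lt D wm); rewrite e.
have := op w wm; rewrite h ltnn => /esym/negbT; rewrite -leqNgt leq_eqVlt => /orP[/eqP -> //|h'].
by have := C2 w wm h'; rewrite h.
Qed.

(** * From lattice paths to cup diagrams *)

(** A path with steps +1 and -1 ending at its minimum 0 is turned into a cup
    diagram: every up step is matched with the next return to its level, and the
    down steps reaching a new minimum carry the rays. *)
Section Path.
Variables (m : nat) (G : nat -> nat).
Hypothesis Gstep : forall u, (u < m)%N -> G u.+1 = (G u).+1 \/ G u = (G u.+1).+1.
Hypothesis Gm : G m = 0%N.

(** The step w returns to the level of v for the first time after the up step v. *)
Definition matched v w : Prop :=
  [/\ (v < w < m)%N, G v = G w.+1 & forall u, (v < u <= w)%N -> (G v < G u)%N].

Lemma matched_up v : (v < m)%N -> G v.+1 = (G v).+1 -> exists w, matched v w.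
Proof.
move=> vm up.
have ex : exists t, (v < t <= m)%N && (G t <= G v)%N by exists m; rewrite vm leqnn Gm.
have [t /andP[ht Gt] tmin] := ex_minnP ex.
case: t ht Gt tmin => // t ht Gt tmin.
have vt : (v < t)%N by have [E|] := eqVneq v t; [move: Gt; rewrite -E up ltnn|lia].
have gt u : (v < u <= t)%N -> (G v < G u)%N.
  by move=> hu; rewrite ltnNge; apply/negP => h; have := tmin u; lia.
exists t; split; [lia| |exact: gt].
by have := gt t; have := Gstep (u := t); lia.
Qed.

Lemma matched_down v w : (v <= w < m)%N -> G w = (G w.+1).+1 -> (G v <= G w.+1)%N ->
  exists2 s, (v <= s)%N & matched s w.
Proof.
move=> hv dn Gv.
have ex : exists s, (s <= w)%N && (G s <= G w.+1)%N by exists v; lia.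
have bd s : (s <= w)%N && (G s <= G w.+1)%N -> (s <= w)%N by case/andP.
have [s /andP[sw Gs] smax] := ex_maxnP ex bd.
have gt u : (s < u <= w)%N -> (G w.+1 < G u)%N.
  by move=> hu; rewrite ltnNge; apply/negP => h; have := smax u; lia.
have ns : s <> w by move=> E; move: Gs; rewrite E dn ltnn.
have GE : G s = G w.+1 by have := gt s.+1; have := Gstep (u := s); lia.
exists s; first by apply: smax; lia.
by split; [lia|exact: GE|rewrite GE].
Qed.

Lemma matched_upE v w : matched v w -> G v.+1 = (G v).+1.
Proof. by case=> h e gt; have := gt v.+1; have := Gstep (u := v); lia. Qed.
Lemma matched_downE v w : matched v w -> G w = (G w.+1).+1.
Proof. by case=> h e gt; have := gt w; have := Gstep (u := w); lia. Qed.

Lemma matched_injr v w w' : matched v w -> matched v w' -> w = w'.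
Proof.
move=> [h e gt] [h' e' gt']; case: (ltngtP w w') => // lt.
  by have := gt' w.+1; lia.
by have := gt w'.+1; lia.
Qed.
Lemma matched_injl v v' w : matched v w -> matched v' w -> v = v'.
Proof.
move=> [h e gt] [h' e' gt']; case: (ltngtP v v') => // lt.
  by have := gt v'; lia.
by have := gt' v; lia.
Qed.

Lemma path_cups : exists mate : nat -> nat,
  [/\ cups m mate, forall u, (u < m)%N -> (u < mate u)%N = (G u < G u.+1)%N,
      forall u, (u < m)%N -> (mate u < u)%N -> matched (mate u) u,
      forall u, (u < m)%N -> mate u = u -> forall s, (s <= u)%N -> (G u.+1 < G s)%N &
      forall s, (s <= m)%N -> ((nop mate s m).*2 + G s)%N = (m - s)%N].
Proof.
have ex u : exists w, (matched u w \/ matched w u) \/ (w = u /\ forall w, ~ matched u w /\ ~ matched w u).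
  have [[w h]|h1] := pselect (exists w, matched u w); first by exists w; left; left.
  have [[w h]|h2] := pselect (exists w, matched w u); first by exists w; left; right.
  exists u; right; split=> // w; split=> h; [apply: h1|apply: h2]; by exists w.
have [mate hm] := choice ex.
have mr v w : matched v w -> mate v = w.
  move=> h; case: (hm v) => [[h'|h']|[_ /(_ w)[]//]]; first exact: matched_injr h' h.
  by have := matched_upE h; have := matched_downE h'; lia.
have ml v w : matched v w -> mate w = v.
  move=> h; case: (hm w) => [[h'|h']|[_ /(_ v)[_]//]]; last exact: matched_injl h' h.
  by have := matched_upE h'; have := matched_downE h; lia.
have op u : (u < m)%N -> (u < mate u)%N = (G u < G u.+1)%N.
  move=> um; apply/idP/idP => h.
    case: (hm u) => [[h'|[h' _]]|[E _]]; [by have := matched_upE h'; lia|lia|lia].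
  have [w h'] := matched_up um ltac:(have := Gstep um; lia).
  by rewrite (mr _ _ h'); case: h'; lia.
have cl u : (u < m)%N -> (mate u < u)%N -> matched (mate u) u.
  move=> um lt; case: (hm u) => [[h'|//]|[E _]]; last by lia.
  by case: h'; lia.
have ray u : (u < m)%N -> mate u = u -> forall s, (s <= u)%N -> (G u.+1 < G s)%N.
  move=> um uu s su; rewrite ltnNge; apply/negP => Gs.
  have dn : G u = (G u.+1).+1 by have := op u um; have := Gstep um; lia.
  have [|s' _ h] := matched_down (v := s) _ dn Gs; first by lia.
  by have := ml _ _ h; case: h; lia.
have opm v : (v < m)%N -> (v < mate v)%N -> matched v (mate v).
  move=> vm lt; case: (hm v) => [[//|h']|[E _]]; last by lia.
  by case: h'; lia.
exists mate; split=> //.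
  split.
  - move=> v vm; case: (ltngtP (mate v) v) => h; [lia| |lia].
    by have := opm v vm h; case; lia.
  - move=> v vm; case: (ltngtP (mate v) v) => h.
    + exact: mr (cl v vm h).
    + exact: ml (opm v vm h).
    + by rewrite !h.
  - move=> v u vm hu uu; have [h e gt] := opm v vm ltac:(lia).
    by have := ray u ltac:(lia) uu v; have := gt u.+1; lia.
  move=> v u vm hu; have [h e gt] := opm v vm ltac:(lia).
  have um : (u < m)%N by lia.
  case: (ltngtP (mate u) u) => lt.
  - have M := cl u um lt; have [h' e' gt'] := M.
    have := gt' v; have := gt u.+1; have [E|] := eqVneq v (mate u); last by lia.
    by move: M; rewrite -E => /mr; lia.
  - have M := opm u um lt; have [h' e' gt'] := M.
    have := gt' (mate v).+1; have := gt u; have [E|] := eqVneq (mate u) (mate v); last by lia.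
    by move: M; rewrite E => /ml; rewrite (ml _ _ (opm v vm ltac:(lia))); lia.
  - by have := ray u um lt v; have := gt u.+1; lia.
move=> s sm; have [d] := ubnP (m - s); elim: d s sm => // d IH s sm hd.
have [->|ne] := eqVneq s m; first by rewrite nop0 Gm subnn.
have sm' : (s < m)%N by lia.
have := IH s.+1 sm' ltac:(lia); rewrite (@nop_cat mate s s.+1) // nop1 /opener op //.
by have := Gstep sm'; case: ltnP => ? [] ?; rewrite /nat_of_bool; lia.
Qed.

(** A cup or ray ending at level 0 is not enclosed, since the level is positive
    inside a cup, and no ray follows it, since a ray reaches a new minimum. *)
Lemma path_marking mate (q : nat -> bool) : cups m mate ->
  (forall u, (u < m)%N -> (mate u < u)%N -> matched (mate u) u) ->
  (forall u, (u < m)%N -> mate u = u -> forall s, (s <= u)%N -> (G u.+1 < G s)%N) ->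
  marking m mate (fun u => let w := maxn u (mate u) in (G w.+1 == 0%N) && q w).
Proof.
move=> D cl ray v vm /andP[/eqP G0 qw].
have wm : (maxn v (mate v) < m)%N by have := mate_lt D vm; lia.
split.
- by rewrite /= (mateK D) // (maxnC (mate v)) G0 qw.
- by move=> u um hu uu; have := ray u um uu (maxn v (mate v)).+1; rewrite G0; lia.
move=> u um [h1 h2]; have mu := mate_lt D um.
have := cl (mate u) mu; rewrite (mateK D) // => /(_ ltac:(lia)) [h e gt].
by have := gt (maxn v (mate v)).+1; rewrite G0; lia.
Qed.

End Path.

(** * Polynomial families of vectors and subspaces *)

Section Polynomials.
Variable K : numFieldType.

Definition polyK (a : K -> K) := exists P : {poly K}, forall t, a t = P.[t].

Lemma polyK_ext a a' : a =1 a' -> polyK a -> polyK a'.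
Proof. by move=> E [P h]; exists P => t; rewrite -E. Qed.
Lemma polyK_const c : polyK (fun _ => c).
Proof. by exists c%:P => t; rewrite hornerC. Qed.
Lemma polyK_id : polyK id.
Proof. by exists 'X => t; rewrite hornerX. Qed.
Lemma polyK_add a b : polyK a -> polyK b -> polyK (fun t => a t + b t).
Proof. by move=> [P hP] [Q hQ]; exists (P + Q) => t; rewrite hornerD hP hQ. Qed.
Lemma polyK_mul a b : polyK a -> polyK b -> polyK (fun t => a t * b t).
Proof. by move=> [P hP] [Q hQ]; exists (P * Q) => t; rewrite hornerM hP hQ. Qed.
Lemma polyK_opp a : polyK a -> polyK (fun t => - a t).
Proof. by move=> [P hP]; exists (- P) => t; rewrite hornerN hP. Qed.
Lemma polyK_sum (I : finType) (a : I -> K -> K) : (forall i, polyK (a i)) ->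
  polyK (fun t => \sum_i a i t).
Proof.
move=> h; have [P hP] := choice h; exists (\sum_i P i) => t.
by rewrite horner_sum; apply: eq_bigr.
Qed.
Lemma polyK_det d (M : K -> 'M[K]_d) : (forall i j, polyK (fun t => M t i j)) ->
  polyK (fun t => \det (M t)).
Proof.
have ex' i : (forall j, polyK (fun t => M t i j)) -> exists f : 'I_d -> {poly K}, forall j t, M t i j = (f j).[t].
  by move=> hi; have [f hf] := choice hi; exists f.
move=> h; have [P hP] := choice (fun i => ex' i (h i)).
exists (\det (\matrix_(i, j) P i j)) => t.
rewrite -[RHS]/(horner_eval t _) -det_map_mx; congr (\det _).
by apply/matrixP => i j; rewrite !mxE hP.
Qed.

(** Q holds at all but finitely many parameters. *)
Definition gen (Q : K -> Prop) := exists2 D : {poly K}, D != 0 & forall t, D.[t] != 0 -> Q t.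

Lemma gen_all (Q : K -> Prop) : (forall t, Q t) -> gen Q.
Proof. by move=> h; exists 1 => //; rewrite oner_neq0. Qed.
Lemma gen_imp (Q Q' : K -> Prop) : (forall t, Q t -> Q' t) -> gen Q -> gen Q'.
Proof. by move=> h [D D0 hD]; exists D => // t /hD/h. Qed.
Lemma gen_and (Q Q' : K -> Prop) : gen Q -> gen Q' -> gen (fun t => Q t /\ Q' t).
Proof.
move=> [D D0 hD] [E E0 hE]; exists (D * E); first by rewrite mulf_neq0.
by move=> t; rewrite hornerM mulf_eq0 negb_or => /andP[/hD ? /hE].
Qed.
Lemma gen_neq0 a t0 : polyK a -> a t0 != 0 -> gen (fun t => a t != 0).
Proof.
move=> [P hP]; rewrite hP => P0; exists P => [|t]; last by rewrite hP.
by apply: contra P0 => /eqP ->; rewrite horner0.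
Qed.
Lemma gen_exists (Q : K -> Prop) : gen Q -> exists t, Q t.
Proof.
move=> [D D0 hD].
have [/allP h|] := boolP (all (root D) [seq i%:R | i <- iota 0 (size D)]); last first.
  by case/allPn=> t _; rewrite /root => /hD; exists t.
have := max_poly_roots D0 (introT allP h).
rewrite map_inj_uniq ?iota_uniq ?size_map ?size_iota ?ltnn; first by move/(_ isT).
by apply: (mulrIn (oner_neq0 K)).
Qed.

End Polynomials.

Section Families.
Variables (K : numFieldType) (V : vectType K).

(** The flag spanned by a sequence of vectors, the form in which flags are moved. *)
Definition spanb (b : nat -> V) (i : nat) : {vspace V} := <<mkseq b i>>%VS.

Lemma spanb0 b : spanb b 0 = 0%VS.
Proof. by rewrite /spanb /mkseq span_nil. Qed.

Lemma spanbS b i : spanb b i.+1 = (spanb b i + <[b i]>)%VS.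
Proof. by rewrite /spanb /mkseq -addn1 iotaD map_cat span_cat /= span_seq1. Qed.

Lemma eq_spanb b b' i : (forall s, (s < i)%N -> b s = b' s) -> spanb b i = spanb b' i.
Proof.
move=> E; rewrite /spanb; congr (span _); apply/eq_in_map => s.
by rewrite mem_iota add0n => /andP[_ si]; apply: E.
Qed.

Lemma mem_spanb b i v : v \in spanb b i -> exists a : nat -> K, v = \sum_(s < i) a s *: b s.
Proof.
elim: i v => [|i IH] v.
  by rewrite spanb0 memv0 => /eqP ->; exists (fun _ => 0); rewrite big_ord0.
rewrite spanbS => /memv_addP[u /IH[a uE] [_ /vlineP[c ->] vE]].
exists (fun s => if s == i then c else a s); rewrite big_ord_recr /= eqxx vE uE; congr (_ + _).
by apply: eq_bigr => s _; rewrite ltn_eqF.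
Qed.

Lemma spanb_mem b i s : (s < i)%N -> b s \in spanb b i.
Proof. by move=> si; apply/memv_span/map_f; rewrite mem_iota. Qed.

Definition polyV (w : K -> V) := exists P : 'I_(\dim (@fullv K V)) -> {poly K},
  forall t, w t = \sum_i (P i).[t] *: (vbasis fullv)`_i.

Lemma polyV_ext w w' : w =1 w' -> polyV w -> polyV w'.
Proof. by move=> E [P h]; exists P => t; rewrite -E. Qed.
Lemma polyV_const (v : V) : polyV (fun _ => v).
Proof.
exists (fun i => (coord (vbasis fullv) i v)%:P) => t.
rewrite {1}(coord_vbasis (memvf v)); apply: eq_bigr => i _; by rewrite hornerC.
Qed.
Lemma polyV_add w w' : polyV w -> polyV w' -> polyV (fun t => w t + w' t).
Proof.
move=> [P hP] [Q hQ]; exists (fun i => P i + Q i) => t; rewrite hP hQ -big_split /=.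
by apply: eq_bigr => i _; rewrite hornerD scalerDl.
Qed.
Lemma polyV_scale a w : polyK a -> polyV w -> polyV (fun t => a t *: w t).
Proof.
move=> [P hP] [Q hQ]; exists (fun i => P * Q i) => t; rewrite hP hQ scaler_sumr.
by apply: eq_bigr => i _; rewrite hornerM scalerA.
Qed.
Lemma polyV_sum (I : finType) (w : I -> K -> V) : (forall i, polyV (w i)) ->
  polyV (fun t => \sum_i w i t).
Proof.
move=> h; have [P hP] := choice h; exists (fun j => \sum_i P i j) => t.
rewrite (eq_bigr (fun i => \sum_j (P i j).[t] *: (vbasis fullv)`_j)) => [|i _]; last exact: hP.
rewrite exchange_big /=; apply: eq_bigr => j _; by rewrite horner_sum scaler_suml.
Qed.
Lemma polyV_img (f : 'End(V)) w : polyV w -> polyV (fun t => f (w t)).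
Proof.
move=> [P hP]; apply: (@polyV_ext (fun t => \sum_i (P i).[t] *: f (vbasis fullv)`_i)).
  by move=> t; rewrite hP linear_sum; apply: eq_bigr => i _; rewrite linearZ.
by apply: polyV_sum => i; apply: polyV_scale; [exists (P i)|exact: polyV_const].
Qed.
Lemma polyV_fun (phi : V -> K) w : (forall u v, phi (u + v) = phi u + phi v) ->
  (forall c u, phi (c *: u) = c * phi u) -> polyV w -> polyK (fun t => phi (w t)).
Proof.
move=> hD hZ [P hP]; apply: (@polyK_ext K (fun t => \sum_i (P i).[t] * phi (vbasis fullv)`_i)).
  move=> t; rewrite hP (big_morph phi hD (_ : phi 0 = 0)); last by rewrite -(scale0r 0) hZ mul0r.
  by apply: eq_bigr => i _; rewrite hZ.
by apply: polyK_sum => i; apply: polyK_mul; [exists (P i)|exact: polyK_const].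
Qed.

End Families.

(** * The two-row space *)

(** The properties of the space, the form and the nilpotent map on which the
    geometry depends.  Keeping them abstract separates it from the computations
    with explicit matrices, which enter only in the instance [standard].  [xp r]
    is the power x^r, [ecoef i] and [fcoef i] are the coordinates along e_(i+1) and
    f_(i+1), and gam makes f_((k+1)/2) + c e_((p+1)/2) isotropic for c = gam and c = - gam. *)
Record two_row_space (K : numFieldType) (V : vectType K) (p k : nat) := TwoRowSpace {
  two_row_ge : (k <= p)%N;
  two_row_gt0 : (0 < k)%N;
  two_row_par : p = k \/ (odd p /\ odd k);
  beta : V -> V -> K;
  betaC : forall u v, beta u v = beta v u;
  betaDr : forall u v w, beta u (v + w) = beta u v + beta u w;
  betaZr : forall u c v, beta u (c *: v) = c * beta u v;
  perp : {vspace V} -> {vspace V};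
  perpP : forall (U : {vspace V}) v, reflect (forall u, u \in U -> beta u v = 0) (v \in perp U);
  dim_perp : forall U, (\dim (perp U) + \dim U)%N = (p + k)%N;
  xp : nat -> 'End(V);
  xpow0 : forall u, xp 0 u = u;
  xpowD : forall r s u, xp (r + s) u = xp r (xp s u);
  beta_xpow1 : forall u v, beta (xp 1 u) v = - beta u (xp 1 v);
  ev : nat -> V;
  fv : nat -> V;
  ecoef : nat -> V -> K;
  fcoef : nat -> V -> K;
  ecoefD : forall i u v, ecoef i (u + v) = ecoef i u + ecoef i v;
  fcoefD : forall i u v, fcoef i (u + v) = fcoef i u + fcoef i v;
  ecoefZ : forall i c v, ecoef i (c *: v) = c * ecoef i v;
  fcoefZ : forall i c v, fcoef i (c *: v) = c * fcoef i v;
  ecoef_ev : forall i j, ecoef i (ev j) = ((i < p)%N && (i.+1 == j))%:R;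
  fcoef_fv : forall i j, fcoef i (fv j) = ((i < k)%N && (i.+1 == j))%:R;
  ecoef_fv : forall i j, ecoef i (fv j) = 0;
  fcoef_ev : forall i j, fcoef i (ev j) = 0;
  ecoef_out : forall i v, (p <= i)%N -> ecoef i v = 0;
  fcoef_out : forall i v, (k <= i)%N -> fcoef i v = 0;
  coefP : forall u v, (forall i, ecoef i u = ecoef i v) ->
    (forall i, fcoef i u = fcoef i v) -> u = v;
  xpow1_ev : forall i, (i <= p)%N -> xp 1 (ev i) = ev i.-1;
  xpow1_fv : forall i, (i <= k)%N -> xp 1 (fv i) = fv i.-1;
  beta_ev_ev : forall i j, (p == k) || (i + j != p.+1)%N -> beta (ev i) (ev j) = 0;
  beta_fv_fv : forall i j, (p == k) || (i + j != k.+1)%N -> beta (fv i) (fv j) = 0;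
  beta_ev_fv : forall i j, (p != k) || (i + j != p.+1)%N -> beta (ev i) (fv j) = 0;
  gam : K;
  gam_neq0 : gam != 0;
  beta_mid : p <> k -> forall c, c ^+ 2 = gam ^+ 2 ->
    let w := fv (k./2).+1 + c *: ev (p./2).+1 in beta w w = 0
}.

Section Space.
Variables (K : numFieldType) (V : vectType K) (p k : nat) (S : two_row_space V p k).
Local Notation n := (p + k)%N.
Local Notation m := ((p + k)./2).
Local Notation beta := (beta S).
Local Notation betaC := (betaC S).
Local Notation betaDr := (betaDr S).
Local Notation betaZr := (betaZr S).
Local Notation perp := (perp S).
Local Notation perpP := (perpP S).
Local Notation dim_perp := (dim_perp S).
Local Notation xp := (xp S).
Local Notation xpow0 := (xpow0 S).
Local Notation xpowD := (xpowD S).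
Local Notation beta_xpow1 := (beta_xpow1 S).
Local Notation ev := (ev S).
Local Notation fv := (fv S).
Local Notation ecoef := (ecoef S).
Local Notation fcoef := (fcoef S).
Local Notation ecoefD := (ecoefD S).
Local Notation fcoefD := (fcoefD S).
Local Notation ecoefZ := (ecoefZ S).
Local Notation fcoefZ := (fcoefZ S).
Local Notation ecoef_ev := (ecoef_ev S).
Local Notation fcoef_fv := (fcoef_fv S).
Local Notation ecoef_fv := (ecoef_fv S).
Local Notation fcoef_ev := (fcoef_ev S).
Local Notation ecoef_out := (ecoef_out S).
Local Notation fcoef_out := (fcoef_out S).
Local Notation coefP := (coefP (t:=S)).
Local Notation xpow1_ev := (xpow1_ev S).
Local Notation xpow1_fv := (xpow1_fv S).
Local Notation beta_ev_ev := (beta_ev_ev S).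
Local Notation beta_fv_fv := (beta_fv_fv S).
Local Notation beta_ev_fv := (beta_ev_fv S).
Local Notation gam := (gam S).
Section Subspaces.
Implicit Types u v w : V.
Implicit Types U W G : {vspace V}.

Lemma betaNr u v : beta u (- v) = - beta u v.
Proof. by rewrite -scaleN1r betaZr mulN1r. Qed.
Lemma beta0r u : beta u 0 = 0.
Proof. by rewrite -[X in beta u X](scale0r 0) betaZr mul0r. Qed.

Lemma betaDl u v w : beta (v + w) u = beta v u + beta w u.
Proof. by rewrite !(betaC _ u) betaDr. Qed.
Lemma betaZl u c v : beta (c *: v) u = c * beta v u.
Proof. by rewrite !(betaC _ u) betaZr. Qed.
Lemma betaNl u v : beta (- v) u = - beta v u.
Proof. by rewrite !(betaC _ u) betaNr. Qed.
Lemma beta0l u : beta 0 u = 0.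
Proof. by rewrite !(betaC _ u) beta0r. Qed.

Lemma xpZ r c u : xp r (c *: u) = c *: xp r u.
Proof. exact: linearZ. Qed.
Lemma xpDv r u v : xp r (u + v) = xp r u + xp r v.
Proof. exact: linearD. Qed.
Lemma xpB r u v : xp r (u - v) = xp r u - xp r v.
Proof. exact: linearB. Qed.

Lemma xpowS r u : xp r.+1 u = xp 1 (xp r u).
Proof. exact: (xpowD 1 r). Qed.

Lemma xpowSr r u : xp r.+1 u = xp r (xp 1 u).
Proof. by rewrite -(addn1 r) xpowD. Qed.

Lemma beta_xpow r u v : beta (xp r u) v = (-1) ^+ r * beta u (xp r v).
Proof.
elim: r u v => [|r IH] u v; first by rewrite !xpow0 expr0 mul1r.
by rewrite xpowS beta_xpow1 IH -xpowSr exprS mulN1r mulNr.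
Qed.

Lemma beta_xpow0 r u v : (beta (xp r u) v == 0) = (beta u (xp r v) == 0).
Proof. by rewrite beta_xpow mulf_eq0 signr_eq0. Qed.

Lemma perp0 : perp 0%VS = fullv.
Proof.
apply/eqP; rewrite eqEsubv subvf /=; apply/subvP => v _; apply/perpP => u.
by rewrite memv0 => /eqP ->; rewrite beta0l.
Qed.

Lemma dim_full : \dim (@fullv _ V) = n.
Proof. by have := dim_perp (0%VS : {vspace V}); rewrite perp0 dimv0 addn0. Qed.

Lemma sub_perpC U W : (U <= perp W)%VS = (W <= perp U)%VS.
Proof.
by apply/subvP/subvP => h v vW; apply/perpP => u /h/perpP/(_ _ vW); rewrite betaC.
Qed.

Lemma perpK U : perp (perp U) = U.
Proof.
apply/esym/eqP; rewrite eqEdim sub_perpC subvv /=.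
by have := dim_perp U; have := dim_perp (perp U); lia.
Qed.

Lemma perpS U W : (U <= W)%VS -> (perp W <= perp U)%VS.
Proof. by rewrite -{1}(perpK W) sub_perpC. Qed.

Definition isotropic U := (U <= perp U)%VS.

Lemma isotropicP U :
  reflect (forall u v, u \in U -> v \in U -> beta u v = 0) (isotropic U).
Proof.
apply: (iffP subvP) => [h u v uU /h/perpP|h v vU]; first exact.
by apply/perpP => u uU; apply: h.
Qed.

Lemma isotropicS U W : (U <= W)%VS -> isotropic W -> isotropic U.
Proof. by move=> UW h; apply: subv_trans (subv_trans UW h) (perpS UW). Qed.

Lemma isotropic_dim U : isotropic U -> ((\dim U).*2 <= n)%N.
Proof. by move/dimvS; have := dim_perp U; lia. Qed.

Lemma isotropic_addl U v : isotropic U -> v \in perp U -> beta v v = 0 ->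
  isotropic (U + <[v]>).
Proof.
move=> /isotropicP iU /perpP vU vv; apply/isotropicP => a b.
case/memv_addP=> a1 a1U [_ /vlineP[ca ->] ->]; case/memv_addP=> b1 b1U [_ /vlineP[cb ->] ->].
by rewrite !betaDl !betaDr !betaZl !betaZr iU // vU // (betaC v) vU // vv !mulr0 !addr0.
Qed.

Lemma double_m : m.*2 = n.
Proof.
case: (two_row_par S) => [->|[op ok]]; first by rewrite addnn doubleK.
by have := odd_double_half n; rewrite oddD op ok.
Qed.

(** Preimages and images under the powers of x; perp exchanges them. *)
Definition pre (r : nat) U : {vspace V} := (xp r @^-1: U)%VS.
Definition xim (r : nat) : {vspace V} := limg (xp r).

Lemma mem_pre r U v : (v \in pre r U) = (xp r v \in U).
Proof. by rewrite /pre -memv_preim. Qed.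

Lemma pre_pre r s U : pre r (pre s U) = pre (r + s) U.
Proof. by apply/vspaceP => v; rewrite !mem_pre (addnC r s) xpowD. Qed.

Lemma pre0 U : pre 0 U = U.
Proof. by apply/vspaceP => v; rewrite mem_pre xpow0. Qed.

Lemma preS r U W : (U <= W)%VS -> (pre r U <= pre r W)%VS.
Proof. exact: lpreimS. Qed.

Lemma img_sub_pre r U W : (xp r @: U <= W)%VS = (U <= pre r W)%VS.
Proof.
apply/subvP/subvP => [h v vU|h _ /memv_imgP[v vU ->]]; first by rewrite mem_pre h ?memv_img.
by rewrite -mem_pre h.
Qed.

Lemma mem_xim r u : reflect (exists v, u = xp r v) (u \in xim r).
Proof.
apply: (iffP idP) => [/memv_imgP[v _ ->]|[v ->]]; first by exists v.
by rewrite memv_img ?memvf.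
Qed.

Lemma ximS r s : (r <= s)%N -> (xim s <= xim r)%VS.
Proof.
by move=> rs; apply/subvP => u /mem_xim[v ->]; apply/mem_xim; exists (xp (s - r) v); rewrite -xpowD subnKC.
Qed.

Lemma perp_img r U : perp (xp r @: U) = pre r (perp U).
Proof.
apply/vspaceP => v; rewrite mem_pre; apply/perpP/perpP => [h u uU|h _ /memv_imgP[u uU ->]].
  by apply/eqP; rewrite -beta_xpow0 h // memv_img.
by apply/eqP; rewrite beta_xpow0 h.
Qed.

Lemma perp_pre r U : perp (pre r U) = (xp r @: perp U)%VS.
Proof. by rewrite -{1}(perpK U) -perp_img perpK. Qed.

Lemma ecoef0 i : ecoef i 0 = 0. Proof. by rewrite -(scale0r 0) ecoefZ mul0r. Qed.
Lemma fcoef0 i : fcoef i 0 = 0. Proof. by rewrite -(scale0r 0) fcoefZ mul0r. Qed.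

Definition spef (a b : nat) (s : seq V) : {vspace V} :=
  <<[seq ev l | l <- iota 1 a] ++ [seq fv l | l <- iota 1 b] ++ s>>%VS.

Lemma ecoef_sum i (I : Type) (r : seq I) (F : I -> V) :
  ecoef i (\sum_(j <- r) F j) = \sum_(j <- r) ecoef i (F j).
Proof. by apply: (big_morph (ecoef i)); [move=> *; exact: ecoefD|exact: ecoef0]. Qed.
Lemma fcoef_sum i (I : Type) (r : seq I) (F : I -> V) :
  fcoef i (\sum_(j <- r) F j) = \sum_(j <- r) fcoef i (F j).
Proof. by apply: (big_morph (fcoef i)); [move=> *; exact: fcoefD|exact: fcoef0]. Qed.

Lemma coef_sumE v :
  v = \sum_(l < p) ecoef l v *: ev l.+1 + \sum_(l < k) fcoef l v *: fv l.+1.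
Proof.
apply: coefP => i; rewrite ?ecoefD ?fcoefD !(ecoef_sum, fcoef_sum).
  rewrite [X in _ + X]big1 ?addr0; last by move=> l _; rewrite ecoefZ ecoef_fv mulr0.
  have [h|h] := ltnP i p; last first.
    by rewrite ecoef_out // big1 // => l _; rewrite ecoefZ ecoef_ev ltnNge h mulr0.
  rewrite (bigD1 (Ordinal h)) //= ecoefZ ecoef_ev h eqxx mulr1 big1 ?addr0 // => l.
  by rewrite -val_eqE /= ecoefZ ecoef_ev eqSS h eq_sym => /negPf ->; rewrite mulr0.
rewrite big1 ?add0r; last by move=> l _; rewrite fcoefZ fcoef_ev mulr0.
have [h|h] := ltnP i k; last first.
  by rewrite fcoef_out // big1 // => l _; rewrite fcoefZ fcoef_fv ltnNge h mulr0.
rewrite (bigD1 (Ordinal h)) //= fcoefZ fcoef_fv h eqxx mulr1 big1 ?addr0 // => l.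
by rewrite -val_eqE /= fcoefZ fcoef_fv eqSS h eq_sym => /negPf ->; rewrite mulr0.
Qed.

Lemma ev_out i : ((i == 0) || (p < i))%N -> ev i = 0.
Proof.
by move=> h; apply: coefP => j; rewrite ?ecoef_ev ?fcoef_ev ?ecoef0 ?fcoef0 //; case: ltnP => // jp; have -> : (j.+1 == i) = false by lia.
Qed.
Lemma fv_out i : ((i == 0) || (k < i))%N -> fv i = 0.
Proof.
by move=> h; apply: coefP => j; rewrite ?fcoef_fv ?ecoef_fv ?ecoef0 ?fcoef0 //; case: ltnP => // jp; have -> : (j.+1 == i) = false by lia.
Qed.

Lemma xpow_ev r i : (i <= p)%N -> xp r (ev i) = ev (i - r).
Proof.
elim: r => [|r IH] ip; first by rewrite xpow0 subn0.
by rewrite xpowS IH // xpow1_ev ?subnS //; lia.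
Qed.
Lemma xpow_fv r i : (i <= k)%N -> xp r (fv i) = fv (i - r).
Proof.
elim: r => [|r IH] ip; first by rewrite xpow0 subn0.
by rewrite xpowS IH // xpow1_fv ?subnS //; lia.
Qed.

Lemma ecoef_xpow r i v : ecoef i (xp r v) = ecoef (i + r) v.
Proof.
rewrite {1}(coef_sumE v) linearD !linear_sum ecoefD !ecoef_sum /=.
rewrite [X in _ + X]big1 ?addr0; last first.
  by move=> l _; rewrite linearZ /= xpow_fv // ecoefZ ecoef_fv mulr0.
have [h|h] := ltnP (i + r) p; last first.
  rewrite [RHS]ecoef_out // big1 // => l _; rewrite linearZ /= xpow_ev // ecoefZ ecoef_ev.
  by have -> : (i.+1 == l.+1 - r)%N = false; [have := ltn_ord l; lia|rewrite andbF mulr0].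
rewrite (bigD1 (Ordinal h)) //= linearZ /= xpow_ev // ecoefZ ecoef_ev.
have -> : (i < p)%N && (i.+1 == (i + r).+1 - r)%N by lia.
rewrite mulr1 big1 ?addr0 // => l; rewrite -val_eqE /= => hl.
rewrite linearZ /= xpow_ev // ecoefZ ecoef_ev.
by have -> : (i.+1 == l.+1 - r)%N = false; [lia|rewrite andbF mulr0].
Qed.
Lemma fcoef_xpow r i v : fcoef i (xp r v) = fcoef (i + r) v.
Proof.
rewrite {1}(coef_sumE v) linearD !linear_sum fcoefD !fcoef_sum /=.
rewrite big1 ?add0r; last first.
  by move=> l _; rewrite linearZ /= xpow_ev // fcoefZ fcoef_ev mulr0.
have [h|h] := ltnP (i + r) k; last first.
  rewrite [RHS]fcoef_out // big1 // => l _; rewrite linearZ /= xpow_fv // fcoefZ fcoef_fv.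
  by have -> : (i.+1 == l.+1 - r)%N = false; [have := ltn_ord l; lia|rewrite andbF mulr0].
rewrite (bigD1 (Ordinal h)) //= linearZ /= xpow_fv // fcoefZ fcoef_fv.
have -> : (i < k)%N && (i.+1 == (i + r).+1 - r)%N by lia.
rewrite mulr1 big1 ?addr0 // => l; rewrite -val_eqE /= => hl.
rewrite linearZ /= xpow_fv // fcoefZ fcoef_fv.
by have -> : (i.+1 == l.+1 - r)%N = false; [lia|rewrite andbF mulr0].
Qed.

Lemma spef_cat a b s : spef a b s = (spef a b [::] + <<s>>)%VS.
Proof. by rewrite /spef catA span_cat cats0. Qed.

Lemma spef_sub a b U :
  (forall l, (1 <= l <= a)%N -> ev l \in U) -> (forall l, (1 <= l <= b)%N -> fv l \in U) ->
  (spef a b [::] <= U)%VS.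
Proof.
move=> he hf; apply/span_subvP => u; rewrite cats0 mem_cat.
by case/orP=> /mapP[l]; rewrite mem_iota => hl ->; [apply: he|apply: hf]; lia.
Qed.

Lemma ev_spef l a b : (l <= a)%N -> ev l \in spef a b [::].
Proof.
case: l => [|l] h; first by rewrite ev_out ?mem0v.
by apply: memv_span; rewrite mem_cat map_f // mem_iota; lia.
Qed.
Lemma fv_spef l a b : (l <= b)%N -> fv l \in spef a b [::].
Proof.
case: l => [|l] h; first by rewrite fv_out ?mem0v.
by apply: memv_span; rewrite cats0 mem_cat orbC map_f // mem_iota; lia.
Qed.

Lemma mem_spef a b v : reflect
  ((forall i, (a <= i)%N -> ecoef i v = 0) /\ (forall i, (b <= i)%N -> fcoef i v = 0))
  (v \in spef a b [::]).
Proof.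
apply: (iffP idP) => [vs|[he hf]].
  have hsum : forall I (r : seq I) (F : I -> V) (c : V -> K),
      (forall u w, c (u + w) = c u + c w) -> c 0 = 0 ->
      c (\sum_(j <- r) F j) = \sum_(j <- r) c (F j).
    by move=> I r F c cD c0; apply: (big_morph c).
  have P (c : V -> K) : (forall u w, c (u + w) = c u + c w) -> (forall x u, c (x *: u) = x * c u) ->
      (forall l, (1 <= l <= a)%N -> c (ev l) = 0) -> (forall l, (1 <= l <= b)%N -> c (fv l) = 0) -> c v = 0.
    move=> cD cZ ce cf; rewrite (coord_span (X := in_tuple _) vs) hsum //; last by rewrite -(scale0r 0) cZ mul0r.
    apply: big1 => j _; rewrite cZ.
    have := mem_nth 0 (ltn_ord j); rewrite /=; move: (_`_j) (coord _ _ _) => w d.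
    rewrite cats0 mem_cat.
    by case/orP=> /mapP[l]; rewrite mem_iota => hl ->; rewrite ?ce ?cf ?mulr0 //; lia.
  split=> i hi.
    apply: (P (ecoef i)) => *; rewrite ?ecoefD ?ecoefZ ?ecoef_fv ?ecoef_ev //.
    by rewrite (_ : (_ == _) = false) ?andbF //; lia.
  apply: (P (fcoef i)) => *; rewrite ?fcoefD ?fcoefZ ?fcoef_ev ?fcoef_fv //.
  by rewrite (_ : (_ == _) = false) ?andbF //; lia.
rewrite (coef_sumE v); apply: memvD; apply: memv_suml => l _.
  have [h|h] := ltnP l a; last by rewrite he // scale0r mem0v.
  by apply/memvZ/ev_spef.
have [h|h] := ltnP l b; last by rewrite hf // scale0r mem0v.
by apply/memvZ/fv_spef.
Qed.

Lemma pre_spef r a b : pre r (spef a b [::]) = spef (a + r) (b + r) [::].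
Proof.
apply/vspaceP => v; rewrite mem_pre; apply/mem_spef/mem_spef => -[he hf]; split=> i hi.
- by have := he (i - r)%N; rewrite ecoef_xpow subnK; [apply; lia|lia].
- by have := hf (i - r)%N; rewrite fcoef_xpow subnK; [apply; lia|lia].
- by rewrite ecoef_xpow he //; lia.
- by rewrite fcoef_xpow hf //; lia.
Qed.

Lemma spef00 : spef 0 0 [::] = 0%VS.
Proof. by apply/eqP; rewrite -subv0; apply: spef_sub => l hl; lia. Qed.

Lemma spef_full : spef p k [::] = fullv.
Proof.
apply/eqP; rewrite eqEsubv subvf /=; apply/subvP => v _.
by apply/mem_spef; split => i hi; rewrite ?ecoef_out ?fcoef_out.
Qed.

Lemma spefS a b a' b' : (a <= a')%N -> (b <= b')%N -> (spef a b [::] <= spef a' b' [::])%VS.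
Proof. by move=> ha hb; apply: spef_sub => l hl; [apply: ev_spef|apply: fv_spef]; lia. Qed.

Lemma dim_spef_le a b : (\dim (spef a b [::]) <= a + b)%N.
Proof. by apply: leq_trans (dim_span _) _; rewrite cats0 size_cat !size_map !size_iota. Qed.

Lemma dim_spef a b : (a <= p)%N -> (b <= k)%N -> \dim (spef a b [::]) = (a + b)%N.
Proof.
move=> ap bk; apply/eqP; rewrite eqn_leq dim_spef_le /=.
pose W := <<[seq ev l | l <- iota a.+1 (p - a)] ++ [seq fv l | l <- iota b.+1 (k - b)]>>%VS.
have hW : (\dim W <= (p - a) + (k - b))%N.
  by apply: leq_trans (dim_span _) _; rewrite size_cat !size_map !size_iota.
have : (spef p k [::] <= spef a b [::] + W)%VS.
  apply: spef_sub => l hl.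
    have [h|h] := leqP l a; first by apply: (subvP (addvSl _ _)); apply: ev_spef.
    apply: (subvP (addvSr _ _)); apply: memv_span; rewrite mem_cat map_f //.
    by rewrite mem_iota; lia.
  have [h|h] := leqP l b; first by apply: (subvP (addvSl _ _)); apply: fv_spef.
  apply: (subvP (addvSr _ _)); apply: memv_span; rewrite mem_cat orbC map_f //.
  by rewrite mem_iota; lia.
rewrite spef_full => /dimvS; rewrite dim_full.
by have := leq_of_leqif (dimv_add_leqif (spef a b [::]) W); lia.
Qed.

Lemma lker_xpow r : lker (xp r) = spef r r [::].
Proof. by rewrite -lpreim0 -spef00 -[LHS]/(pre r _) pre_spef !add0n. Qed.

Lemma xpow_out r v : (p <= r)%N -> xp r v = 0.
Proof.
move=> pr; apply/eqP; rewrite -memv_ker lker_xpow; apply/mem_spef.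
by have := two_row_ge S; split => i hi; rewrite ?ecoef_out ?fcoef_out //; lia.
Qed.

Lemma dim_pre r U : \dim (pre r U) = (\dim (U :&: xim r) + \dim (lker (xp r)))%N.
Proof.
rewrite -(limg_ker_dim (xp r) (pre r U)) addnC; congr (_ + _)%N; congr (\dim _).
  apply/eqP; rewrite eqEsubv; apply/andP; split.
    by rewrite subv_cap img_sub_pre subvv /= limgS // subvf.
  apply/subvP => u /memv_capP[uU /mem_xim[v e]].
  by rewrite e memv_img // mem_pre -e.
by apply/capv_idPr/subvP => v; rewrite memv_ker mem_pre => /eqP ->; rewrite mem0v.
Qed.

Lemma dim_pre_le r U : (\dim (pre r U) <= \dim U + r.*2)%N.
Proof.
rewrite dim_pre leq_add ?dimvS ?capvSl // lker_xpow -addnn; exact: dim_spef_le.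
Qed.

Lemma dim_pre_im r U : (r <= k)%N -> (U <= xim r)%VS -> \dim (pre r U) = (\dim U + r.*2)%N.
Proof.
move=> rk /capv_idPl; have := two_row_ge S => kp.
by rewrite dim_pre => ->; rewrite lker_xpow dim_spef ?addnn // (leq_trans rk).
Qed.

Lemma dim_pre_xim r U : (\dim U + r.*2 <= \dim (pre r U))%N -> (U <= xim r)%VS.
Proof.
rewrite dim_pre => h; apply/capv_idPl/eqP; rewrite eqEdim capvSl /=.
by have := dim_spef_le r r; rewrite -lker_xpow; move: h; set d := \dim (_ :&: _); lia.
Qed.

Lemma lker_xim a b : (a + b <= k)%N -> (spef a a [::] <= xim b)%VS.
Proof.
have := two_row_ge S => kp abk; apply: spef_sub => l hl; apply/mem_xim.
  by exists (ev (l + b)); rewrite xpow_ev ?addnK //; lia.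
by exists (fv (l + b)); rewrite xpow_fv ?addnK //; lia.
Qed.

Lemma pre_xim r s U : (r + s <= k)%N -> (U <= xim (r + s))%VS -> (pre r U <= xim s)%VS.
Proof.
move=> rsk /subvP h; apply/subvP => v; rewrite mem_pre => /h /mem_xim[u e].
have : v - xp s u \in lker (xp r) by rewrite memv_ker linearB /= e xpowD subrr.
rewrite lker_xpow => /(subvP (lker_xim rsk)) h1.
by rewrite -(subrK (xp s u) v) memvD //; apply/mem_xim; exists u.
Qed.

Lemma xim_pre1 r U W : (r.+1 <= k)%N -> (U <= xim r.+1)%VS -> (W <= pre 1 U)%VS -> (W <= xim r)%VS.
Proof. by move=> rk Ur WU; apply: subv_trans WU _; apply: pre_xim; rewrite ?add1n. Qed.

Lemma img_pre r U : (U <= xim r)%VS -> (xp r @: pre r U)%VS = U.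
Proof. exact: lpreimK. Qed.

Lemma lker_pre r U : (spef r r [::] <= pre r U)%VS.
Proof. by rewrite -lker_xpow; apply/subvP => v; rewrite memv_ker mem_pre => /eqP ->; rewrite mem0v. Qed.

Lemma beta_spef a b v :
  (forall l, (1 <= l <= a)%N -> beta (ev l) v = 0) -> (forall l, (1 <= l <= b)%N -> beta (fv l) v = 0) ->
  v \in perp (spef a b [::]).
Proof.
move=> he hf; rewrite -[_ \in _]/(<[v]> <= _)%VS sub_perpC.
by apply: spef_sub => l hl; apply/perpP => _ /vlineP[c ->]; rewrite betaC betaZr ?he ?hf ?mulr0.
Qed.

Lemma isotropic_spef a b :
  (if p == k then a + b <= p else (a.*2 <= p) && (b.*2 <= k))%N -> isotropic (spef a b [::]).
Proof.
move=> h; apply: spef_sub => l hl; apply: beta_spef => l' hl'.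
- by apply: beta_ev_ev; case: eqP h; lia.
- by rewrite betaC; apply: beta_ev_fv; case: eqP h; lia.
- by apply: beta_ev_fv; case: eqP h; lia.
- by apply: beta_fv_fv; case: eqP h; lia.
Qed.

(** * Lagrangian subspaces *)

Definition lagrangian G := isotropic G /\ \dim G = m.

Lemma perpD U W : perp (U + W) = (perp U :&: perp W)%VS.
Proof.
apply/vspaceP => v; rewrite memv_cap; apply/idP/andP => [h|[hU hW]].
  by split; apply: (subvP (perpS _)) h; rewrite ?addvSl ?addvSr.
apply/perpP => _ /memv_addP[a aU [b bW ->]].
by rewrite betaDl (perpP _ _ hU) // (perpP _ _ hW) // addr0.
Qed.

Lemma lag_perp G : lagrangian G -> perp G = G.
Proof.
move=> [iG dG]; apply/esym/eqP; rewrite eqEdim -/(isotropic G) iG dG /=.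
by have := dim_perp G; have := double_m; lia.
Qed.

Lemma iso_lag G : isotropic G -> (m <= \dim G)%N -> lagrangian G.
Proof.
by move=> iG h; split=> //; have := isotropic_dim iG; have := double_m; lia.
Qed.

Lemma dim_perp_hyper U : (\dim U).+1 = m -> \dim (perp U) = m.+1.
Proof. by have := dim_perp U; have := double_m; lia. Qed.

Lemma lag_beta G u v : lagrangian G -> u \in G -> v \in G -> beta u v = 0.
Proof. by case=> /isotropicP + _; apply. Qed.

Lemma dim_add_line U v : v \notin U -> \dim (U + <[v]>) = (\dim U).+1.
Proof.
move=> vU; rewrite dimv_disjoint_sum ?dim_vline.
  by case: eqP vU => [->|]; rewrite ?mem0v ?addn1.
apply/eqP; rewrite -subv0; apply/subvP => w /memv_capP[wU /vlineP[c wE]].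
have [c0|c0] := eqVneq c 0; first by rewrite wE c0 scale0r mem0v.
by case/negP: vU; rewrite -(scalerK c0 v) -wE memvZ.
Qed.

Lemma add_lineE U W v : (U <= W)%VS -> \dim W = (\dim U).+1 -> v \in W -> v \notin U ->
  W = (U + <[v]>)%VS.
Proof.
move=> UW dW vW vU; apply/esym/eqP; rewrite eqEdim dim_add_line // dW leqnn andbT.
by rewrite subv_add UW -memvE.
Qed.

Lemma notin_sub U W : ~~ (W <= U)%VS -> {v | v \in W & v \notin U}.
Proof. by move=> h; apply/sig2W/subvPn. Qed.

Lemma dim_lt_notin U W : (\dim U < \dim W)%N -> {v | v \in W & v \notin U}.
Proof. by move=> h; apply: notin_sub; apply: contraL h => /dimvS; rewrite -leqNgt. Qed.

(** The orthogonal of a hyperplane I of a Lagrangian, modulo I, is a hyperbolic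
    plane, which has only two isotropic lines. *)
Lemma two_lag I L0 L1 L2 :
  lagrangian L0 -> lagrangian L1 -> lagrangian L2 ->
  (I <= L0)%VS -> (I <= L1)%VS -> (I <= L2)%VS -> (\dim I).+1 = m ->
  L0 <> L1 -> L0 <> L2 -> L1 = L2.
Proof.
move=> l0 l1 l2 I0 I1 I2 dI n01 n02.
have d (L : {vspace V}) : lagrangian L -> \dim L = (\dim I).+1 by case=> _ ->.
have [g gL gI] := dim_lt_notin (eq_leq (esym (d _ l0))).
have [h hL hI] := dim_lt_notin (eq_leq (esym (d _ l1))).
have [u uL uI] := dim_lt_notin (eq_leq (esym (d _ l2))).
have e0 := add_lineE I0 (d _ l0) gL gI.
have e1 := add_lineE I1 (d _ l1) hL hI.
have e2 := add_lineE I2 (d _ l2) uL uI.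
have hL0 : h \notin L0.
  apply/negP => h0; apply: n01; apply/esym/eqP; rewrite eqEdim (d _ l0) (d _ l1) leqnn andbT.
  by rewrite {1}e1 subv_add I0 -memvE.
have iP (L : {vspace V}) w : lagrangian L -> (I <= L)%VS -> w \in L -> w \in perp I.
  by move=> lL IL wL; apply: (subvP (perpS IL)); rewrite lag_perp.
have gh : beta g h != 0.
  apply: contra hL0 => /eqP gh; rewrite -(lag_perp l0); apply/perpP => w.
  rewrite {1}e0 => /memv_addP[i iI [_ /vlineP[c ->] ->]].
  by rewrite betaDl betaZl gh mulr0 addr0 (perpP _ _ (iP _ _ l1 I1 hL)).
have : u \in (L0 + <[h]>)%VS.
  suff <- : perp I = (L0 + <[h]>)%VS by apply: iP uL.
  apply/esym/eqP; rewrite eqEdim subv_add -memvE (iP _ _ l1) // dim_add_line //.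
  by rewrite -{1}(lag_perp l0) perpS //= (d _ l0) dim_perp_hyper // dI.
case/memv_addP=> l l0L [_ /vlineP[b ->] uE].
move: l0L uE; rewrite {1}e0 => /memv_addP[i iI [_ /vlineP[a ->] ->]] uE.
have uu : beta u u = 0 by apply: (lag_beta l2).
move: uu; rewrite uE !betaDl !betaDr !betaZl !betaZr.
have ig : beta i g = 0 by apply: (lag_beta l0) => //; apply: (subvP I0).
have ih : beta i h = 0 by apply: (lag_beta l1) => //; apply: (subvP I1).
have ii : beta i i = 0 by apply: (lag_beta l0) => //; apply: (subvP I0).
rewrite (betaC g i) (betaC h i) (betaC h g) ig ih ii (lag_beta l0 gL gL) (lag_beta l1 hL hL).
move=> z0; have {z0} /eqP : (2 * (a * b)) * beta g h = 0 by rewrite -[RHS]z0; ring.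
rewrite mulf_eq0 (negPf gh) orbF mulf_eq0 pnatr_eq0 /= mulf_eq0.
case/orP=> /eqP z; move: uE; rewrite z scale0r ?addr0 => uE.
  apply/esym/eqP; rewrite eqEdim (d _ l1) (d _ l2) leqnn andbT e2 subv_add I1 -memvE uE.
  by rewrite memvD ?memvZ // (subvP I1).
case: n02; apply/esym/eqP; rewrite eqEdim (d _ l0) (d _ l2) leqnn andbT e2 subv_add I0 -memvE uE.
by rewrite memvD ?memvZ // (subvP I0).
Qed.

(** On that hyperbolic plane the nilpotent skew operator x vanishes. *)
Lemma xpow_perp_hyperplane I L : lagrangian L -> (I <= L)%VS -> (\dim I).+1 = m ->
  (xp 1 @: I <= I)%VS -> (xp 1 @: perp I <= I)%VS.
Proof.
move=> lL IL dI xI; case: (lL) => iL dL.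
have x0 v : beta (xp 1 v) v = 0.
  have /eqP := beta_xpow1 v v; rewrite (betaC v) -addr_eq0 -mulr2n mulrn_eq0 /=.
  by move/eqP.
have xIv i : i \in I -> xp 1 i \in I by move=> iI; apply: (subvP xI); apply: memv_img.
have Lp v : v \in perp L -> v \in L by rewrite lag_perp.
have pI v : v \in L -> v \in perp I by move=> vL; apply: (subvP (perpS IL)); rewrite lag_perp.
have [g gL gI] := dim_lt_notin (eq_leq (etrans dI (esym dL))).
have e := add_lineE IL (etrans dL (esym dI)) gL gI.
have inL v : v \in perp I -> beta g v = 0 -> v \in L.
  move=> vI gv; apply: Lp; apply/perpP => w; rewrite {1}e => /memv_addP[i iI [_ /vlineP[c ->] ->]].
  by rewrite betaDl betaZl gv mulr0 addr0 (perpP _ _ vI).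
have xpI v : v \in perp I -> xp 1 v \in perp I.
  move=> vI; apply/perpP => i iI; rewrite betaC beta_xpow1 betaC (perpP _ _ vI) ?oppr0 //; exact: xIv.
(* x acts on the line L / I by a scalar c, which is 0 by nilpotency *)
have xg : xp 1 g \in I.
  have : xp 1 g \in L by apply: inL; [exact: (xpI _ (pI _ gL))|by rewrite betaC x0].
  rewrite {1}e => /memv_addP[i iI [_ /vlineP[c ->] xgE]].
  have xr r : xp r g - c ^+ r *: g \in I.
    elim: r => [|r IH]; first by rewrite xpow0 expr0 scale1r subrr mem0v.
    have -> : xp r.+1 g - c ^+ r.+1 *: g = xp 1 (xp r g - c ^+ r *: g) + c ^+ r *: i.
      by rewrite xpB xpZ -xpowS xgE scalerDr scalerA exprSr opprD addrA addrAC subrK.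
    by rewrite memvD ?memvZ // xIv.
  have c0 : c = 0.
    apply/eqP; apply: contraR gI => c0; have := xr p; rewrite xpow_out // sub0r memvN.
    by move=> h; rewrite -(scalerK (expf_neq0 p c0) g) memvZ.
  by rewrite xgE c0 scale0r addr0.
apply/subvP => _ /memv_imgP[v vI ->].
have : xp 1 v \in L.
  by apply: inL; [exact: xpI|rewrite betaC beta_xpow1 betaC (perpP _ _ vI) ?oppr0].
have [gv|gv] := eqVneq (beta g v) 0.
  have := inL _ vI gv; rewrite {1}e => /memv_addP[i iI [_ /vlineP[c ->] ->]] _.
  by rewrite xpDv xpZ memvD ?memvZ // xIv.
rewrite {1}e => /memv_addP[i iI [_ /vlineP[c ->] xvE]].
have := x0 v; rewrite xvE betaDl betaZl (perpP _ _ vI) // add0r => /eqP.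
by rewrite mulf_eq0 (negPf gv) orbF => /eqP ->; rewrite scale0r addr0.
Qed.

(** With W = H cap I^perp, the space W + I is Lagrangian and contains I, so by
    [two_lag] it is G or G'; H meets that one in W and the other one in I cap H. *)
Lemma adjacent_dim I G G' H : lagrangian G -> lagrangian G' -> lagrangian H ->
  (I <= G)%VS -> (I <= G')%VS -> (\dim I).+1 = m -> G <> G' ->
  (\dim (G :&: H) = (\dim (I :&: H)).+1 /\ \dim (G' :&: H) = \dim (I :&: H)) \/
  (\dim (G' :&: H) = (\dim (I :&: H)).+1 /\ \dim (G :&: H) = \dim (I :&: H)).
Proof.
move=> lG lG' lH IG IG' dI nGG'; have m2 := double_m.
have Ip : (I <= perp I)%VS by apply: isotropicS IG _; case: lG.
have pI L : lagrangian L -> (I <= L)%VS -> (L <= perp I)%VS.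
  by move=> lL IL; rewrite -{1}(lag_perp lL) perpS.
pose W := (H :&: perp I)%VS.
have dW : \dim W = (\dim (I :&: H)).+1.
  have -> : W = perp (H + I)%VS by rewrite perpD lag_perp.
  have := dim_perp (H + I)%VS; have := dimv_sum_cap H I; rewrite (capvC H).
  by case: lH => _ ->; lia.
have lW : lagrangian (W + I)%VS.
  apply: iso_lag.
    apply/isotropicP => ? ? /memv_addP[a /memv_capP[aH aI] [b bI ->]].
    move=> /memv_addP[a' /memv_capP[a'H a'I] [b' b'I ->]].
    rewrite !betaDl !betaDr (lag_beta lH) // (betaC a) (perpP _ _ aI) // (perpP _ _ a'I) //.
    by rewrite (perpP _ _ (subvP Ip _ b'I)) // !addr0.
  have := dimv_sum_cap W I; have -> : (W :&: I = I :&: H)%VS.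
    by rewrite /W -capvA (capv_idPr Ip) capvC.
  lia.
have II : (G :&: G' = I)%VS.
  apply/esym/eqP; rewrite eqEdim subv_cap IG IG' /=.
  have : (G :&: G' <= G)%VS by apply: capvSl.
  move=> /dimv_leqif_eq[+ E]; move: E; rewrite (proj2 lG) -dI leq_eqVlt => -> /orP[/eqP E|//].
  case: nGG'; rewrite -[LHS]E; apply/eqP; rewrite eqEdim capvSr /= E.
  by rewrite (proj2 lG) (proj2 lG').
have key L L' : lagrangian L -> (I <= L)%VS -> (I <= L')%VS -> (L :&: L' = I)%VS -> lagrangian L' -> (W + I)%VS = L ->
    \dim (L :&: H) = (\dim (I :&: H)).+1 /\ \dim (L' :&: H) = \dim (I :&: H).
  move=> lL IL IL' LL' lL' E.
  have WL : (L :&: H = W)%VS.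
    apply/eqP; rewrite eqEsubv; apply/andP; split.
      by rewrite /W subv_cap capvSr /= (subv_trans (capvSl _ _) (pI _ lL IL)).
    by rewrite subv_cap -E addvSl /W capvSl.
  split; first by rewrite WL.
  congr (\dim _); apply/eqP; rewrite eqEsubv; apply/andP; split; last first.
    by rewrite subv_cap capvSr (subv_trans (capvSl _ _)).
  rewrite subv_cap capvSr andbT -LL' subv_cap capvSl andbT.
  have : (L' :&: H <= W)%VS by rewrite /W subv_cap capvSr (subv_trans (capvSl _ _)) ?pI.
  by move/subv_trans; apply; rewrite -WL capvSl.
have [E|/eqP E] := eqVneq G (W + I)%VS; first by left; apply: key.
right; apply: key => //; first by rewrite capvC.
by rewrite -(two_lag lG lG' lW IG IG' (addvSr _ _) dI nGG' E).
Qed.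

(** The elementary move to an adjacent Lagrangian. *)
Lemma lag_swap G v : lagrangian G -> v \notin G -> beta v v = 0 ->
  let I := (G :&: perp <[v]>)%VS in
  [/\ (\dim I).+1 = m, lagrangian (I + <[v]>) & G <> (I + <[v]>)%VS].
Proof.
move=> lG vG vv I; have m2 := double_m.
have dI : (\dim I).+1 = m.
  have -> : I = perp (G + <[v]>)%VS by rewrite perpD lag_perp.
  have := dim_perp (G + <[v]>)%VS; rewrite dim_add_line // (proj2 lG); lia.
split=> //; last by move=> E; case/negP: vG; rewrite E -[v \in _]/(<[v]> <= _)%VS addvSr.
apply: iso_lag; last by rewrite dim_add_line ?dI //; apply: contra vG => /memv_capP[].
apply: isotropic_addl => //; first by apply: isotropicS (capvSl _ _) _; case: lG.
by rewrite -[_ \in _]/(<[v]> <= _)%VS sub_perpC capvSr.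
Qed.

(** Two Lagrangians belong to the same family iff their intersection has the
    dimension parity of m; the proof connects them by adjacent Lagrangians. *)
Lemma lag_parity G G' H : lagrangian G -> lagrangian G' -> lagrangian H ->
  odd (\dim (G :&: H) + \dim (G' :&: H)) = odd (m + \dim (G :&: G')).
Proof.
have [d] := ubnP (m - \dim (G :&: G')); elim: d G => // d IH G hd lG lG' lH.
have [E|/eqP nGG'] := eqVneq G G'.
  by rewrite E capvv (proj2 lG') !addnn !odd_double.
have [u uG' uG] : {u | u \in G' & u \notin G}.
  apply: notin_sub; apply/negP => h; apply: nGG'; apply/esym/eqP.
  by rewrite eqEdim h (proj2 lG) (proj2 lG') leqnn.
have [dI lG2 nG2] := lag_swap lG uG (lag_beta lG' uG' uG').
set I := (_ :&: _)%VS in dI lG2 nG2; set G2 := (_ + _)%VS in lG2 nG2.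
have IG : (I <= G)%VS by apply: capvSl.
have IG2 : (I <= G2)%VS by apply: addvSl.
have le : (\dim (G :&: G') < \dim (G2 :&: G'))%N.
  have <- : \dim (G :&: G' + <[u]>) = (\dim (G :&: G')).+1.
    by apply: dim_add_line; rewrite memv_cap (negPf uG).
  apply: dimvS; rewrite subv_add -memvE memv_cap uG' andbT; apply/andP; split; last first.
    by rewrite -[_ \in _]/(<[u]> <= _)%VS addvSr.
  rewrite subv_cap capvSr andbT; apply: subv_trans IG2.
  rewrite subv_cap capvSl /= (subv_trans (capvSr _ _)) // sub_perpC.
  by rewrite lag_perp // -memvE.
have leI : (\dim (I :&: G') <= \dim (G :&: G'))%N by rewrite dimvS // capvS.
have A := adjacent_dim lG lG2 lG' IG IG2 dI nG2.
have B := adjacent_dim lG lG2 lH IG IG2 dI nG2.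
have eq2 : \dim (G2 :&: G') = (\dim (G :&: G')).+1 by lia.
have lem : (\dim (G2 :&: G') <= m)%N by rewrite -(proj2 lG') dimvS ?capvSr.
have := IH G2; rewrite eq2 => /(_ _ lG2 lG' lH); have := eq2; lia.
Qed.

(** As long as G meets E in some u, swap E along an isotropic v with
    beta u v <> 0: this removes u from the intersection. *)
Lemma lag_transversal G : lagrangian G -> exists E, lagrangian E /\ (G :&: E = 0)%VS.
Proof.
move=> lG.
suff h d E : lagrangian E -> \dim (G :&: E) = d -> exists E, lagrangian E /\ (G :&: E = 0)%VS.
  by apply: (h _ G lG (erefl _)).
elim: d E => [|d IH] E lE dE; first by exists E; split=> //; apply/eqP; rewrite -dimv_eq0 dE.
have [u /memv_capP[uG uE] u0] : {u | u \in (G :&: E)%VS & u \notin 0%VS}.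
  by apply: dim_lt_notin; rewrite dimv0 dE.
have [v0 _ uv0] : {v | v \in fullv & v \notin perp <[u]>}.
  apply: dim_lt_notin; have := dim_perp <[u]>; rewrite dim_full dim_vline.
  by move: u0; rewrite memv0 => ->; lia.
have {uv0} uv0 : beta u v0 != 0.
  apply: contra uv0 => /eqP h; apply/perpP => _ /vlineP[c ->]; by rewrite betaZl h mulr0.
(* v0 is corrected along the isotropic u to become isotropic *)
pose v := v0 - (beta v0 v0 / (2 * beta u v0)) *: u.
have uu : beta u u = 0 by apply: (lag_beta lE).
have vv : beta v v = 0.
  rewrite /v betaDl !betaDr !betaNl !betaNr !betaZl !betaZr uu (betaC v0 u); field.
  exact: uv0.
have uv : beta u v != 0 by rewrite /v betaDr betaNr betaZr uu mulr0 subr0.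
have vE : v \notin E by apply: contra uv => vE; rewrite (lag_beta lE).
have [dI lE2 nE2] := lag_swap lE vE vv.
have := adjacent_dim lE lE2 lG (capvSl _ _) (addvSl _ _) dI nE2.
set I := (_ :&: _)%VS in dI lE2 nE2 *; set E2 := (_ + _)%VS in lE2 nE2 *.
rewrite !(capvC _ G) dE => -[[e1 e2]|[e1 e2]].
  by apply: (IH E2) => //; rewrite e2; lia.
have : (G :&: I <= G :&: E)%VS by rewrite capvS // capvSl.
move=> /dimv_leqif_eq[_]; rewrite dE -e2 eqxx => /esym/eqP h.
have : u \in (G :&: I)%VS by rewrite h memv_cap uG.
rewrite memv_cap => /andP[_ /memv_capP[_ /perpP /(_ v)]].
by rewrite memv_line betaC => /(_ isT) h2; rewrite h2 eqxx in uv.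
Qed.

End Subspaces.

(** * Polynomial families in the two-row space *)

Lemma polyK_beta w w' : polyV w -> polyV w' -> polyK (fun t => beta (w t) (w' t)).
Proof.
move=> hw [P hP]; apply: (@polyK_ext K (fun t => \sum_i (P i).[t] * beta (w t) (vbasis fullv)`_i)).
  move=> t; rewrite hP (big_morph (beta (w t)) (betaDr _) (beta0r _)).
  by apply: eq_bigr => i _; rewrite betaZr.
apply: polyK_sum => i; apply: polyK_mul; first by exists (P i).
by apply: (polyV_fun (phi := fun u => beta u _)) => // *; rewrite ?betaDl ?betaZl.
Qed.

(** Linear independence is an open condition. *)
Lemma gen_notin (b : nat -> K -> V) z w t0 : (forall s, polyV (b s)) -> polyV z ->
  \dim (spanb (b^~ t0) w) = w -> z t0 \notin spanb (b^~ t0) w ->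
  gen (fun t => z t \notin spanb (b^~ t) w).
Proof.
move=> hb hz d0 z0.
pose b' s t := if (s < w)%N then b s t else z t.
have hb' s : polyV (b' s).
  apply: (@polyV_ext K V (if (s < w)%N then b s else z)); last by case: ifP.
  by move=> t; rewrite /b'; case: ifP.
have eb t : spanb (b'^~ t) w = spanb (b^~ t) w by apply: eq_spanb => s sw; rewrite /b' sw.
have eb1 t : spanb (b'^~ t) w.+1 = (spanb (b^~ t) w + <[z t]>)%VS.
  by rewrite spanbS eb /b' ltnn.
pose X0 := [tuple b' i t0 | i < w.+1].
have X0E : X0 = mkseq (b'^~ t0) w.+1 :> seq V.
  by rewrite /= /mkseq -val_enum_ord -map_comp.
have fX : free X0.
  by rewrite /free size_tuple X0E -/(spanb _ _) eb1 dim_add_line // d0.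
have X0i (i : 'I_w.+1) : X0`_i = b' i t0 by rewrite -(tnth_nth 0 X0) tnth_mktuple.
pose M t : 'M[K]_w.+1 := \matrix_(i, j) coord X0 j (b' i t).
have hM : polyK (fun t => \det (M t)).
  apply: polyK_det => i j; apply: (@polyK_ext K (fun t => coord X0 j (b' i t))).
    by move=> t; rewrite mxE.
  by apply: polyV_fun => // *; rewrite ?linearD ?linearZ.
have : \det (M t0) != 0.
  have -> : M t0 = 1%:M; last by rewrite det1 oner_neq0.
  by apply/matrixP => i j; rewrite !mxE -X0i (coord_free i j fX).
move/(gen_neq0 hM); apply: gen_imp => t; apply: contra => /mem_spanb[a az].
apply/det0P; exists (\row_i (if (i < w)%N then a i else -1)).
  apply/eqP => /rowP /(_ ord_max); rewrite !mxE ltnn => /eqP.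
  by rewrite oppr_eq0 oner_eq0.
apply/rowP => j; rewrite !mxE big_ord_recr /= !mxE ltnn mulN1r.
apply/eqP; rewrite subr_eq0 /b' /= ltnn az linear_sum /=; apply/eqP.
apply: eq_bigr => i _; rewrite !mxE /= ltn_ord linearZ /=; by rewrite /b' ltn_ord.
Qed.

(** A family with prescribed values at 0 and 1. *)
Definition inter (u0 u1 : K -> V) t := (1 - t) *: u0 t + t *: u1 t.

Lemma polyV_inter u0 u1 : polyV u0 -> polyV u1 -> polyV (inter u0 u1).
Proof.
move=> h0 h1; apply: polyV_add; apply: polyV_scale => //; last exact: polyK_id.
by apply: polyK_add; [exact: polyK_const|exact/polyK_opp/polyK_id].
Qed.
Lemma inter0 u0 u1 : inter u0 u1 0 = u0 0.
Proof. by rewrite /inter subr0 scale1r scale0r addr0. Qed.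
Lemma inter1 u0 u1 : inter u0 u1 1 = u1 1.
Proof. by rewrite /inter subrr scale1r scale0r add0r. Qed.

(** Vectors in the preimage of a moving subspace can be moved along with it, with
    a prescribed position at one parameter: apply a section of x^r to a moving
    linear combination of the basis. *)
Lemma lift_pre1 (b : nat -> K -> V) w r t0 v0 : (forall s, polyV (b s)) ->
  (spanb (b^~ t0) w <= xim r)%VS -> gen (fun t => (spanb (b^~ t) w <= xim r)%VS) ->
  v0 \in pre r (spanb (b^~ t0) w) ->
  exists u, [/\ polyV u, u t0 = v0 & gen (fun t => u t \in pre r (spanb (b^~ t) w))].
Proof.
move=> hb h0 hg; rewrite mem_pre => /mem_spanb[a av].
pose sec t := \sum_(s < w) a s *: ((xp r)^-1)%VF (b s t).
have secE t : (spanb (b^~ t) w <= xim r)%VS -> xp r (sec t) = \sum_(s < w) a s *: b s t.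
  move=> h; rewrite /sec linear_sum; apply: eq_bigr => s _.
  by rewrite linearZ /= limg_lfunVK //; apply: (subvP h); apply: (@spanb_mem K V (b^~ t)).
(* the correction v0 - sec t0 lies in the kernel of x^r *)
exists (fun t => sec t + (v0 - sec t0)); split.
- apply: polyV_add; last exact: polyV_const.
  apply: polyV_sum => s; apply: polyV_scale; first exact: polyK_const.
  exact: polyV_img.
- by rewrite addrC subrK.
apply: gen_imp hg => t ht; rewrite mem_pre xpDv xpB !secE // av subrr addr0.
by apply: memv_suml => s _; apply/memvZ/(@spanb_mem K V (b^~ t)).
Qed.

Lemma lift_pre (b : nat -> K -> V) w r v0 v1 : (forall s, polyV (b s)) ->
  (spanb (b^~ 0%R) w <= xim r)%VS -> (spanb (b^~ 1%R) w <= xim r)%VS ->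
  gen (fun t => (spanb (b^~ t) w <= xim r)%VS) ->
  v0 \in pre r (spanb (b^~ 0) w) -> v1 \in pre r (spanb (b^~ 1) w) ->
  exists u, [/\ polyV u, u 0 = v0, u 1 = v1 & gen (fun t => u t \in pre r (spanb (b^~ t) w))].
Proof.
move=> hb h0 h1 hg hv0 hv1.
have [u0 [p0 e0 g0]] := lift_pre1 hb h0 hg hv0.
have [u1 [p1 e1 g1]] := lift_pre1 hb h1 hg hv1.
exists (inter u0 u1); split; rewrite ?inter0 ?inter1 //; first exact: polyV_inter.
by apply: gen_imp (gen_and g0 g1) => t [? ?]; rewrite memvD ?memvZ.
Qed.

(** A polynomial family of bases of Lagrangians extends to the flags of the
    orthogonals: the remaining vectors come from the adjugate of a matrix of
    pairings that is invertible at the two given parameters. *)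
Lemma full_family (b : nat -> K -> V) : (forall s, polyV (b s)) ->
  (forall t, t = 0 \/ t = 1 -> forall i, (i <= m)%N -> \dim (spanb (b^~ t) i) = i) ->
  exists b' (Q : K -> Prop), [/\ forall s, polyV (b' s), forall s, (s < m)%N -> b' s = b s,
    gen Q, Q 0 /\ Q 1 &
    forall t, Q t -> lagrangian (spanb (b^~ t) m) ->
      forall q, (q <= m)%N -> spanb (b'^~ t) (m + q) = perp (spanb (b'^~ t) (m - q))].
Proof.
move=> hb hd.
have exh t : t = 0 \/ t = 1 -> exists h : nat -> V, forall j, (j < m)%N ->
    h j \in perp (spanb (b^~ t) j) /\ beta (h j) (b j t) != 0.
  move=> /hd dt; suff ex j : exists z, (j < m)%N -> z \in perp (spanb (b^~ t) j) /\ beta z (b j t) != 0.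
    by have [h hh] := choice ex; exists h.
  have [jm|] := ltnP j m; last by exists 0.
  have [z z1 z2] : {z | z \in perp (spanb (b^~ t) j) & z \notin perp (spanb (b^~ t) j.+1)}.
    apply: dim_lt_notin; have := dim_perp (spanb (b^~ t) j); have := dim_perp (spanb (b^~ t) j.+1).
    by rewrite !dt ?(ltnW jm) //; lia.
  exists z => _; split=> //; apply: contra z2 => /eqP bz.
  by rewrite spanbS perpD memv_cap z1; apply/perpP => _ /vlineP[c ->]; rewrite betaZl betaC bz mulr0.
have [h0 hh0] := exh 0 (or_introl erefl); have [h1 hh1] := exh 1 (or_intror erefl).
pose h j := inter (fun _ => h0 j) (fun _ => h1 j).
have ph j : polyV (h j) by apply: polyV_inter; apply: polyV_const.
pose A t : 'M[K]_m := \matrix_(i, j) beta (h i t) (b j t).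
have pA i j : polyK (fun t => A t i j).
  by apply: (polyK_ext (a := fun t => beta (h i t) (b j t))); [move=> t; rewrite mxE|exact: polyK_beta].
have detA t (g : nat -> V) : (forall j, h j t = g j) ->
    (forall j, (j < m)%N -> g j \in perp (spanb (b^~ t) j) /\ beta (g j) (b j t) != 0) -> \det (A t) != 0.
  move=> hg hh; have -> : \det (A t) = \prod_i A t i i.
    rewrite -det_tr det_trig.
      by apply: eq_bigr => i _; rewrite mxE.
    apply/is_trig_mxP => i j ij; rewrite !mxE hg betaC.
    by have [/perpP + _] := hh j (ltn_ord j); apply; apply: (@spanb_mem K V (b^~ t)).
  by apply/prodf_neq0 => i _; rewrite mxE hg; have [] := hh i (ltn_ord i).
have d0 : \det (A 0) != 0 by apply: (detA _ h0) hh0 => j; rewrite /h inter0.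
have d1 : \det (A 1) != 0 by apply: (detA _ h1) hh1 => j; rewrite /h inter1.
(* N i is dual to the b j up to the factor det A, so it is orthogonal to all b j
   with j <> i; no division is needed to stay polynomial *)
pose N (i : nat) t := \sum_(l < m) oapp (fun i : 'I_m => (\adj (A t)) i l) 0 (insub i) *: h l t.
have NE (i j : 'I_m) t : beta (N i t) (b j t) = \det (A t) * (i == j)%:R.
  rewrite betaC /N (big_morph (beta _) (betaDr _) (beta0r _)) valK /=.
  have := congr1 (fun M : 'M_m => M i j) (mul_adj_mx (A t)); rewrite !mxE mulr_natr => <-.
  by apply: eq_bigr => l _; rewrite betaZr !mxE betaC.
have pN i : polyV (N i).
  apply: polyV_sum => l; apply: polyV_scale => //.
  case: insub => [i'|] /=; last exact: polyK_const.
  rewrite /= -[X in polyK X]/(fun t => _); apply: (polyK_ext (a := fun t => (-1) ^+ (l + i') * \det (row' l (col' i' (A t))))).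
    by move=> t; rewrite mxE.
  apply: polyK_mul; first exact: polyK_const.
  by apply: polyK_det => a c; apply: (polyK_ext (a := fun t => A t (lift l a) (lift i' c))) => [t|]; rewrite ?mxE.
(* b' (m + q) = N (m - q - 1) *)
pose b' s := if (s < m)%N then b s else N (m - (s - m).+1)%N.
exists b', (fun t => \det (A t) != 0); split.
- by move=> s; rewrite /b'; case: ifP.
- by move=> s sm; rewrite /b' sm.
- by apply: gen_neq0 d0; apply: polyK_det.
- by [].
move=> t dt lt.
have eb i : (i <= m)%N -> spanb (b'^~ t) i = spanb (b^~ t) i.
  by move=> im; apply: eq_spanb => s si; rewrite /b' (leq_trans si im).
suff sp q : (q <= m)%N -> (spanb (b'^~ t) (m + q) <= perp (spanb (b'^~ t) (m - q)))%VS /\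
    \dim (spanb (b'^~ t) (m + q)) = (m + q)%N.
  have db q : (q <= m)%N -> \dim (spanb (b'^~ t) (m - q)) = (m - q)%N.
    move=> qm; have : (\dim (spanb (b'^~ t) (m - q)) <= m - q)%N.
      by apply: leq_trans (dim_span _) _; rewrite size_mkseq.
    have : (\dim (spanb (b'^~ t) m) <= \dim (spanb (b'^~ t) (m - q)) + q)%N.
      have -> : spanb (b'^~ t) m = (spanb (b'^~ t) (m - q) + <<map (b'^~ t) (iota (m - q) q)>>)%VS.
        by rewrite -span_cat -map_cat -[iota (m - q) q]/(iota (0 + (m - q)) q) -iotaD subnK.
      apply: leq_trans (leq_of_leqif (dimv_add_leqif _ _)) _; rewrite leq_add2l.
      by apply: leq_trans (dim_span _) _; rewrite size_map size_iota.
    by rewrite eb // (proj2 lt); lia.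
  move=> q qm; have [h1' h2'] := sp q qm; apply/eqP; rewrite eqEdim h1' h2' /=.
  by have := dim_perp (spanb (b'^~ t) (m - q)); rewrite db //; have := double_m; lia.
elim: q => [|q IH] qm; first by rewrite addn0 subn0 eb // (lag_perp lt) subvv (proj2 lt).
have [s1 s2] := IH (ltnW qm).
have bE : b' (m + q)%N t = N (m - q.+1)%N t by rewrite /b' ltnNge leq_addr /= addKn.
have jm : (m - q.+1 < m)%N by lia.
have nb i : (i < m)%N -> beta (N (m - q.+1)%N t) (b i t) = \det (A t) * (m - q.+1 == i)%N%:R.
  by move=> im; have := NE (Ordinal jm) (Ordinal im) t; rewrite -val_eqE.
rewrite addnS spanbS bE dim_add_line ?s2; last first.
  apply/negP => /(subvP s1); rewrite eb; last by lia.
  move/perpP => /(_ (b (m - q.+1)%N t)); rewrite betaC nb // eqxx mulr1 => h'.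
  by case/eqP: dt; apply: h'; apply: (@spanb_mem K V (b^~ t)); lia.
split=> //; rewrite subv_add -memvE (subv_trans s1) /=; last first.
  have -> : (m - q = (m - q.+1).+1)%N by lia.
  by rewrite perpS // spanbS addvSl.
rewrite eb; last by lia.
apply/perpP => u /mem_spanb[a ->]; rewrite betaC (big_morph (beta _) (betaDr _) (beta0r _)).
rewrite big1 // => i _; have im : (i < m)%N by apply: leq_trans (ltn_ord i) _; lia.
by rewrite betaZr nb // gtn_eqF ?mulr0.
Qed.

(** * The conditions attached to a marked cup diagram *)
Implicit Types H : nat -> {vspace V}.
Implicit Types U : {vspace V}.

(** The first l steps of a flag of the Springer fiber. *)
Definition half_flag (l : nat) (H : nat -> {vspace V}) : Prop :=
  H 0%N = 0%VS /\
  forall s, (s < l)%N -> [/\ (H s <= H s.+1)%VS, \dim (H s.+1) = s.+1 & (xp 1 @: H s.+1 <= H s)%VS].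

Lemma half_flag_eq l H H' : (forall s, (s <= l)%N -> H s = H' s) -> half_flag l H -> half_flag l H'.
Proof.
move=> E [h0 h]; split=> [|s sl]; first by rewrite -E.
by rewrite -!E ?(ltnW sl) //; apply: h.
Qed.

Lemma half_dim l H s : half_flag l H -> (s <= l)%N -> \dim (H s) = s.
Proof. by case=> h0 h; case: s => [|s] sl; [rewrite h0 dimv0|case: (h s sl)]. Qed.

Lemma half_sub l H s t : half_flag l H -> (s <= t)%N -> (t <= l)%N -> (H s <= H t)%VS.
Proof.
move=> [_ h]; elim: t => [|t IH]; first by rewrite leqn0 => /eqP ->.
rewrite leq_eqVlt => /orP[/eqP -> //|st tl].
by case: (h t tl) => h1 _ _; apply: subv_trans h1; apply: IH; lia.
Qed.

Lemma half_flagW l l' H : half_flag l H -> (l' <= l)%N -> half_flag l' H.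
Proof. by move=> [h0 h] ll; split=> // s sl; apply: h; lia. Qed.

Lemma half_xp l H s : half_flag l H -> (s <= l)%N -> (xp 1 @: H s <= H s)%VS.
Proof.
move=> [h0 h]; case: s => [|s] sl; first by rewrite h0 limg0.
by case: (h s sl) => h1 _ h2; apply: subv_trans h1.
Qed.

Lemma pre_add_line r U (v : V) : pre r (U + <[xp r v]>) = (pre r U + <[v]>)%VS.
Proof.
apply/vspaceP => u; rewrite mem_pre; apply/memv_addP/memv_addP.
  case=> a aU [_ /vlineP[c ->] e]; exists (u - c *: v); first by rewrite mem_pre xpB xpZ e addrK.
  by exists (c *: v); [apply/memvZ/memv_line|rewrite subrK].
case=> a; rewrite mem_pre => aU [_ /vlineP[c ->] ->]; exists (xp r a) => //.
by exists (c *: xp r v); [apply/memvZ/memv_line|rewrite xpDv xpZ].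
Qed.

(** A subspace whose preimage is Lagrangian is related to its orthogonal by a
    power of x, and conversely. *)
Lemma lag_pre_perp r (F : {vspace V}) : lagrangian (pre r F) -> (F <= xim r)%VS -> (r <= k)%N ->
  perp F = pre r.*2 F.
Proof.
move=> lG Fr rk; have dF := dim_pre_im rk Fr.
have m2 := double_m; have dG := proj2 lG.
apply/eqP; rewrite eqEdim; apply/andP; split; last first.
  by have := dim_pre_le r.*2 F; have := dim_perp F; lia.
rewrite -addnn -pre_pre -img_sub_pre.
by rewrite -perp_pre (lag_perp lG).
Qed.

Lemma perp_pre_xim r (F : {vspace V}) : perp F = pre r.*2 F -> (\dim F + r.*2)%N = m -> (F <= xim r.*2)%VS.
Proof.
move=> E dF; apply: dim_pre_xim; rewrite -E.
by have := dim_perp F; have := double_m; lia.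
Qed.

Lemma perp_pre_lag r (F : {vspace V}) : perp F = pre r.*2 F -> (\dim F + r.*2)%N = m -> (r.*2 <= k)%N ->
  lagrangian (pre r F).
Proof.
move=> E dF rk; have Fx := perp_pre_xim E dF.
have Fr : (F <= xim r)%VS by apply: subv_trans Fx (ximS _); lia.
apply: iso_lag; last by rewrite dim_pre_im //; lia.
apply/isotropicP => u u' uF u'F.
have /mem_xim[y uy] : u \in xim r.
  by apply: (subvP (pre_xim _ _)) uF; rewrite addnn.
have yF : y \in perp F by rewrite E mem_pre -addnn xpowD -uy -mem_pre.
apply/eqP; rewrite uy beta_xpow0 betaC; apply/eqP.
by apply: (perpP _ _ yF); rewrite -mem_pre.
Qed.

Section Diagram.
Variables (mate : nat -> nat) (mk : nat -> bool).

(** The step at a ray is spanned by some e's and f's and one more vector, whose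
    coefficients on the next f and the next e are [ray_weight]. *)
Definition lastray w := all (fun u => mate u != u) (iota w.+1 (m - w.+1)).

Definition ray_weight w : K * K :=
  if p == k then (if mk w then (1, 0) else (0, 1))
  else if mk w then (1, gam) else if lastray w then (1, - gam) else (0, 1).

Local Notation cnt w := (nop mate 0 w).
Local Notation rho s := (nop mate s m).

(** As long as the indices are in range, x^a maps [ray_vec w a] to [ray_vec w 0]. *)
Definition ray_vec w a : V :=
  (ray_weight w).1 *: fv (cnt w + a).+1 + (ray_weight w).2 *: ev (w - cnt w + a).+1.
Definition ray_space w := spef (w - cnt w) (cnt w) [:: ray_vec w 0].

(** The conditions on a cup are attached to its right endpoint, the first index at
    which all the steps they mention are known. *)
Definition cond (H : nat -> {vspace V}) w : Prop :=
  if (mate w < w)%N then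
    let v := mate w in let r := (w - v).+1./2 in
    if mk w then (H v + xp r @: H w.+1)%VS = H v.+1 /\ perp (H w.+1) = pre (m - w.+1) (H w.+1)
    else H w.+1 = pre r (H v)
  else if mate w == w then H w.+1 = ray_space w else True.

Hypothesis D : cups m mate.
Hypothesis Mk : marking m mate mk.
Hypothesis Nc : nop mate 0 m = k./2.

Lemma rho_cnt s : (s <= m)%N -> (cnt s + rho s)%N = k./2.
Proof. by move=> sm; rewrite -Nc -nop_cat. Qed.

Lemma rho_le s : (s <= m)%N -> ((rho s).*2 <= k)%N.
Proof. by move=> sm; have := rho_cnt sm; lia. Qed.

Lemma rhoS s : (s < m)%N -> rho s = (opener mate s + rho s.+1)%N.
Proof. by move=> sm; rewrite (@nop_cat mate s s.+1) // nop1. Qed.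

Lemma rho_closer w : (w < m)%N -> (mate w < w)%N ->
  rho (mate w) = ((w - mate w).+1./2 + rho w.+1)%N /\
  (mate w + ((w - mate w).+1./2).*2)%N = w.+1 /\ rho w = rho w.+1.
Proof.
move=> wm vw; have vm := mate_lt D wm; have mv := mateK D wm.
have op : (mate w < mate (mate w))%N by rewrite mv.
have := nop_cup D vm op; rewrite mv => ->; split=> //.
have := cup_inside_count D vm op; rewrite mv => h; split; first by lia.
by rewrite rhoS // /opener ltnNge (ltnW vw).
Qed.

Lemma weights w : ray_weight w = (0, 1) \/
  exists2 c, ray_weight w = (1, c) & (p = k /\ c = 0) \/ (p <> k /\ c ^+ 2 = gam ^+ 2).
Proof.
rewrite /ray_weight; case: eqP => e; case: (mk w); try by left.
- by right; exists 0 => //; left.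
- by right; exists gam => //; right.
- case: ifP => _; last by left.
  by right; exists (- gam) => //; right; rewrite sqrrN.
Qed.

(** With l the number of rays on the left of w.  For p <> k the middle vectors enter only
    at the last ray, which is why its vector can be isotropic. *)
Lemma ray_sizes w : (w < m)%N -> mate w = w ->
  exists l, [/\ w = (l + (cnt w).*2)%N, (l + k./2 < p)%N, (k./2 < k)%N,
    (p == k -> l = 0%N /\ p = (k./2).*2.+1) &
    (p != k -> ((l + k./2)%N = p./2 /\ exists2 c, ray_weight w = (1, c) & c ^+ 2 = gam ^+ 2) \/
      ((l + k./2 < p./2)%N /\ ray_weight w = (0, 1)))].
Proof.
move=> wm ww; exists (nray mate 0 w); have kp := two_row_ge S; have k0 := two_row_gt0 S.
have c1 := closedI_count D (closedI_ray D wm ww); rewrite subn0 in c1.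
have c2 := closedI_count D (closedI0m D); rewrite subn0 Nc in c2.
have c3 : nray mate 0 m = (nray mate 0 w + (1 + nray mate w.+1 m))%N.
  rewrite (@nray_cat mate 0 w) ?(ltnW wm) // (@nray_cat mate w w.+1) // nray1.
  by rewrite /ray ww eqxx.
have m2 := double_m; have hp := two_row_par S.
split=> //; try lia.
move=> npk; have [E|E] := boolP (lastray w).
  left; split.
    have : nray mate w.+1 m = 0%N.
      by apply: nray_eq0 => u hu; apply/eqP; apply: (allP E); rewrite mem_iota; lia.
    by move: npk; case: hp; lia.
  rewrite /ray_weight (negPf npk) E; case: (mk w); first by exists gam.
  by exists (- gam); rewrite ?sqrrN.
right; have [u hu uu] : exists2 u, (w < u < m)%N & mate u = u.
  move: E => /allPn[u]; rewrite mem_iota negbK => hu /eqP uu; exists u => //; lia.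
split.
  have : (0 < nray mate w.+1 m)%N.
    by rewrite /nray -has_count; apply/hasP; exists u; rewrite ?mem_iota /ray ?uu //; lia.
  by move: npk; case: hp; lia.
suff kw : mk w = false by rewrite /ray_weight (negPf npk) (negPf E) kw.
by apply/negP => kw; have [_ /(_ u)] := Mk wm kw; rewrite ww maxnn; lia.
Qed.

Lemma ray_vec_notin w : (w < m)%N -> mate w = w -> ray_vec w 0 \notin spef (w - cnt w) (cnt w) [::].
Proof.
move=> wm ww; have ck := rho_cnt (ltnW wm).
have [l [el h1 h2 h3 h4]] := ray_sizes wm ww.
apply/negP => /mem_spef[he hf']; move: (he (w - cnt w)%N (leqnn _)) (hf' (cnt w) (leqnn _)).
rewrite /ray_vec !addn0 ecoefD fcoefD !ecoefZ !fcoefZ ecoef_ev fcoef_ev ecoef_fv fcoef_fv !eqxx !andbT.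
rewrite !mulr0 addr0 add0r (_ : (cnt w < k)%N); last by lia.
rewrite (_ : (w - cnt w < p)%N); last by lia.
rewrite !mulr1; case: (weights w) => [->|[c -> _]] /=; first by move/eqP; rewrite oner_eq0.
by move=> _ /eqP; rewrite oner_eq0.
Qed.

Lemma ray_spaceE w : ray_space w = (spef (w - cnt w) (cnt w) [::] + <[ray_vec w 0]>)%VS.
Proof. by rewrite /ray_space spef_cat span_seq1. Qed.

Lemma dim_ray_space w : (w < m)%N -> mate w = w -> \dim (ray_space w) = w.+1.
Proof.
move=> wm ww; have ck := rho_cnt (ltnW wm); have [l [el h1 h2 h3 h4]] := ray_sizes wm ww.
by rewrite ray_spaceE dim_add_line ?ray_vec_notin // dim_spef; lia.
Qed.

(** Whatever the marks, the preimage of the space at a ray is isotropic; at the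
    last ray this is where the choice of gam matters. *)
Lemma ray_space_facts w : (w < m)%N -> mate w = w ->
  [/\ (ray_space w <= xim (rho w.+1))%VS, isotropic (pre (rho w.+1) (ray_space w)) &
      pre (rho w.+1) (ray_space w) = (spef (w - cnt w + rho w.+1) (k./2) [::] + <[ray_vec w (rho w.+1)]>)%VS].
Proof.
move=> wm ww; have [l [el h1 h2 h3 h4]] := ray_sizes wm ww.
have er : (cnt w + rho w.+1)%N = k./2.
  by rewrite -(rho_cnt wm) (@nop_cat mate 0 w w.+1) // nop1 /opener ww ltnn addn0.
have xr : xp (rho w.+1) (ray_vec w (rho w.+1)) = ray_vec w 0.
  rewrite /ray_vec xpDv !xpZ !addn0 er; congr (_ *: _ + _ *: _).
    by rewrite xpow_fv //; congr fv; lia.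
  by rewrite xpow_ev; [congr ev|]; lia.
have E : pre (rho w.+1) (ray_space w) =
    (spef (w - cnt w + rho w.+1) (k./2) [::] + <[ray_vec w (rho w.+1)]>)%VS.
  by rewrite /ray_space spef_cat span_seq1 -xr pre_add_line pre_spef er.
split=> //.
  rewrite /ray_space spef_cat span_seq1 subv_add; apply/andP; split; last first.
    by rewrite -memvE -xr; apply/mem_xim; eexists.
  apply: spef_sub => i hi; apply/mem_xim; [exists (ev (i + rho w.+1))|exists (fv (i + rho w.+1))].
    by rewrite xpow_ev ?addnK //; lia.
  by rewrite xpow_fv ?addnK //; lia.
rewrite E; have -> : (w - cnt w + rho w.+1 = l + k./2)%N by lia.
have h3' (e : p = k) : l = 0%N /\ p = (k./2).*2.+1 by apply: h3; rewrite e.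
have h4' (e : p <> k) : ((l + k./2).*2 < p)%N /\ ((k./2).*2 < k)%N.
  have [op ok] : odd p /\ odd k by case: (two_row_par S).
  have : (l + k./2 <= p./2)%N.
    by have /h4 [[-> _]|[/ltnW]] // : p != k by apply/eqP.
  by have := odd_double_half p; have := odd_double_half k; rewrite op ok; lia.
have h2' : ((k./2).*2 <= k)%N by rewrite -[leqRHS]odd_double_half leq_addl.
apply: isotropic_addl.
- by apply: isotropic_spef; case: eqP => // e; [have [? ?] := h3' e; lia|have [? ?] := h4' e; lia].
- rewrite /ray_vec er; have -> : (w - cnt w + rho w.+1 = l + k./2)%N by lia.
  apply: beta_spef => i hi; rewrite betaDr !betaZr.
    rewrite beta_ev_fv ?beta_ev_ev ?mulr0 ?addr0 //.
      by case: eqP => // e; have [? ?] := h4' e; lia.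
    by case: eqP => // e; have [? ?] := h3' e; lia.
  rewrite beta_fv_fv ?[beta (fv _) (ev _)]betaC ?beta_ev_fv ?mulr0 ?addr0 //.
    by case: eqP => // e; have [? ?] := h3' e; lia.
  by case: eqP => // e; have [? ?] := h4' e; lia.
rewrite /ray_vec er; have -> : (w - cnt w + rho w.+1 = l + k./2)%N by lia.
have [e|npk] := eqVneq p k.
  have [-> /=|[c -> [[_ ->]|[/(_ e)]]] //=] := weights w; rewrite !scale0r ?add0r ?addr0 scale1r.
    by rewrite beta_ev_ev // e eqxx.
  by rewrite beta_fv_fv // e eqxx.
have [[-> [c -> cg]]|[lt ->]] := h4 npk; first by rewrite /= scale1r; apply: beta_mid => //; apply/eqP.
by rewrite scale0r add0r scale1r beta_ev_ev //; apply/orP; right; lia.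
Qed.

Lemma late_rho s : (s <= m)%N -> closedI mate m s m ->
  (forall u, (s <= u < m)%N -> mate u <> u) -> (s + (rho s).*2)%N = m.
Proof. by move=> sm cs nr; have := closedI_count D cs; rewrite nray_eq0 //; lia. Qed.

Lemma late_after v : (v < m)%N -> mk v -> (v < mate v)%N ->
  (v + (rho v).*2)%N = m /\ ((mate v).+1 + (rho (mate v).+1).*2)%N = m.
Proof.
move=> vm kv vw; have wm := mate_lt D vm.
have c0 := marked_outer D Mk vm kv (ltnW vw); have cm := closedI0m D.
have nr := marked_late D Mk vm kv vw.
have cv : closedI mate m v m by exact: (closedI_rest D cm c0 (ltnW vm)).
have e := late_rho (ltnW vm) cv (fun u hu => nr u hu).
split=> //; have := nop_cup D vm vw; have := cup_inside_count D vm vw.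
by lia.
Qed.

(** At a left endpoint rho drops by one, so isotropy passes from the preimage of
    H s to its subspace x^(- rho s.+1) (H s.+1); at the right end of an unmarked cup the
    preimage is the one at the left endpoint; at marked cups and rays it is
    computed directly. *)
Lemma half_xim_iso l H : (l <= m)%N -> half_flag l H -> (forall w, (w < l)%N -> cond H w) ->
  forall s, (s <= l)%N -> (H s <= xim (rho s))%VS /\ isotropic (pre (rho s) (H s)).
Proof.
move=> lm hf hc s; have [d] := ubnP s; elim: d s => // d IH s sd sl.
have kp := two_row_ge S; case: s sd sl => [_ _|w wd wl].
  have [-> _] := hf; rewrite sub0v; split=> //.
  rewrite -spef00 pre_spef !add0n; apply: isotropic_spef.
  by have := rho_le (leq0n m); case: eqP; lia.
have wm : (w < m)%N by lia.
have [Ix Ii] := IH w wd (ltnW wl).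
have := hc w wl; rewrite /cond; case: ltngtP => [vw|op|ww] cw.
- have [e1 [e2 e3]] := rho_closer wm vw.
  have [Jx Ji] := IH (mate w) (ltn_trans vw wd) (ltnW (ltn_trans vw wl)).
  move: cw; case: ifP => [kw [_ cw]|_ ->]; last first.
    rewrite pre_pre (addnC (rho w.+1)) -e1; split=> //.
    by apply: pre_xim; rewrite -e1 //; have := rho_le (ltnW (ltn_trans vw wm)); lia.
  have mw : mk (mate w) by have [] := Mk wm kw.
  have vm := ltn_trans vw wm.
  have := late_after vm mw; rewrite (mateK D) // => /(_ vw)[_ e4].
  have e5 : (m - w.+1)%N = (rho w.+1).*2 by lia.
  have dH := half_dim hf wl; rewrite e5 in cw.
  have e6 : (\dim (H w.+1) + (rho w.+1).*2)%N = m by rewrite dH.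
  split; last by case: (perp_pre_lag cw e6 (rho_le wm)).
  by apply: subv_trans (perp_pre_xim cw e6) (ximS _); lia.
- have [_ h] := hf; have [h1 h2] := h w wl; rewrite img_sub_pre => h3.
  have e : rho w = (rho w.+1).+1 by rewrite rhoS // /opener op.
  split; first by apply: xim_pre1 h3; rewrite -e //; have := rho_le (ltnW wm); lia.
  by apply: isotropicS Ii; rewrite e -(addn1 (rho w.+1)) -pre_pre preS.
- by rewrite cw; have [] := ray_space_facts wm ww.
Qed.

(** * Partial flags satisfying the conditions *)

Definition fits l H := half_flag l H /\ forall w, (w < l)%N -> cond H w.

Lemma fitsW l l' H : fits l H -> (l' <= l)%N -> fits l' H.
Proof. by move=> [hf hc] ll; split; [apply: half_flagW hf ll|move=> w wl; apply: hc; lia]. Qed.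

Lemma fits_xim l H s : (l <= m)%N -> fits l H -> (s <= l)%N -> (H s <= xim (rho s))%VS.
Proof. by move=> lm [hf hc] sl; case: (half_xim_iso lm hf hc sl). Qed.

Lemma fits_iso l H s : (l <= m)%N -> fits l H -> (s <= l)%N -> isotropic (pre (rho s) (H s)).
Proof. by move=> lm [hf hc] sl; case: (half_xim_iso lm hf hc sl). Qed.

Lemma fits_dim_pre l H s r : (l <= m)%N -> fits l H -> (s <= l)%N -> (r <= rho s)%N ->
  \dim (pre r (H s)) = (s + r.*2)%N.
Proof.
move=> lm iH sl rr; have := rho_le (leq_trans sl lm) => h.
rewrite dim_pre_im ?(half_dim (proj1 iH)) //; first by lia.
by apply: subv_trans (fits_xim lm iH sl) (ximS rr).
Qed.

(** The conditions of consecutive and nested unmarked cups compose. *)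
Lemma fits_concat H s t : closedI mate m s t ->
  (forall w, (s <= w < t)%N -> [/\ cond H w, mk w = false & mate w <> w]) ->
  H t = pre (nop mate s t) (H s).
Proof.
move: s t; apply: (closedI_ind D) => [s _ _|s t st cst _ ms _ hc|s t sw wt cst c1 c2 IH1 IH2 hc].
- by rewrite nop0 pre0.
- by have [_ _ /(_ ms)] := hc s ltac:(lia).
- have sm : (s < m)%N by case: c1; lia.
  have [cw kw _] := hc (mate s) ltac:(lia).
  have -> : H t = pre (nop mate (mate s).+1 t) (H (mate s).+1).
    by apply: IH2 => w hw; apply: hc; lia.
  move: cw; rewrite /cond (mateK D) // sw kw => ->.
  rewrite pre_pre; congr (pre _ _).
  by rewrite (@nop_cat mate s (mate s).+1 t) ?(nop_cupE D) // 1?addnC //; apply: leqW (ltnW sw).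
Qed.

Lemma closer_concat l H w : fits l H -> (w <= l)%N -> (w < m)%N -> (mate w < w)%N ->
  H w = pre ((w - mate w).+1./2.-1) (H (mate w).+1).
Proof.
move=> [_ hc] wl wm vw; have vm := ltn_trans vw wm; have mv := mateK D wm.
have op : (mate w < mate (mate w))%N by rewrite mv.
have e := cup_inside_count D vm op; rewrite mv in e.
have ci := closedI_inside D vm op; rewrite mv in ci.
have -> : (w - mate w).+1./2.-1 = nop mate (mate w).+1 w by lia.
apply: fits_concat ci _ => u hu; have hu' : (mate w < u < mate (mate w))%N by rewrite mv; lia.
split; [apply: hc; lia|exact: (unmarked_inside D Mk vm hu')|exact: (cups_no_ray D vm hu')].
Qed.

(** Left of the last ray no ray or outer cup can be marked, so the steps at the
    outer positions are spanned by basis vectors: rays add one e, cups take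
    preimages. *)
Lemma fits_early H o : closedI mate m 0 o -> (forall w, (w < o)%N -> cond H w) -> H 0 = 0%VS ->
  (exists2 u, (o <= u < m)%N & mate u = u) -> H o = spef (o - cnt o) (cnt o) [::].
Proof.
move=> co hc h0 hu.
suff h s t : closedI mate m s t -> (forall w, (s <= w < t)%N -> cond H w) ->
    (exists2 u, (t <= u < m)%N & mate u = u) ->
    H s = spef (s - cnt s) (cnt s) [::] -> H t = spef (t - cnt t) (cnt t) [::].
  by apply: (h _ _ co) => //; rewrite nop0 spef00 h0.
move: s t => {co hc h0 hu}.
apply: (closedI_ind D) => [s _ _ _ //|s t st cst c1 ms IH hc hu E|s t sw wt cst c1 c2 IH1 IH2 hc hu E].
- have sm : (s < m)%N by case: c1; lia.
  have cs := hc s ltac:(lia).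
  have e1 : cnt s.+1 = cnt s by rewrite (@nop_cat mate 0 s s.+1) // nop1 /opener ms ltnn addn0.
  apply: IH => //; first by move=> w hw; apply: hc; lia.
  have [l [el h1 h2 h3 h4]] := ray_sizes sm ms.
  move: cs; rewrite /cond ms ltnn eqxx => ->; rewrite /ray_space spef_cat span_seq1 e1.
  have -> : ray_vec s 0 = ev (s - cnt s).+1.
    suff e : ray_weight s = (0, 1) by rewrite /ray_vec e scale0r add0r scale1r addn0.
    have [u hu1 uu] := hu; have us : (s < u)%N by lia.
    have ks : mk s = false.
      by apply/negP => ks; have [_ /(_ u)] := Mk sm ks; rewrite ms maxnn; lia.
    rewrite /ray_weight ks; case: ifP => // npk.
    suff -> : lastray s = false by [].
    by apply/negP => /allP /(_ u); rewrite mem_iota uu eqxx; lia.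
  have -> : (s.+1 - cnt s = (s - cnt s).+1)%N by lia.
  apply/eqP; rewrite eqEsubv subv_add spefS //= -memvE ev_spef //=.
  apply: spef_sub => i hi; last by apply: (subvP (addvSl _ _)); apply: fv_spef; lia.
  have [->|ne] := eqVneq i (s - cnt s).+1; first by apply: (subvP (addvSr _ _)); apply: memv_line.
  by apply: (subvP (addvSl _ _)); apply: ev_spef; lia.
- have sm : (s < m)%N by case: c1; lia.
have cw := hc (mate s) ltac:(lia).
have [u hu1 uu] := hu; have wm := mate_lt D sm.
have kw : mk (mate s) = false.
  by apply: (unmarked_before_ray D Mk _ uu); [lia|lia].
apply: IH2 => //; first by move=> w hw; apply: hc; lia.
move: cw; rewrite /cond (mateK D) // sw kw => ->; rewrite E pre_spef.
have e := cup_inside_count D sm sw.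
have e2 : cnt (mate s).+1 = (cnt s + (mate s - s).+1./2)%N.
  by rewrite (@nop_cat mate 0 s (mate s).+1) ?(nop_cupE D) //; apply: leqW (ltnW sw).
have e3 : (cnt s <= s)%N by rewrite /nop subn0 (leq_trans (count_size _ _)) // size_iota.
rewrite e2; congr (spef _ _ _); move: e; lia.
Qed.

Lemma early_at_ray l H w : fits l H -> (w <= l)%N -> (w < m)%N -> mate w = w ->
  H w = spef (w - cnt w) (cnt w) [::].
Proof.
move=> [hf hc] wl wm ww; apply: fits_early; first exact: (closedI_ray D wm ww).
- by move=> u uw; apply: hc; lia.
- by case: hf.
- by exists w => //; lia.
Qed.

(** The situation at the right end of a marked cup: I is a hyperplane of the
    Lagrangian attached to the left end, and the new Lagrangian is the other one
    containing I. *)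
Lemma marked_setup l H w : fits l H -> (w <= l)%N -> (l <= m)%N -> (w < m)%N -> (mate w < w)%N -> mk w ->
  let v := mate w in let I := pre (rho w.+1) (H w) in let G0 := pre (rho v) (H v) in
  [/\ lagrangian G0, (I <= G0)%VS, (\dim I).+1 = m & perp I = pre (rho v) (H v.+1)] /\
  [/\ (m - w.+1)%N = (rho w.+1).*2, rho v = ((w - v).+1./2 + rho w.+1)%N,
    (xp ((w - v).+1./2) @: H w <= H v)%VS & (w.+1 + (rho w.+1).*2)%N = m].
Proof.
move=> iH wl lm wm vw kw v I G0; have [hf hc] := iH.
have vm : (v < m)%N := ltn_trans vw wm; have mv : mate v = w := mateK D wm.
have op : (v < mate v)%N by rewrite mv.
have kv : mk v by have [] := Mk wm kw.
have [l1 l2] := late_after vm kv op; rewrite mv in l2.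
have [e1 [e2 e3]] := rho_closer wm vw.
have cc := closer_concat iH wl wm vw; rewrite -/v in e1 e2 cc.
set r := (w - v).+1./2 in e1 e2 cc *.
have r0 : (0 < r)%N by rewrite /r half_gt0; lia.
have vl : (v <= l)%N by lia.
have v1l : (v.+1 <= l)%N by lia.
have ev1 : rho v = (rho v.+1).+1 by rewrite rhoS // /opener op.
have lG : lagrangian G0.
  by apply: iso_lag; [exact: (fits_iso lm iH vl)|rewrite (fits_dim_pre lm) // l1].
have EI : I = pre (rho v.+1) (H v.+1).
  by rewrite /I cc pre_pre; congr (pre _ _); rewrite -/r; lia.
have [_ /(_ v v1l)[s1 s2 s3]] := hf.
have IG : (I <= G0)%VS.
  by rewrite EI /G0 ev1 -(addn1 (rho v.+1)) -pre_pre preS // -img_sub_pre.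
have dI : (\dim I).+1 = m by rewrite EI (fits_dim_pre lm) //; lia.
have E1 : pre (rho v) (H v.+1) = pre 1 I by rewrite EI pre_pre ev1.
split; split=> //; first 1 last.
- by lia.
- apply/subvP => _ /memv_imgP[u uH ->]; have -> : r = r.-1.+1 by lia.
  rewrite xpowS; apply: (subvP s3); rewrite memv_img // -mem_pre -cc //.
rewrite E1; apply/eqP; rewrite eqEdim; apply/andP; split.
  rewrite -img_sub_pre; apply: (xpow_perp_hyperplane lG IG dI).
  rewrite EI; apply/subvP => _ /memv_imgP[u uI ->]; rewrite mem_pre -xpowSr xpowS.
  by apply: (subvP (half_xp hf v1l)); rewrite memv_img // -mem_pre.
by rewrite (dim_perp_hyper dI); have := dim_pre_le 1 I; lia.
Qed.

(** A vector z that may be added to H w.  At a marked cup z is the image of an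
    isotropic h of I^perp outside the Lagrangian attached to the left endpoint, in
    the notation of [marked_setup]. *)
Definition admits H w (z : V) : Prop :=
  let v := mate w in let r := (w - v).+1./2 in
  if (v < w)%N then
    if mk w then exists h, [/\ z = xp (rho w.+1) h, h \in pre (rho v) (H v.+1), beta h h = 0 & h \notin pre (rho v) (H v)]
    else z \in pre r (H v) /\ z \notin H w
  else if v == w then z \in ray_space w /\ z \notin H w
  else z \in pre 1 (H w) /\ z \notin H w.

Lemma admits_fits H w z : (w < m)%N -> fits w H -> admits H w z -> H w.+1 = (H w + <[z]>)%VS -> fits w.+1 H.
Proof.
move=> wm iH gz EH; have [hf hc] := iH.
suff [zH xz cw] : [/\ z \notin H w, xp 1 z \in H w & cond H w].
  split; last first.
    by move=> u; rewrite ltnS leq_eqVlt => /orP[/eqP -> //|]; apply: hc.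
  split; first by case: hf.
  move=> s; rewrite ltnS leq_eqVlt => /orP[/eqP ->|]; last by case: hf => _; apply.
  rewrite EH addvSl dim_add_line // (half_dim hf) //; split=> //.
  apply/subvP => _ /memv_imgP[_ /memv_addP[a aH [_ /vlineP[c ->] ->]] ->].
  by rewrite xpDv xpZ memvD ?memvZ // (subvP (half_xp hf (leqnn w))) // memv_img.
have dHw := half_dim hf (leqnn w).
move: gz; rewrite /admits /cond; case: ltngtP => [vw|op|ww]; last 2 first.
- by case=> zp zH; split=> //; rewrite -mem_pre.
- case=> zp zH.
  have Ew := early_at_ray iH (leqnn w) wm ww.
  have [l [el h1 h2 h3 h4]] := ray_sizes wm ww.
  have Er : ray_space w = (H w + <[ray_vec w 0]>)%VS by rewrite /ray_space spef_cat span_seq1 Ew.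
  have Hr : (H w <= ray_space w)%VS by rewrite Er addvSl.
  have ck := rho_cnt (ltnW wm).
  have xr : xp 1 (ray_vec w 0) \in H w.
    rewrite /ray_vec xpDv !xpZ !addn0 Ew xpow_fv; last by lia.
    rewrite xpow_ev; last by lia.
    by rewrite memvD ?memvZ // ?fv_spef ?ev_spef //; lia.
  split=> //.
    move: zp; rewrite Er => /memv_addP[a aH [_ /vlineP[c ->] ->]].
    by rewrite xpDv xpZ memvD ?memvZ // (subvP (half_xp hf (leqnn w))) // memv_img.
  apply/eqP; rewrite EH eqEdim subv_add Hr -memvE zp dim_add_line // Er /=.
  apply: leq_trans (leq_of_leqif (dimv_add_leqif _ _)) _.
  by rewrite dim_vline; case: (_ != _); rewrite ?addn1 ?addn0.
have vm := ltn_trans vw wm.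
have [e1 [e2 e3]] := rho_closer wm vw.
have vl := ltnW vw.
have cc := closer_concat iH (leqnn w) wm vw.
have [_ /(_ _ vw)[s1 s2 s3]] := hf.
set v := mate w in vw vm e1 e2 cc vl s1 s2 s3 *; set r := (w - v).+1./2 in e1 e2 cc *.
have r0 : (0 < r)%N by rewrite /r half_gt0; lia.
case: ifP => kw; last first.
  case=> zp zH; split=> //.
    rewrite cc mem_pre -xpowD; have -> : (r.-1 + 1 = r)%N by lia.
    by apply: (subvP s1); rewrite -mem_pre.
  have dp : (\dim (pre r (H v)) <= w.+1)%N.
    by apply: leq_trans (dim_pre_le _ _) _; rewrite (half_dim hf vl) e2.
  apply/eqP; rewrite EH eqEdim subv_add -memvE zp dim_add_line // dHw dp !andbT.
  have -> : pre r (H v) = pre r.-1 (pre 1 (H v)) by rewrite pre_pre addn1 prednK.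
  by rewrite cc preS // -img_sub_pre.
case=> h [zh hv hh hn].
have [[lG IG dI EI] [l1 l2 l3 l4]] := marked_setup iH (leqnn w) (ltnW wm) wm vw kw.
rewrite -/v -/r in lG IG dI EI l1 l2 l3 l4 *.
set I := pre (rho w.+1) (H w) in IG dI EI *; set rh := rho w.+1 in zh I IG dI EI l1 l2 l4 *.
have hI : h \notin I by apply: contra hn; apply: (subvP IG).
have hP : h \in perp I by rewrite EI.
have EL : pre rh (H w.+1) = (I + <[h]>)%VS by rewrite EH zh pre_add_line.
have zn : z \notin H w by rewrite zh -mem_pre.
have lL : lagrangian (pre rh (H w.+1)).
  rewrite EL; apply: iso_lag; last by rewrite dim_add_line // dI.
  by apply: isotropic_addl => //; apply: isotropicS IG _; case: lG.
have xH : (H w <= xim rh)%VS by rewrite /rh -e3; apply: (fits_xim (ltnW wm) iH).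
split=> //.
  rewrite zh -xpowS xpowSr -mem_pre -/I.
  rewrite -[_ \in I]/(<[_]> <= I)%VS -limg_line.
  apply: subv_trans (limgS _ (_ : <[h]> <= perp I)%VS) _; first by rewrite -memvE.
  apply: (xpow_perp_hyperplane lG IG dI).
  rewrite /I; apply/subvP => _ /memv_imgP[u uI ->]; rewrite mem_pre -xpowSr xpowS.
  by apply: (subvP (half_xp hf (leqnn w))); rewrite memv_img // -mem_pre.
have xz : xp r z = xp (rho v) h by rewrite zh -xpowD l2.
have xzv : xp r z \in H v.+1 by rewrite xz -mem_pre.
have xzn : xp r z \notin H v by rewrite xz -mem_pre.
split; last first.
  rewrite l1; apply: lag_pre_perp => //.
    by rewrite EH subv_add xH -memvE zh; apply/mem_xim; eexists.
  by apply: leq_trans (rho_le wm); rewrite -addnn leq_addr.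
apply/eqP; rewrite eqEsubv; apply/andP; split.
  rewrite subv_add s1 EH limgD limg_line subv_add (subv_trans l3) //= -memvE //.
have := add_lineE s1 _ xzv xzn; rewrite s2 (half_dim hf vl) => /(_ (erefl _)) ->.
rewrite subv_add addvSl -memvE; apply: (subvP (addvSr _ _)); apply: memv_img.
by rewrite EH; apply: (subvP (addvSr _ _)); apply: memv_line.
Qed.

(** * Existence, uniqueness and variation of the next step *)

(** A polynomial formula for the second isotropic line of a hyperbolic plane with
    isotropic vector g. *)
Lemma iso_fix (g h : V) : beta g g = 0 ->
  let z := (2 * beta g h) *: h - beta h h *: g in beta z z = 0.
Proof.
move=> gg z; rewrite /z !(betaDl, betaDr, betaNl, betaNr, betaZl, betaZr) gg (betaC h g); ring.
Qed.

Lemma iso_fix_notin G (g h : V) : lagrangian G -> g \in G -> beta g h != 0 ->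
  (2 * beta g h) *: h - beta h h *: g \notin G.
Proof.
move=> lG gG gh; apply/negP => hG; have := lag_beta lG gG hG.
rewrite betaDr betaNr !betaZr (lag_beta lG gG gG) mulr0 subr0 => /eqP.
by rewrite !mulf_eq0 pnatr_eq0 (negPf gh).
Qed.

Lemma fits_admits H w : (w < m)%N -> fits w.+1 H ->
  forall z, z \in H w.+1 -> z \notin H w -> admits H w z.
Proof.
move=> wm iH z zH zn; have [hf hc] := iH; have iHw := fitsW iH (leqnSn w).
have [_ /(_ w (leqnn _))[s1 s2 s3]] := hf.
have := hc w (leqnn _); rewrite /cond /admits; case: ltngtP => [vw|op|ww]; last 2 first.
- by move=> _; split=> //; rewrite mem_pre; apply: (subvP s3); apply: memv_img.
- by move=> <-.
case: ifP => kw; last by move=> <-.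
move=> [c1 c2].
have [[lG IG dI EI] [l1 l2 l3 l4]] := marked_setup iHw (leqnn w) (ltnW wm) wm vw kw.
have c6 : (\dim (H w.+1) + (rho w.+1).*2)%N = m by rewrite s2.
rewrite l1 in c2.
have lL := perp_pre_lag c2 c6 (rho_le wm).
have Fx : (H w.+1 <= xim (rho w.+1))%VS.
  by apply: subv_trans (perp_pre_xim c2 c6) (ximS _); rewrite -addnn leq_addr.
have /mem_xim[h zE] := subvP Fx _ zH.
have hL : h \in pre (rho w.+1) (H w.+1) by rewrite mem_pre -zE.
have xz : xp (rho (mate w)) h = xp (w - mate w).+1./2 z by rewrite zE -xpowD l2.
exists h; split=> //.
- by rewrite mem_pre xz -c1; apply: (subvP (addvSr _ _)); apply: memv_img.
- exact: (lag_beta lL).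
apply/negP; rewrite mem_pre xz => xzn.
have [_ /(_ _ (leqW vw))[t1 t2 t3]] := hf.
have : (H (mate w).+1 <= H (mate w))%VS.
  rewrite -c1 subv_add subvv /= (add_lineE s1 _ zH zn) ?s2 ?(half_dim hf (leqnSn w)) //.
  by rewrite limgD limg_line subv_add l3 -memvE.
by move/dimvS; rewrite t2 (half_dim hf) ?ltnn // ltnW // ltnW.
Qed.

Lemma admits_ex H w : (w < m)%N -> fits w H -> exists z, admits H w z.
Proof.
move=> wm iH; have [hf hc] := iH; have k0 := two_row_gt0 S.
have dHw := half_dim hf (leqnn w).
rewrite /admits; case: ltngtP => [vw|op|ww]; last 2 first.
- have e : rho w = (rho w.+1).+1 by rewrite rhoS // /opener op.
  have [z zp zH] : {z | z \in pre 1 (H w) & z \notin H w}; last by exists z.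
  by apply: dim_lt_notin; rewrite (fits_dim_pre (ltnW wm) iH) ?dHw ?e // addn2.
- have Ew := early_at_ray iH (leqnn w) wm ww.
  exists (ray_vec w 0); split; last by rewrite Ew ray_vec_notin.
  by rewrite ray_spaceE; apply: (subvP (addvSr _ _)); apply: memv_line.
have [e1 [e2 e3]] := rho_closer wm vw.
case kw: (mk w); last first.
  have [z zp zH] : {z | z \in pre (w - mate w).+1./2 (H (mate w)) & z \notin H w}; last by exists z.
  by apply: dim_lt_notin; rewrite (fits_dim_pre (ltnW wm) iH) ?dHw ?e2 // ?(ltnW vw) // e1 leq_addr.
have [[lG IG dI EI] [l1 l2 l3 l4]] := marked_setup iH (leqnn w) (ltnW wm) wm vw kw.
set G0 := pre _ (H (mate w)) in lG IG *; set I := pre _ (H w) in IG dI EI.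
have [h0 h0P h0G] : {h | h \in perp I & h \notin G0}.
  by apply: dim_lt_notin; rewrite (proj2 lG) dim_perp_hyper.
have [g gG gI] : {g | g \in G0 & g \notin I}.
  by apply: dim_lt_notin; rewrite (proj2 lG) dI.
have gh : beta g h0 != 0.
  apply: contra h0G => /eqP gh; rewrite -(lag_perp lG); apply/perpP => u.
  rewrite (add_lineE IG _ gG gI) ?(proj2 lG) // => /memv_addP[i iI [_ /vlineP[c ->] ->]].
  by rewrite betaDl betaZl gh mulr0 addr0 (perpP _ _ h0P).
pose h := (2 * beta g h0) *: h0 - beta h0 h0 *: g.
exists (xp (rho w.+1) h); exists h; split=> //.
- rewrite -EI memvB ?memvZ //; apply: (subvP (perpS IG)); by rewrite lag_perp.
- exact: (iso_fix h0 (lag_beta lG gG gG)).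
- exact: iso_fix_notin.
Qed.

(** Only left endpoints of cups leave a choice; at a marked cup this is
    [two_lag]. *)
Lemma fits_unique H H' w : (w < m)%N -> fits w.+1 H -> fits w.+1 H' ->
  (forall s, (s <= w)%N -> H s = H' s) -> (mate w <= w)%N -> H w.+1 = H' w.+1.
Proof.
move=> wm iH iH' E mw; have [hf hc] := iH; have [hf' hc'] := iH'.
move: (hc w (leqnn _)) (hc' w (leqnn _)); rewrite /cond; case: ltngtP => [vw|op|ww].
- case: ifP => kw; last by rewrite -(E _ (ltnW vw)) => -> ->.
  move=> _ _; have iw := fitsW iH (leqnSn w).
  have [[lG IG dI EI] [l1 l2 l3 l4]] := marked_setup iw (leqnn w) (ltnW wm) wm vw kw.
  have key H1 : fits w.+1 H1 -> (forall s, (s <= w)%N -> H s = H1 s) ->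
     [/\ lagrangian (pre (rho w.+1) (H1 w.+1)), (pre (rho w.+1) (H w) <= pre (rho w.+1) (H1 w.+1))%VS,
       pre (rho (mate w)) (H (mate w)) <> pre (rho w.+1) (H1 w.+1) & (H1 w.+1 <= xim (rho w.+1))%VS].
    move=> i1 E1; have [f1 g1] := i1; have [_ /(_ w (leqnn _))[s1 s2 s3]] := f1.
    have Fx := fits_xim wm i1 (leqnn _).
    split=> //; last 1 first.
    - have [z zH zn] : {z | z \in H1 w.+1 & z \notin H1 w}.
        by apply: dim_lt_notin; rewrite s2 (half_dim f1).
      have := fits_admits wm i1 zH zn; rewrite /admits vw kw => -[h [zE _ _ hn]] E2.
      by case/negP: hn; rewrite -(E1 _ (ltnW vw)) E2 mem_pre -zE.
    - by apply: iso_lag; [exact: (fits_iso wm i1 (leqnn _))|rewrite (fits_dim_pre wm i1) // l4].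
    - by rewrite preS // (E1 _ (leqnn w)).
  have [k1 k2 k3 k4] := key H iH (fun s _ => erefl _).
  have [j1 j2 j3 j4] := key H' iH' E.
  have := two_lag lG k1 j1 IG k2 j2 dI k3 j3 => EE.
  by rewrite -(img_pre k4) EE (img_pre j4).
- by lia.
- by move=> -> ->.
Qed.

Lemma cond_eq H H' w : (forall s, (s <= w.+1)%N -> H s = H' s) -> cond H w -> cond H' w.
Proof.
move=> E; rewrite /cond; case: ltngtP => [vw|op|ww] //; last by rewrite (E w.+1).
by rewrite (E w.+1) // (E (mate w)) ?(E (mate w).+1) //; lia.
Qed.

Lemma fits_eq l H H' : (forall s, (s <= l)%N -> H s = H' s) -> fits l H -> fits l H'.
Proof.
move=> E [hf hc]; split; first exact: half_flag_eq hf.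
by move=> w wl; apply: cond_eq (hc w wl) => s sw; apply: E; lia.
Qed.

Lemma admits_eq H H' w z : (forall s, (s <= w)%N -> H s = H' s) -> admits H w z -> admits H' w z.
Proof.
move=> E; rewrite /admits; case: ltngtP => [vw|op|ww]; rewrite ?(E w) //.
by case: ifP => _; rewrite ?(E (mate w)) ?(E (mate w).+1) // ltnW.
Qed.

Definition upd (b : nat -> V) (i : nat) (z : V) (s : nat) := if s == i then z else b s.

Lemma upd_spanb b i z s : (s <= i)%N -> spanb (upd b i z) s = spanb b s.
Proof. by move=> si; apply: eq_spanb => t ts; rewrite /upd; case: eqP => //; lia. Qed.

Lemma upd_fits b w z : (w < m)%N -> fits w (spanb b) -> admits (spanb b) w z ->
  fits w.+1 (spanb (upd b w z)).
Proof.
move=> wm ib gz; apply: (@admits_fits _ w z) => //.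
- by apply: fits_eq ib => s sw; rewrite upd_spanb.
- by apply: admits_eq gz => s sw; rewrite upd_spanb.
- by rewrite spanbS /upd eqxx upd_spanb.
Qed.

Lemma fits_extend l b : (l <= m)%N -> fits l (spanb b) ->
  exists b', fits m (spanb b') /\ forall s, (s < l)%N -> b' s = b s.
Proof.
have [d] := ubnP (m - l); elim: d l b => // d IH l b hd lm ib.
have [E|lm'] := leqP m l; first by exists b; split=> //; apply: fitsW ib _.
have [z gz] := admits_ex lm' ib.
have [b' [i' e']] := IH l.+1 (upd b l z) ltac:(lia) lm' (upd_fits lm' ib gz).
exists b'; split=> // s sl; rewrite e' ?leqW // /upd; case: eqP => //; lia.
Qed.

Lemma fits_basis l H : fits l H -> exists b, forall s, (s <= l)%N -> spanb b s = H s.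
Proof.
move=> [[h0 h] _].
have ex s : exists z, (s < l)%N -> z \in H s.+1 /\ z \notin H s.
  have [sl|] := ltnP s l; last by exists 0.
  have [z z1 z2] : {z | z \in H s.+1 & z \notin H s}.
    apply: dim_lt_notin; have [_ -> _] := h s sl.
    by rewrite (@half_dim l) ?ltnS // ltnW.
  by exists z.
have [b hb] := choice ex; exists b; elim=> [|s IH] sl; first by rewrite spanb0 h0.
rewrite spanbS IH; last by lia.
have [b1 b2] := hb s sl; have [s1 s2 _] := h s sl.
by apply/esym/add_lineE => //; rewrite s2 (@half_dim l) // ltnW.
Qed.

Lemma fits_nonempty : exists b, fits m (spanb b).
Proof.
have i0 : fits 0 (spanb (fun _ => 0)) by split=> //; split=> //; apply: spanb0.
by have [b [ib _]] := fits_extend (leq0n _) i0; exists b.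
Qed.

(** At the left endpoint w any line of x^(-1) (H w) / H w is admissible, and this
    quotient has dimension 2. *)
Lemma fits_vary H w : (w < m)%N -> (w < mate w)%N -> fits m H ->
  exists H', [/\ fits m H', forall s, (s <= w)%N -> H' s = H s & H' w.+1 <> H w.+1].
Proof.
move=> wm op iH; have [b eb] := fits_basis iH; have [hf hc] := iH.
have iw := fitsW iH (ltnW wm); have k0 := two_row_gt0 S.
have ibw : fits w (spanb b) by apply: fits_eq iw => s sw; rewrite eb //; lia.
have [_ /(_ w wm)[s1 s2 s3]] := hf.
have e : rho w = (rho w.+1).+1 by rewrite rhoS // /opener op.
have [z zp zn] : {z | z \in pre 1 (H w) & z \notin H w.+1}.
  by apply: dim_lt_notin; rewrite (fits_dim_pre (ltnW wm) iw) ?e // s2 addn2.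
have gz : admits (spanb b) w z.
  rewrite /admits (eb w (ltnW wm)) ltnNge (ltnW op) /= gtn_eqF //; split=> //.
  by apply: contra zn; apply: (subvP s1).
have [b' [ib' eb']] := fits_extend wm (upd_fits wm ibw gz).
have eH s : (s <= w)%N -> spanb b' s = H s.
  move=> sw; rewrite -eb; last by lia.
  by rewrite -[RHS](@upd_spanb b w z) //; apply: eq_spanb => t ts; apply: eb'; lia.
exists (spanb b'); split=> // E; case/negP: zn; rewrite -E spanbS eb' // /upd eqxx.
by apply: (subvP (addvSr _ _)); apply: memv_line.
Qed.

(** * Polynomial curves in the set of a diagram *)

(** The conditions are only required for almost all parameters: the rank of a
    moving family may drop at finitely many of them. *)
Definition family l (F G : nat -> {vspace V}) (b : nat -> K -> V) : Prop :=
  [/\ forall s, polyV (b s), forall s, (s <= l)%N -> spanb (b^~ 0) s = F s,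
      forall s, (s <= l)%N -> spanb (b^~ 1) s = G s & gen (fun t => fits l (spanb (b^~ t)))].

Lemma family_xim l (F G : nat -> {vspace V}) b s r : (l <= m)%N -> fits l F -> fits l G -> family l F G b -> (s <= l)%N -> (r <= rho s)%N ->
  [/\ (spanb (b^~ 0%R) s <= xim r)%VS, (spanb (b^~ 1%R) s <= xim r)%VS &
     gen (fun t => (spanb (b^~ t) s <= xim r)%VS)].
Proof.
move=> lm iF iG [pb b0 b1 bg] sl rs; split.
- by rewrite b0 //; apply: subv_trans (fits_xim lm iF sl) (ximS rs).
- by rewrite b1 //; apply: subv_trans (fits_xim lm iG sl) (ximS rs).
- by apply: gen_imp bg => t it; apply: subv_trans (fits_xim lm it sl) (ximS rs).
Qed.

(** The factors c0, c1 are needed since the formula of [iso_fix] rescales vectors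
    that are already isotropic. *)
Lemma family_add l (F G : nat -> {vspace V}) b z z0 z1 c0 c1 : (l < m)%N -> fits l.+1 F -> fits l.+1 G ->
  family l F G b -> polyV z -> z0 \in F l.+1 -> z0 \notin F l -> z1 \in G l.+1 -> z1 \notin G l ->
  z 0 = c0 *: z0 -> z 1 = c1 *: z1 -> c0 != 0 -> c1 != 0 ->
  gen (fun t => admits (spanb (b^~ t)) l (z t)) ->
  family l.+1 F G (fun s => if s == l then z else b s).
Proof.
move=> lm iF iG [pb b0 b1 bg] pz z0F z0n z1G z1n e0 e1 n0 n1 gg.
set b' := fun s => _.
have eb t s : (s <= l)%N -> spanb (b'^~ t) s = spanb (b^~ t) s.
  by move=> sl; apply: eq_spanb => i il; rewrite /b'; case: eqP => //; lia.
have ebS t : spanb (b'^~ t) l.+1 = (spanb (b^~ t) l + <[z t]>)%VS.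
  by rewrite spanbS eb // /b' eqxx.
have lin (c : K) (u : V) : c != 0 -> <[c *: u]>%VS = <[u]>%VS.
  move=> cn; apply/eqP; rewrite eqEsubv -!memvE memvZ ?memv_line //=.
  by rewrite -{1}(scalerK cn u) memvZ ?memv_line.
split.
- by move=> s; rewrite /b'; case: ifP.
- move=> s; rewrite leq_eqVlt => /orP[/eqP ->|sl]; last by rewrite eb ?b0 // -ltnS.
  rewrite ebS b0 // e0 lin //; have [[_ /(_ l (leqnn _))[s1 s2 _]] _] := iF.
  by rewrite [RHS](add_lineE s1 _ z0F z0n) // s2 (half_dim (proj1 iF)).
- move=> s; rewrite leq_eqVlt => /orP[/eqP ->|sl]; last by rewrite eb ?b1 // -ltnS.
  rewrite ebS b1 // e1 lin //; have [[_ /(_ l (leqnn _))[s1 s2 _]] _] := iG.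
  by rewrite [RHS](add_lineE s1 _ z1G z1n) // s2 (half_dim (proj1 iG)).
apply: gen_imp (gen_and bg gg) => t [it gt].
apply: (@admits_fits _ l (z t)) => //.
- by apply: fits_eq it => s sl; rewrite eb.
- by apply: admits_eq gt => s sl; rewrite eb.
- by rewrite ebS eb.
Qed.

(** At a marked cup the vectors h of the two flags are joined inside I^perp and
    then corrected by [iso_fix] along a moving g of the Lagrangian attached to the
    left endpoint; at the two ends h is isotropic already and is only rescaled. *)
Lemma family_step l (F G : nat -> {vspace V}) b : (l < m)%N -> fits l.+1 F -> fits l.+1 G -> family l F G b ->
  exists b', family l.+1 F G b'.
Proof.
move=> lm iF iG fb; have lm' := ltnW lm.
have iFl := fitsW iF (leqnSn l); have iGl := fitsW iG (leqnSn l).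
have [pb b0 b1 bg] := fb.
have [z0 z0F z0n] : {z | z \in F l.+1 & z \notin F l}.
  by apply: dim_lt_notin; rewrite (half_dim (proj1 iF)) // (half_dim (proj1 iF)).
have [z1 z1G z1n] : {z | z \in G l.+1 & z \notin G l}.
  by apply: dim_lt_notin; rewrite (half_dim (proj1 iG)) // (half_dim (proj1 iG)).
have g0 := fits_admits lm iF z0F z0n; have g1 := fits_admits lm iG z1G z1n.
have add' z := @family_add l F G b z z0 z1 1 1 lm iF iG fb.
(* where admissibility is membership in a preimage, lift both vectors and
   interpolate *)
have lifted s r : (s <= l)%N -> (r <= rho s)%N -> z0 \in pre r (F s) -> z1 \in pre r (G s) ->
    (forall H z, z \in pre r (H s) -> z \notin H l -> admits H l z) -> exists b', family l.+1 F G b'.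
  move=> sl rs h0 h1 hgood.
  have [x0 x1 xg] := family_xim lm' iFl iGl fb sl rs.
  rewrite -b0 // in h0; rewrite -b1 // in h1.
  have [z [pz e0 e1 gz]] := lift_pre pb x0 x1 xg h0 h1.
  eexists; apply: (add' z) => //; rewrite ?scale1r ?oner_eq0 //.
  have gn : gen (fun t => z t \notin spanb (b^~ t) l).
    by apply: (gen_notin (t0 := 0)) => //; rewrite ?b0 ?e0 // (half_dim (proj1 iF)).
  by apply: gen_imp (gen_and gz gn) => t [h2 h3]; apply: hgood.
move: g0 g1; rewrite {1 2}/admits; case: ltngtP => [vw|op|ww].
- have [e1 [e2 e3]] := rho_closer lm vw; have vl := ltnW vw.
  case kw: (mk l); last first.
    move=> [h0 _] [h1 _]; apply: (lifted _ _ vl _ h0 h1); first by rewrite e1 leq_addr.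
    by move=> H z hz zn; rewrite /admits vw kw.
  move=> [h0 [zE0 h0p h00 h0n]] [h1 [zE1 h1p h10 h1n]].
  have mv := mateK D lm; have ov : (mate l < mate (mate l))%N by rewrite mv.
  have setup H : fits l H -> _ := fun i => marked_setup i (leqnn l) lm' lm vw kw.
  have exg H h : fits l H -> h \notin pre (rho (mate l)) (H (mate l)) ->
      exists2 g, g \in pre (rho (mate l)) (H (mate l)) & beta g h != 0.
    move=> iH hn; have [[lG _ _ _] _] := setup H iH.
    apply: contrapT => hg; case/negP: hn; rewrite -(lag_perp lG); apply/perpP => g gG.
    by apply/eqP; apply: contrapT => /negP gh; apply: hg; exists g.
  have [g0 g0p g0h] := exg F h0 iFl h0n; have [g1 g1p g1h] := exg G h1 iGl h1n.
  have [x0 x1 xg] := family_xim lm' iFl iGl fb vl (leqnn _).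
  rewrite -b0 // in g0p; rewrite -b1 // in g1p.
  have [g [pg eg0 eg1 gg]] := lift_pre pb x0 x1 xg g0p g1p.
  have kv : mk (mate l) by have [] := Mk lm kw.
  have xS H : fits l H -> (H (mate l).+1 <= xim (rho (mate l)))%VS.
    move=> iH; have [[lG IG dI EI] [l1 l2 l3 l4]] := setup H iH.
    apply: dim_pre_xim; rewrite -EI dim_perp_hyper // (half_dim (proj1 iH)) //.
    by have [e4 _] := late_after (ltn_trans vw lm) kv ov; rewrite addSn e4.
  have X0 : (spanb (b^~ 0%R) (mate l).+1 <= xim (rho (mate l)))%VS by rewrite b0 //; apply: xS.
  have X1 : (spanb (b^~ 1%R) (mate l).+1 <= xim (rho (mate l)))%VS by rewrite b1 //; apply: xS.
  have Xg : gen (fun t => (spanb (b^~ t) (mate l).+1 <= xim (rho (mate l)))%VS).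
    by apply: gen_imp bg => t it; apply: xS.
  rewrite -b0 // in h0p; rewrite -b1 // in h1p.
  have [h [ph eh0 eh1 gh]] := lift_pre pb X0 X1 Xg h0p h1p.
  (* isotropic for every t, equal to multiples of z0, z1 at the ends *)
  pose z t := xp (rho l.+1) ((2 * beta (g t) (h t)) *: h t - beta (h t) (h t) *: g t).
  have pgh : polyK (fun t => beta (g t) (h t)) by apply: polyK_beta.
  eexists; apply: (@family_add l F G b z z0 z1 (2 * beta g0 h0) (2 * beta g1 h1)) => //.
  - apply: polyV_img; apply: polyV_add.
      by apply: polyV_scale => //; apply: polyK_mul => //; apply: polyK_const.
    apply: (polyV_ext (w := fun t => (- beta (h t) (h t)) *: g t)); first by move=> t; rewrite scaleNr.
    by apply: polyV_scale => //; apply: polyK_opp; apply: polyK_beta.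
  - by rewrite /z eg0 eh0 h00 scale0r subr0 xpZ zE0.
  - by rewrite /z eg1 eh1 h10 scale0r subr0 xpZ zE1.
  - by rewrite mulf_neq0 // pnatr_eq0.
  - by rewrite mulf_neq0 // pnatr_eq0.
  have gn : gen (fun t => beta (g t) (h t) != 0) by apply: (gen_neq0 (t0 := 0) pgh); rewrite eg0 eh0.
  apply: gen_imp (gen_and (gen_and gg gh) (gen_and gn bg)) => t [[gt ht] [nt it]].
  have [[lG IG dI EI] [l1 l2 l3 l4]] := setup _ it.
  have [[_ /(_ _ vw)[s1 _ _]] _] := it.
  rewrite /admits vw kw; eexists; split; first by [].
  - by rewrite memvB ?memvZ //; apply: (subvP (preS _ s1)).
  - by apply: iso_fix; apply: (lag_beta lG).
  - exact: iso_fix_notin.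
- move=> [h0 _] [h1 _]; apply: (lifted l 1%N) => //.
    by rewrite rhoS // /opener op.
  by move=> H z hz zn; rewrite /admits ltnNge (ltnW op) /= gtn_eqF.
- have E : F l = G l by rewrite (early_at_ray iFl _ lm ww) // (early_at_ray iGl _ lm ww).
  have ES : F l.+1 = G l.+1.
    move: (proj2 iF l (leqnn _)) (proj2 iG l (leqnn _)); rewrite /cond ww ltnn eqxx => -> ->; by [].
  move=> [h0 _] _; eexists.
  apply: (@family_add l F G b (fun _ => z0) z0 z0 1 1) => //; rewrite ?scale1r ?oner_eq0 -?ES -?E //.
    exact: polyV_const.
  apply: gen_imp bg => t it; rewrite /admits ww ltnn eqxx; split=> //.
  by rewrite (early_at_ray it _ lm ww) // -(early_at_ray iFl _ lm ww).
Qed.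

(** The curve is built step by step up to m; the larger steps are the orthogonals,
    for which bases are provided by [full_family]. *)
Lemma curve (F G : nat -> {vspace V}) : fits m F -> fits m G ->
  exists b : nat -> K -> V, [/\ forall s, polyV (b s),
    forall i, (i <= m)%N -> spanb (b^~ 0) i = F i /\ spanb (b^~ 0) (n - i) = perp (F i),
    forall i, (i <= m)%N -> spanb (b^~ 1) i = G i /\ spanb (b^~ 1) (n - i) = perp (G i) &
    gen (fun t => fits m (spanb (b^~ t)) /\
      forall i, (i <= m)%N -> spanb (b^~ t) (n - i) = perp (spanb (b^~ t) i))].
Proof.
move=> iF iG.
have [b [pb b0 b1 bg]] : exists b, family m F G b.
  suff h l : (l <= m)%N -> exists b, family l F G b by apply: (h m).
  elim: l => [|l IH] lm; last first.
    have [b fb] := IH (ltnW lm).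
    by apply: (family_step lm (fitsW iF lm) (fitsW iG lm) fb).
  exists (fun _ _ => 0); split.
  - by move=> s; apply: polyV_const.
  - by move=> s; rewrite leqn0 => /eqP ->; rewrite spanb0; case: iF => -[-> _].
  - by move=> s; rewrite leqn0 => /eqP ->; rewrite spanb0; case: iG => -[-> _].
  - by apply: gen_all => t; split=> //; split=> //; apply: spanb0.
have lag H : fits m H -> lagrangian (H m).
  move=> iH; apply: iso_lag; last by rewrite (half_dim (proj1 iH)).
  by have := fits_iso (leqnn _) iH (leqnn _); rewrite nop0 pre0.
have [|b' [Q [pb' eb' gQ [Q0 Q1] hQ]]] := full_family pb.
  move=> t [->|->] i im; first by rewrite b0 // (half_dim (proj1 iF)).
  by rewrite b1 // (half_dim (proj1 iG)).
have eb t i : (i <= m)%N -> spanb (b'^~ t) i = spanb (b^~ t) i.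
  by move=> im; apply: eq_spanb => s si; rewrite eb' // (leq_trans si).
have m2 := double_m.
have E t i : Q t -> lagrangian (spanb (b^~ t) m) -> (i <= m)%N ->
    spanb (b'^~ t) (n - i) = perp (spanb (b'^~ t) i).
  move=> qt lt im; have -> : (n - i = m + (m - i))%N by lia.
  by rewrite hQ ?leq_subr // subKn.
exists b'; split=> //.
- move=> i im; rewrite eb // b0 //; split=> //.
  by rewrite E // ?eb ?b0 //; apply: lag.
- move=> i im; rewrite eb // b1 //; split=> //.
  by rewrite E // ?eb ?b1 //; apply: lag.
apply: gen_imp (gen_and gQ bg) => t [qt it]; split; last by move=> i im; rewrite E //; apply: lag.
by apply: fits_eq it => s sm; rewrite eb.
Qed.

(** * Separating a flag from the set of a diagram *)

(** G and G' belong to opposite families. *)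
Definition opp_fam (G G' : {vspace V}) := odd (m + \dim (G :&: G')).

Lemma opp_famE (G G' L : {vspace V}) : lagrangian G -> lagrangian G' -> lagrangian L ->
  opp_fam G G' = opp_fam G L (+) opp_fam G' L.
Proof.
move=> lG lG' lL; rewrite /opp_fam -(lag_parity lG lG' lL) !oddD addbACA addbb.
by [].
Qed.

Lemma opp_famC (G G' : {vspace V}) : opp_fam G G' = opp_fam G' G.
Proof. by rewrite /opp_fam capvC. Qed.

Lemma opp_fam_id (G : {vspace V}) : lagrangian G -> opp_fam G G = false.
Proof. by move=> lG; rewrite /opp_fam capvv (proj2 lG) addnn odd_double. Qed.

Lemma opp_fam_adj (I G G' : {vspace V}) : lagrangian G -> lagrangian G' ->
  (I <= G)%VS -> (I <= G')%VS -> (\dim I).+1 = m -> G <> G' -> opp_fam G G'.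
Proof.
move=> lG lG' IG IG' dI ne; rewrite /opp_fam.
have : (\dim (G :&: G') < m)%N.
  rewrite ltnNge; apply/negP => h; apply: ne; apply/eqP; rewrite eqEdim (proj2 lG) (proj2 lG') leqnn andbT.
  have /eqP <- : (G :&: G' == G)%VS by rewrite eqEdim capvSl (proj2 lG).
  exact: capvSr.
have : (\dim I <= \dim (G :&: G'))%N by rewrite dimvS // subv_cap IG.
move: (\dim (G :&: G')) => d h1 h2; have -> : d = \dim I by lia.
by rewrite -dI addSn /= addnn odd_double.
Qed.

Lemma late_lag l F o : (l <= m)%N -> fits l F -> (o <= l)%N -> closedI mate m 0 o ->
  (forall u, (o <= u < m)%N -> mate u <> u) -> lagrangian (pre (rho o) (F o)).
Proof.
move=> lm iF ol co nr; have om := leq_trans ol lm.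
have e := late_rho om (closedI_rest D (closedI0m D) co om) nr.
by apply: iso_lag; [exact: (fits_iso lm iF ol)|rewrite (fits_dim_pre lm) // e].
Qed.

Lemma marked_adj F w : (w < m)%N -> fits w.+1 F -> (mate w < w)%N -> mk w ->
  [/\ lagrangian (pre (rho w.+1) (F w.+1)), lagrangian (pre (rho (mate w)) (F (mate w))) &
     opp_fam (pre (rho w.+1) (F w.+1)) (pre (rho (mate w)) (F (mate w)))].
Proof.
move=> wm iF vw kw; have iFw := fitsW iF (leqnSn w); have [hf hc] := iF.
have [[lG IG dI EI] [l1 l2 l3 l4]] := marked_setup iFw (leqnn w) (ltnW wm) wm vw kw.
have [_ /(_ w (leqnn _))[s1 s2 s3]] := hf.
have lL : lagrangian (pre (rho w.+1) (F w.+1)).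
  by apply: iso_lag; [exact: (fits_iso wm iF (leqnn _))|rewrite (fits_dim_pre wm iF) // l4].
split=> //; apply: (@opp_fam_adj (pre (rho w.+1) (F w))) => //; first by apply: preS.
have [z zH zn] : {z | z \in F w.+1 & z \notin F w}.
  by apply: dim_lt_notin; rewrite s2 (half_dim hf).
have := fits_admits wm iF zH zn; rewrite /admits vw kw => -[h [zE _ _ hn]] E2.
by case/negP: hn; rewrite -E2 mem_pre -zE.
Qed.

(** Along the outer positions right of all rays the family is kept by unmarked cups
    and changed by marked ones, starting from the space at the last ray, which is
    fixed by the diagram, or from 0 if there is no ray. *)
Lemma same_family l F F' o : (l <= m)%N -> fits l F -> fits l F' -> (o <= l)%N -> closedI mate m 0 o ->
  (forall u, (o <= u < m)%N -> mate u <> u) -> ~~ opp_fam (pre (rho o) (F o)) (pre (rho o) (F' o)).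
Proof.
move=> lm iF iF'; have [d] := ubnP o; elim: d o => // d IH o od ol co nr.
have lF := late_lag lm iF ol co nr; have lF' := late_lag lm iF' ol co nr.
suff [E|//] : F o = F' o \/ ~~ opp_fam (pre (rho o) (F o)) (pre (rho o) (F' o)).
  by rewrite E opp_fam_id.
case: o od ol co nr lF lF' => [|w] od ol co nr lF lF'; first by left; case: iF iF' => -[-> _] _ [[-> _] _].
have wm : (w < m)%N := leq_trans ol lm.
have iFw := fitsW iF ol; have iFw' := fitsW iF' ol.
have [_ /(_ w)] := co; rewrite leq0n /= ltnSn => /(_ isT); rewrite ltnS leq_eqVlt => /orP[/eqP ww|vw].
  by left; move: (proj2 iFw w (leqnn _)) (proj2 iFw' w (leqnn _)); rewrite /cond ww ltnn eqxx => -> ->.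
right; have vm := ltn_trans vw wm; have mv := mateK D wm.
have ov : (mate w < mate (mate w))%N by rewrite mv.
have cv : closedI mate m 0 (mate w).
  by apply: (closedI_rest_l D co) => //; have := closedI_cup D vm ov; rewrite mv.
have nrv u : (mate w <= u < m)%N -> mate u <> u.
  move=> hu; have [h|h] := ltnP w u; first by apply: nr; lia.
  have [->|nw] := eqVneq u w; first by lia.
  have [->|nv] := eqVneq u (mate w); first by lia.
  by apply: (cups_no_ray D vm); rewrite mv; lia.
have vd : (mate w < d)%N by lia.
have vl : (mate w <= l)%N by lia.
have IHv := IH _ vd vl cv nrv.
have [e1 [e2 e3]] := rho_closer wm vw.
case kw: (mk w).
  have [a1 a2 a3] := marked_adj wm iFw vw kw.
  have [b1 b2 b3] := marked_adj wm iFw' vw kw.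
  by rewrite (opp_famE a1 b1 a2) a3 (opp_famE b1 a2 b2) b3 (negPf IHv).
move: (proj2 iFw w (leqnn _)) (proj2 iFw' w (leqnn _)); rewrite /cond vw kw => -> ->.
by rewrite !pre_pre (addnC (rho w.+1)) -e1.
Qed.

Definition full_flag F := half_flag m F /\ forall i, (i <= n)%N -> F (n - i)%N = perp (F i).

(** Membership in a fixed subspace as the vanishing of a linear map. *)
Lemma lker_sub_proj (U : {vspace V}) v : ((\1 - projv U)%VF v == 0) = (v \in U).
Proof.
rewrite add_lfunE opp_lfunE id_lfunE subr_eq0; apply/eqP/idP => [->|/projv_id //].
exact: memv_proj.
Qed.

(** A flag of the Springer fiber outside the set of a diagram is separated from
    it either by an incidence condition or by a degenerate pairing. *)
Lemma separation F0 : full_flag F0 -> ~ fits m F0 ->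
  (exists (L : 'End(V)) (i j : nat), [/\ (i <= n)%N, (j <= n)%N, ~~ (L @: F0 i <= F0 j)%VS &
     forall F, full_flag F -> fits m F -> (L @: F i <= F j)%VS]) \/
  (exists (j : nat) (y : 'I_j -> V), [/\ (j <= n)%N,
     forall b, b \in F0 j -> (forall i, beta b (y i) = 0) -> b = 0 &
     forall F, full_flag F -> fits m F ->
       exists b, [/\ b \in F j, b != 0 & forall i, beta b (y i) = 0]]).
Proof.
move=> fF0 nF0; have [hF0 pF0] := fF0; have m2 := double_m.
have [w [wm cw ncw]] : exists w, [/\ (w < m)%N, forall u, (u < w)%N -> cond F0 u & ~ cond F0 w].
  have ex : exists w, (w < m)%N && ~~ `[< cond F0 w >].
    apply: contrapT => h; apply: nF0; split=> // w wm; apply: contrapT => nc.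
    by apply: h; exists w; rewrite wm; apply/asboolPn.
  have [w /andP[wm /asboolPn nc] wmin] := ex_minnP ex; exists w; split=> // u uw.
  apply: contrapT => /asboolPn ncu; have := wmin u; rewrite (ltn_trans uw wm) ncu => /(_ isT).
  by lia.
have i0 : fits w F0 by split=> //; apply: half_flagW hF0 (ltnW wm).
have [_ /(_ w wm)[s1 s2 s3]] := hF0.
have wn : (w.+1 <= n)%N by lia.
move: ncw; rewrite /cond; case: ltngtP => [vw|op|ww] ncw //; last first.
  (* F w.+1 is a fixed space: a projection maps it into F 0 = 0 *)
  have incl F : full_flag F -> fits m F -> F w.+1 = ray_space w.
    by move=> _ [_ hc]; have := hc w wm; rewrite /cond ww ltnn eqxx.
  left; exists (\1 - projv (ray_space w))%VF, w.+1, 0%N; split=> //.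
    apply/negP => h; apply: ncw; apply/eqP; rewrite eqEdim s2; apply/andP; split.
      apply/subvP => v vF; rewrite -lker_sub_proj -memv0 -(proj1 hF0).
      by apply: (subvP h); apply: memv_img.
    rewrite /ray_space spef_cat span_seq1.
    apply: leq_trans (leq_of_leqif (dimv_add_leqif _ _)) _.
    have e3 : (cnt w <= w)%N by rewrite /nop subn0 (leq_trans (count_size _ _)) // size_iota.
    by have := dim_spef_le (w - cnt w) (cnt w); rewrite dim_vline; case: (_ != _); lia.
  move=> F fF iF; apply/subvP => _ /memv_imgP[v vF ->]; rewrite (proj1 (proj1 fF)) memv0.
  by rewrite lker_sub_proj -(incl F fF iF).
have vm := ltn_trans vw wm; have vl := ltnW vw.
have [e1 [e2 e3]] := rho_closer wm vw.
move: ncw; case kw: (mk w) => ncw; last first.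
  (* x^r maps F w.+1 into F (mate w), and equality follows by dimension *)
  left; exists (xp (w - mate w).+1./2), w.+1, (mate w); split=> //; first by lia.
    apply/negP => h; apply: ncw; apply/eqP; rewrite eqEdim s2 -img_sub_pre h /=.
    by rewrite (fits_dim_pre (ltnW wm) i0 vl) ?e2 // e1 leq_addr.
  move=> F fF [_ hc]; have := hc w wm; rewrite /cond vw kw img_sub_pre => ->; exact: subvv.
have [[lG IG dI EI] [l1 l2 l3 l4]] := marked_setup i0 (leqnn w) (ltnW wm) wm vw kw.
have [h|h] := boolP (xp (m - w.+1) @: F0 (n - w.+1)%N <= F0 w.+1)%VS; last first.
  left; exists (xp (m - w.+1)), (n - w.+1)%N, w.+1; split=> //; first by apply: leq_subr.
  move=> F fF [_ hc]; have := hc w wm; rewrite /cond vw kw => -[_ c2].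
  by rewrite (proj2 fF) // c2 img_sub_pre subvv.
have c2 : perp (F0 w.+1) = pre (m - w.+1) (F0 w.+1).
  apply/eqP; rewrite eqEdim -pF0 // -img_sub_pre h /= pF0 //.
  have := dim_pre_le (m - w.+1) (F0 w.+1); have := dim_perp (F0 w.+1); rewrite s2; lia.
have c6 : (\dim (F0 w.+1) + (rho w.+1).*2)%N = m by rewrite s2.
rewrite l1 in c2.
have rk : ((rho w.+1).*2 <= k)%N by apply: rho_le.
have lL := perp_pre_lag c2 c6 rk.
have Fx : (F0 w.+1 <= xim (rho w.+1))%VS.
  by apply: subv_trans (perp_pre_xim c2 c6) (ximS _); rewrite -addnn leq_addr.
(* the only remaining failure is that F0 takes the Lagrangian of the left endpoint *)
have EG : pre (rho w.+1) (F0 w.+1) = pre (rho (mate w)) (F0 (mate w)).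
  have xr : (xp (w - mate w).+1./2 @: F0 w.+1 <= F0 (mate w))%VS.
    apply: contrapT => /negP nx; apply: ncw; split; last by rewrite l1.
    have [_ /(_ _ vm)[t1 t2 t3]] := hF0.
    apply/eqP; rewrite eqEdim t2; apply/andP; split.
      rewrite subv_add t1 img_sub_pre /=.
      have cc := closer_concat i0 (leqnn w) wm vw.
      have r0 : (0 < (w - mate w).+1./2)%N by rewrite half_gt0 ltnS subn_gt0.
      by move: s3; rewrite img_sub_pre {1}cc pre_pre add1n prednK.
    have [z zx zn] := notin_sub nx.
    apply: leq_trans (_ : \dim (F0 (mate w) + <[z]>) <= _)%N.
      by rewrite dim_add_line // (half_dim hF0) // ltnW.
    by apply: dimvS; rewrite addvS // -memvE.
  apply/eqP; rewrite eqEdim (proj2 lL) (proj2 lG) leqnn andbT.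
  by rewrite l2 (addnC (w - mate w).+1./2) -pre_pre preS // -img_sub_pre.
have [E [lE E0]] := lag_transversal lG; rewrite -EG in lG E0.
right; set G0 := pre (rho w.+1) (F0 w.+1) in lG E0 *.
have kG0 : (spef (rho w.+1) (rho w.+1) [::] <= G0)%VS by apply: lker_pre.
have kE v : v \in E -> v \in G0 -> v = 0.
  by move=> vE vG; apply/eqP; rewrite -memv0 -E0 memv_cap vG.
(* vectors of E are detected on F w.+1 through their images: y lifts a basis of W
   through x^rho *)
pose W := (E :&: xim (rho w.+1))%VS.
have PW : perp W = (E + spef (rho w.+1) (rho w.+1) [::])%VS.
  apply: (can_inj (@perpK)); rewrite perpK perpD (lag_perp lE) -lker_xpow /W; congr (_ :&: _)%VS.
  by rewrite -lpreim0 -[(_ @^-1: 0)%VS]/(pre (rho w.+1) 0) perp_pre perp0.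
have dW : \dim W = w.+1.
  have dk : \dim (spef (rho w.+1) (rho w.+1) [::]) = (rho w.+1).*2.
    have r1 : (rho w.+1 <= k)%N by apply: leq_trans rk; rewrite -addnn leq_addr.
    by rewrite dim_spef ?addnn // (leq_trans r1) // (two_row_ge S).
  have dj : \dim (E + spef (rho w.+1) (rho w.+1) [::]) = (m + (rho w.+1).*2)%N.
    rewrite dimv_disjoint_sum ?dk ?(proj2 lE) //; apply/eqP; rewrite -subv0; apply/subvP => v.
    by case/memv_capP=> vE /(subvP kG0) vG; rewrite (kE v) ?mem0v.
  have e := dim_perp W; rewrite PW dj in e.
  have /addnI : (m + ((rho w.+1).*2 + \dim W) = m + m)%N by rewrite addnA e addnn m2.
  by rewrite -[RHS]l4 addnC => /addIn.
have [y yW] : exists y : 'I_w.+1 -> V, forall i, xp (rho w.+1) (y i) = (vbasis W)`_i.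
  suff ex (i : 'I_w.+1) : exists z, xp (rho w.+1) z = (vbasis W)`_i by have [y hy] := choice ex; exists y.
  have : (vbasis W)`_i \in W by apply/vbasis_mem/mem_nth; rewrite size_tuple dW.
  by case/memv_capP=> _ /mem_xim[z ->]; exists z.
have yP g : (forall i, beta (xp (rho w.+1) g) (y i) = 0) -> g \in perp W.
  move=> hg; apply/perpP => u uW; rewrite (coord_vbasis uW) betaC.
  rewrite (big_morph (beta g) (betaDr _) (beta0r _)) big1 // => i _; rewrite betaZr.
  have iw : (i < w.+1)%N by rewrite -dW.
  have := hg (Ordinal iw); rewrite beta_xpow yW /= => /eqP; rewrite mulf_eq0 signr_eq0 /= => /eqP ->.
  by rewrite mulr0.
exists w.+1, y; split=> //.
  move=> b bF hb; have /mem_xim[g bE] := subvP Fx _ bF.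
  have : g \in perp W by apply: yP => i; rewrite -bE.
  rewrite PW => /memv_addP[e eE [kk kkk gE]].
  have e0 : e = 0.
    apply: kE => //; have -> : e = g - kk by rewrite gE addrK.
    by rewrite memvB ?(subvP kG0 _ kkk) // /G0 mem_pre -bE.
  by move: kkk; rewrite -lker_xpow memv_ker bE gE e0 add0r => /eqP.
move=> F fF iF; have iFw := fitsW iF wm.
have mv := mateK D wm; have ov : (mate w < mate (mate w))%N by rewrite mv.
have kv : mk (mate w) by have [] := Mk wm kw.
have [a1 a2 a3] := marked_adj wm iFw vw kw.
have co := marked_outer D Mk vm kv (ltnW ov).
have sf := same_family (ltnW wm) (fitsW iF (ltnW wm)) i0 vl co (fun u hu => marked_late D Mk vm kv ov hu).
rewrite -EG -/G0 in sf.
(* opposite to G0, hence not transversal to E *)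
have op : opp_fam (pre (rho w.+1) (F w.+1)) G0 by rewrite (opp_famE a1 lG a2) a3 opp_famC (negPf sf).
have [e eG e0] : {e | e \in (pre (rho w.+1) (F w.+1) :&: E)%VS & e \notin 0%VS}.
  apply: dim_lt_notin; rewrite dimv0 lt0n; apply/negP => /eqP d0.
  by move: op; rewrite /opp_fam -(lag_parity a1 lG lE) d0 E0 dimv0.
have [eF eE] := memv_capP eG; exists (xp (rho w.+1) e); split; first by rewrite -mem_pre.
  apply: contra e0 => /eqP xe; rewrite (kE e) ?mem0v //; apply: (subvP kG0).
  by rewrite -lker_xpow memv_ker xe.
move=> i; rewrite beta_xpow yW.
have : (vbasis W)`_i \in W by apply/vbasis_mem/mem_nth; rewrite size_tuple dW.
by case/memv_capP=> wE _; rewrite (lag_beta lE) ?mulr0.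
Qed.

End Diagram.

(** * Distinct diagrams have incomparable sets *)

Section Incomparable.
Variables (mate : nat -> nat) (mk mk' : nat -> bool).
Hypothesis D : cups m mate.
Hypothesis Mk : marking m mate mk.
Hypothesis Mk' : marking m mate mk'.
Hypothesis Nc : nop mate 0 m = k./2.

Lemma ray_space_neq u : (u < m)%N -> mate u = u -> mk u -> mk' u = false ->
  ray_space mate mk u <> ray_space mate mk' u.
Proof.
move=> um uu ku nku; rewrite (ray_spaceE D Mk Nc) (ray_spaceE D Mk' Nc) => E.
have : ray_vec mate mk u 0 \in (spef (u - nop mate 0 u) (nop mate 0 u) [::] + <[ray_vec mate mk' u 0]>)%VS.
  by rewrite -E; apply: (subvP (addvSr _ _)); apply: memv_line.
case/memv_addP=> a /mem_spef[ae af] [_ /vlineP[c ->] vE].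
have [l [el h1 h2 h3 h4]] := ray_sizes D Mk Nc um uu.
have cu := rho_cnt D Mk Nc (ltnW um).
have co : ecoef (u - nop mate 0 u)%N (ray_vec mate mk u 0) = c * ecoef (u - nop mate 0 u)%N (ray_vec mate mk' u 0).
  by rewrite vE ecoefD ae // add0r ecoefZ.
have cf : fcoef (nop mate 0 u) (ray_vec mate mk u 0) = c * fcoef (nop mate 0 u) (ray_vec mate mk' u 0).
  by rewrite vE fcoefD af // add0r fcoefZ.
move: co cf; rewrite /ray_vec !addn0 !ecoefD !fcoefD !ecoefZ !fcoefZ !ecoef_ev !fcoef_ev !ecoef_fv !fcoef_fv !eqxx !andbT.
rewrite (_ : (nop mate 0 u < k)%N); last by lia.
rewrite (_ : (u - nop mate 0 u < p)%N); last by lia.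
rewrite !mulr0 !mulr1 !addr0 !add0r /ray_weight ku nku.
have -> : lastray mate u.
  apply/allP => i; rewrite mem_iota => hi; apply/eqP.
  by have [_ a1 _] := Mk um ku; apply: a1; rewrite ?uu ?maxnn; lia.
case: ifP => _ /=.
  by move=> _ /eqP; rewrite mulr0 oner_eq0.
move=> E1 E2; have c1 : c = 1 by rewrite E2 mulr1.
move: E1; rewrite c1 mul1r => /eqP; rewrite -addr_eq0 -mulr2n mulrn_eq0.
by rewrite (negPf (gam_neq0 S)).
Qed.

(** At a ray the two marks give different spaces; at a cup the marked condition
    excludes the unmarked one. *)
Lemma marks_agree H w : (w < m)%N -> fits mate mk m H -> fits mate mk' m H -> mk w -> mk' w.
Proof.
move=> wm iH iH'.
suff h u : (u < m)%N -> (mate u <= u)%N -> mk u -> mk' u.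
  have [wv|] := ltnP w (mate w); last by move/h; apply.
  move=> kw; have vm := mate_lt D wm; have [kv _ _] := Mk wm kw.
  have := h _ vm; rewrite (mateK D) // => /(_ (ltnW wv) kv) kv'.
  by have [] := Mk' vm kv'; rewrite (mateK D).
move=> um vu ku; apply: contraT => /negPf nku.
have := proj2 iH u um; have := proj2 iH' u um; rewrite /cond.
case: ltngtP vu => // [vu _|uu _].
  rewrite ku nku => E [c1 _]; have [hf _] := iH; have vm := ltn_trans vu um.
  have [_ /(_ _ vm)[s1 s2 s3]] := hf.
  have : (H (mate u).+1 <= H (mate u))%VS by rewrite -c1 subv_add subvv /= img_sub_pre -E.
  by move/dimvS; rewrite s2 (half_dim hf) ?ltnn // ltnW.
by move=> E1 E2; case: (ray_space_neq um uu ku nku); rewrite -E1 -E2.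
Qed.

End Incomparable.

Lemma count_sub_eq (T : Type) (a b : pred T) s : (forall x, a x -> b x) ->
  count a s = count b s -> all (fun x => a x == b x) s.
Proof.
move=> ab; have le t : (count a t <= count b t)%N by apply: sub_count.
elim: s => //= x s IH; have := ab x; case: (a x) (b x) => [] [] //=.
- by move=> _ /addnI.
- by move/(_ isT).
- by move=> _ E; have := le s; rewrite -[in X in (X <= _)%N](add0n (count a s)) E ltnn.
Qed.

Lemma full_flag_ex mate mk H : cups m mate -> marking m mate mk -> nop mate 0 m = k./2 -> fits mate mk m H ->
  exists2 H', full_flag H' & forall s, (s <= m)%N -> H' s = H s.
Proof.
move=> D Mk Nc iH; exists (fun s => if (s <= m)%N then H s else perp (H (n - s)%N)); last by move=> s ->.
have m2 := double_m.
have lH : lagrangian (H m).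
  apply: iso_lag; last by rewrite (half_dim (proj1 iH)).
  by have := fits_iso D Mk Nc (leqnn _) iH (leqnn _); rewrite nop0 pre0.
split; first by apply: half_flag_eq (proj1 iH) => s ->.
move=> i ni; case: (ltngtP i m) => im.
- by rewrite leqNgt (_ : (m < n - i)%N) /= ?subKn //; lia.
- by rewrite (_ : (n - i <= m)%N) ?perpK //; lia.
- by rewrite im (_ : (n - m)%N = m) ?leqnn ?lag_perp //; lia.
Qed.

Lemma fits_ext mate mk mate' mk' H : (forall w, (w < m)%N -> mate' w = mate w) ->
  (forall w, (w < m)%N -> mk' w = mk w) -> fits mate mk m H -> fits mate' mk' m H.
Proof.
move=> mE kE [hf hc]; split=> // u um; move: (hc u um); rewrite /cond mE // kE //.
have nE s : (s <= m)%N -> nop mate' 0 s = nop mate 0 s.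
  move=> sm; rewrite /nop; apply: eq_in_count => i; rewrite mem_iota => hi; rewrite /opener mE //; lia.
have lE : lastray mate' u = lastray mate u.
  by apply: eq_in_all => i; rewrite mem_iota => hi; rewrite mE //; lia.
by rewrite /ray_space /ray_vec /ray_weight nE ?(ltnW um) // lE kE.
Qed.

(** The sets attached to two diagrams are comparable only if the diagrams agree:
    a left endpoint of the first diagram, where the flag can be varied, must be
    one of the second, and both have the same number of cups. *)
Lemma diagrams_agree mate mk mate' mk' : cups m mate -> marking m mate mk -> nop mate 0 m = k./2 ->
  cups m mate' -> marking m mate' mk' -> nop mate' 0 m = k./2 ->
  (forall H, full_flag H -> fits mate mk m H -> fits mate' mk' m H) ->
  (forall w, (w < m)%N -> mate' w = mate w) /\ (forall w, (w < m)%N -> mk' w = mk w).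
Proof.
move=> D Mk Nc D' Mk' Nc' sub.
have sub' H : fits mate mk m H -> fits mate' mk' m H.
  by move=> iH; have [H' f' e'] := full_flag_ex D Mk Nc iH; apply: (fits_eq D' Mk' Nc' e'); apply: sub => //; apply: (fits_eq D Mk Nc _ iH) => s /e'.
have [b ib] := fits_nonempty D Mk Nc.
have op w : (w < m)%N -> (w < mate w)%N -> (w < mate' w)%N.
  move=> wm wo; rewrite ltnNge; apply/negP => nw.
  have [H' [i' e' ne]] := fits_vary D Mk Nc wm wo ib.
  apply: ne; apply: (fits_unique D' Mk' Nc' wm _ _ e' nw); first exact: fitsW (sub' _ i') wm.
  exact: fitsW (sub' _ ib) wm.
have opE w : (w < m)%N -> (w < mate w)%N = (w < mate' w)%N.
  move=> wm.
  have := @count_sub_eq _ (fun u => (u < m)%N && opener mate u) (fun u => (u < m)%N && opener mate' u) (iota 0 m).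
  have cE f : count (fun u => (u < m)%N && f u) (iota 0 m) = count f (iota 0 m).
    by apply: eq_in_count => u; rewrite mem_iota add0n => /andP[_ ->].
  rewrite !cE; move: Nc Nc'; rewrite /nop subn0 => -> -> h.
  have /allP /(_ w) : all (fun x => ((x < m)%N && opener mate x) == ((x < m)%N && opener mate' x)) (iota 0 m).
    by apply: h => // u /andP[um uo]; rewrite um; apply: op.
  by rewrite mem_iota add0n wm /= => /(_ isT) /eqP.
have mE := cups_opener_eq D D' opE; split=> // w wm.
have iHb := sub' _ ib.
have cE H : fits mate' mk' m H -> fits mate mk' m H by apply: fits_ext => w' wm'; rewrite ?mE.
have Mk2 : marking m mate mk'.
  move=> u um ku; have [a1 a2 a3] := Mk' u um ku; rewrite -(mE u um); split=> //.
    by move=> i im hi; rewrite -(mE i im); apply: a2.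
  by move=> i im; rewrite -(mE i im); apply: a3.
apply/idP/idP.
  exact: (marks_agree D Mk2 Mk Nc wm (cE _ iHb) ib).
exact: (marks_agree D Mk Mk2 Nc wm ib (cE _ iHb)).
Qed.

(** * Every flag satisfies the conditions of some diagram *)

(** A subquotient of the symmetric space on which x has an even nilpotency order
    has two Jordan blocks of that size, since the form (u, v) |-> beta u (x^(r-1) v)
    is alternating there. *)
Lemma even_order_dim (U : {vspace V}) r : (U <= perp U)%VS -> (xp 1 @: U <= U)%VS -> (0 < r)%N -> ~~ odd r ->
  (xp r @: perp U <= U)%VS -> ~~ (xp r.-1 @: perp U <= U)%VS -> (\dim U + r.*2 <= \dim (perp U))%N.
Proof.
move=> iU xU r0 er xr nxr.
have xA (s : nat) (a : V) : a \in perp U -> xp s a \in perp U.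
  move=> aA; apply/perpP => u uU; apply/eqP; rewrite betaC beta_xpow0 betaC; apply/eqP.
  apply: (perpP _ _ aA); elim: s => [|s IH]; first by rewrite xpow0.
  by rewrite xpowS; apply: (subvP xU); apply: memv_img.
have [_ /memv_imgP[u uA ->] un] := notin_sub nxr.
have [v vA uv] : exists2 v, v \in perp U & beta v (xp r.-1 u) != 0.
  apply: contrapT => h; case/negP: un; rewrite -(perpK U); apply/perpP => v vA.
  by apply/eqP; apply: contrapT => /negP vu; apply: h; exists v.
have alt (w : V) : beta w (xp r.-1 w) = 0.
  have := beta_xpow r.-1 w w; rewrite betaC -signr_odd.
  have -> : odd r.-1 by case: r r0 er {xr nxr un uv} => // r _; rewrite /= negbK.
  move=> /eqP; rewrite expr1 mulN1r -addr_eq0 -mulr2n mulrn_eq0 /=; exact: eqP.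
have uv' : beta u (xp r.-1 v) != 0 by rewrite -beta_xpow0 betaC.
have uA' : xp r.-1 u \in perp U by apply: xA.
have vA' : xp r.-1 v \in perp U by apply: xA.
suff h j : (j <= r)%N -> (\dim U + j.*2 <= \dim (perp U :&: pre j U))%N.
  by apply: leq_trans (h r (leqnn _)) (dimvS (capvSl _ _)).
elim: j => [|j IH] jr; first by rewrite addn0 pre0 (capv_idPr iU).
have Bj : (j + (r.-1 - j) = r.-1)%N by rewrite subnKC // -ltnS prednK.
have BS : (j.+1 + (r.-1 - j) = r)%N by rewrite addSn Bj prednK.
have inS (w : V) : w \in perp U -> xp (r.-1 - j) w \in (perp U :&: pre j.+1 U)%VS.
  move=> wA; rewrite memv_cap xA // mem_pre -xpowD BS; apply: (subvP xr); exact: memv_img.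
have sub : (perp U :&: pre j U <= perp U :&: pre j.+1 U)%VS.
  rewrite capvS // -addn1 -pre_pre preS // -img_sub_pre; exact: xU.
have n1 : xp (r.-1 - j) u \notin (perp U :&: pre j U)%VS.
  by rewrite memv_cap mem_pre -xpowD Bj (negPf un) andbF.
have n2 : xp (r.-1 - j) v \notin (perp U :&: pre j U + <[xp (r.-1 - j) u]>)%VS.
  apply/negP => /memv_addP[a /memv_capP[_]]; rewrite mem_pre => aU [_ /vlineP[c ->] E].
  have {}E : xp r.-1 v = xp j a + c *: xp r.-1 u by rewrite -{1}Bj xpowD E xpDv xpZ -xpowD Bj.
  have := congr1 (beta u) E; rewrite betaDr betaZr alt mulr0 addr0 [beta u (xp j a)]betaC (perpP _ _ uA) // => h.
  by rewrite h eqxx in uv'.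
apply: leq_trans (_ : \dim (perp U :&: pre j U + <[xp (r.-1 - j) u]> + <[xp (r.-1 - j) v]>) <= _)%N.
  by rewrite !dim_add_line //; rewrite doubleS !addnS !ltnS; apply: IH; apply: ltnW.
by apply: dimvS; rewrite !subv_add sub -!memvE !inS.
Qed.

Section Coverage.
Variable F : nat -> {vspace V}.
Hypothesis fF : full_flag F.
Let hF := proj1 fF.
Let pF := proj2 fF.

Definition order_le i r := (xp r @: perp (F i) <= F i)%VS.

Lemma order_ex i : exists r, order_le i r.
Proof.
exists p; apply/subvP => _ /memv_imgP[u _ ->]; by rewrite xpow_out // mem0v.
Qed.

(** Nilpotency order of x on the subquotient of a step by its orthogonal. *)
Definition order i := ex_minn (order_ex i).

Lemma orderP i : order_le i (order i).
Proof. by rewrite /order; case: ex_minnP. Qed.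
Lemma order_min i r : order_le i r -> (order i <= r)%N.
Proof. by rewrite /order; case: ex_minnP => s _; apply. Qed.
Lemma order_pred i : (0 < order i)%N -> ~~ order_le i (order i).-1.
Proof. by move=> o0; apply/negP => /order_min; lia. Qed.

Lemma flag_mid : F m = perp (F m).
Proof.
have m2 := double_m; have h : (m <= n)%N by lia.
by have := pF h; have -> : (n - m = m)%N by lia.
Qed.

Lemma flag_iso i : (i <= m)%N -> (F i <= perp (F i))%VS.
Proof.
move=> im; apply: subv_trans (half_sub hF im (leqnn _)) _.
rewrite flag_mid; exact: perpS (half_sub hF im (leqnn _)).
Qed.

Lemma dim_perp_flag i : (i <= m)%N -> \dim (perp (F i)) = (i + (m - i).*2)%N.
Proof. by move=> im; have := dim_perp (F i); rewrite (half_dim hF) //; have := double_m; lia. Qed.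

Lemma order_ge i : (i <= m)%N -> (m - i <= order i)%N.
Proof.
move=> im; have := orderP i; rewrite /order_le img_sub_pre => /dimvS.
by have := dim_pre_le (order i) (F i); rewrite dim_perp_flag // (half_dim hF) //; lia.
Qed.

(** An even order larger than m - i would need two Jordan blocks too large for
    the dimension 2 (m - i). *)
Lemma order_odd i : (i <= m)%N -> order i != (m - i)%N -> odd (order i).
Proof.
move=> im ne; have := order_ge im => ge; apply: contraT => ev.
have o0 : (0 < order i)%N by lia.
have := even_order_dim (flag_iso im) (half_xp hF im) o0 ev (orderP i) (order_pred o0).
by rewrite dim_perp_flag // (half_dim hF) //; lia.
Qed.

(** F i.+1 lies between F i and x^(-1) (F i), and dually for the orthogonals. *)
Lemma order_step i : (i < m)%N -> (order i.+1 <= order i <= (order i.+1).+2)%N.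
Proof.
move=> im; have [_ /(_ i im)[s1 s2 s3]] := hF; apply/andP; split; apply: order_min.
  apply: subv_trans (subv_trans (orderP i) s1); apply: limgS; exact: perpS.
rewrite /order_le; apply/subvP => _ /memv_imgP[u uA ->].
have -> : (order i.+1).+2 = (1 + (order i.+1 + 1))%N by lia.
rewrite !xpowD; apply: (subvP s3); apply: memv_img; apply: (subvP (orderP i.+1)).
apply: memv_img; apply/perpP => f fF1; apply/eqP; rewrite betaC beta_xpow0 betaC; apply/eqP.
by apply: (perpP _ _ uA); apply: (subvP s3); apply: memv_img.
Qed.

Lemma order0 : order 0 = p.
Proof.
have F0 : F 0 = 0%VS by case: hF.
apply/eqP; rewrite eqn_leq; apply/andP; split.
  by apply: order_min; apply/subvP => _ /memv_imgP[u _ ->]; rewrite xpow_out // mem0v.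
rewrite leqNgt; apply/negP => lt.
have := subvP (orderP 0) (xp (order 0) (ev p)); rewrite F0 perp0 memv_img ?memvf // => /(_ isT).
rewrite memv0 xpow_ev // => /eqP /(congr1 (ecoef (p - order 0).-1)).
rewrite ecoef_ev ecoef0 prednK ?subn_gt0 // eqxx leq_subr.
by move/eqP; rewrite oner_eq0.
Qed.

Lemma orderm : order m = 0%N.
Proof.
apply/eqP; rewrite -leqn0; apply: order_min.
have m2 := double_m; have Em := flag_mid.
by rewrite /order_le -Em; apply/subvP => _ /memv_imgP[u uF ->]; rewrite xpow0.
Qed.

(** The excess of the order over its minimum m - i, shifted by one so that the
    minimal odd order and the even order have different levels. *)
Definition level i := if odd (order i) then (order i - (m - i)).+1 else 0%N.

Lemma level_step u : (u < m)%N -> level u.+1 = (level u).+1 \/ level u = (level u.+1).+1.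
Proof.
move=> um; have st := order_step um; have g1 := order_ge um; have g0 := order_ge (ltnW um).
have := @order_odd u (ltnW um); have := @order_odd u.+1 um; rewrite /level.
case: (eqVneq (order u) (m - u)%N) => e1; case: (eqVneq (order u.+1) (m - u.+1)%N) => e2.
- move=> _ _; rewrite e1 e2; have -> : (m - u = (m - u.+1).+1)%N by rewrite -subSn.
  by rewrite /= !subnn; case: (odd _) => /=; [left|right].
- move=> /(_ isT) o2 _; have e3 : order u.+1 = order u by clear -e1 e2 st g1 g0 um; lia.
  by rewrite -e3 o2 e3 e1; left; clear -um; lia.
- move=> _ /(_ isT) o1; rewrite o1; right.
  have [e3|e3] : order u = order u.+1 \/ order u = (order u.+1).+2.
    + case/andP: st => s1 s2; have [e|ne] := eqVneq (order u) (order u.+1).+1; last by clear -ne s1 s2; lia.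
      by clear -e e1 e2 um; lia.
    + by clear -e3 e1 e2 um g0; lia.
  have -> : odd (order u.+1) by move: o1; rewrite e3 /= negbK.
  by clear -e1 e2 e3 um; lia.
- move=> /(_ isT) o2 /(_ isT) o1; rewrite o1 o2.
  have [e3|e3] : order u = order u.+1 \/ order u = (order u.+1).+2.
    + case/andP: st => s1 s2; have [e|ne] := eqVneq (order u) (order u.+1).+1; last by clear -ne s1 s2; lia.
      by move: o1; rewrite e /= o2.
    + by left; clear -e3 e1 e2 um g0 g1; lia.
  by right; clear -e3 e1 e2 um g0 g1; lia.
Qed.

Lemma level_m : level m = 0%N.
Proof. by rewrite /level orderm. Qed.

Lemma order_level i : (i <= m)%N -> (0 < level i)%N -> (order i + 1 = m - i + level i)%N.
Proof. by move=> im; have := order_ge im; rewrite /level; case: ifP; lia. Qed.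

Lemma order_level0 i : (i <= m)%N -> level i = 0%N -> order i = (m - i)%N.
Proof.
move=> im; rewrite /level; case: ifP => // ev _; apply/eqP; apply: contraT.
by move/(order_odd im); rewrite ev.
Qed.

Lemma level0_perp i : (i <= m)%N -> level i = 0%N -> perp (F i) = pre (m - i) (F i).
Proof.
move=> im l0; have := orderP i; rewrite /order_le (order_level0 im l0) img_sub_pre => h.
apply/eqP; rewrite eqEdim h /= dim_perp_flag //.
by apply: leq_trans (dim_pre_le _ _) _; rewrite (half_dim hF).
Qed.

Lemma level_count mate : (forall s, (s <= m)%N -> ((nop mate s m).*2 + level s)%N = (m - s)%N) ->
  nop mate 0 m = k./2.
Proof.
move=> /(_ 0%N isT); rewrite subn0 /level order0 subn0; have := double_m; have := two_row_ge S.
case: (two_row_par S) => [e|[op ok]].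
  by case: ifP => o; have := odd_double_half k; have := odd_double_half p; rewrite -?e o; lia.
by rewrite op; have := odd_double_half k; have := odd_double_half p; rewrite op ok; lia.
Qed.

(** At a cup with positive level the order stays constant on its left endpoint
    and drops by the width on the whole cup. *)
Lemma cup_incl v w r : (v < w < m)%N -> (v + r.*2)%N = w.+1 -> order v.+1 = order v ->
  order v = (order w.+1 + r.*2)%N -> F w = pre r.-1 (F v.+1) -> (xp r @: F w.+1 <= F v)%VS.
Proof.
move=> hv er o1 o2 cc; have r0 : (0 < r)%N by lia.
have vm : (v < m)%N by lia. have wm : (w < m)%N by lia.
have [_ /(_ v vm)[s1 s2 s3]] := hF; have [_ /(_ w wm)[t1 t2 t3]] := hF.
have xw f : f \in F w -> xp r.-1 f \in F v.+1 by rewrite cc mem_pre.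
have xw' f : f \in F w -> xp r f \in F v.
  by move=> fw; rewrite -(prednK r0) xpowS; apply: (subvP s3); apply: memv_img; apply: xw.
apply/subvP => _ /memv_imgP[z zF ->]; apply: contraT => zn.
have znw : z \notin F w by apply: contra zn; apply: xw'.
have EF : F w.+1 = (F w + <[z]>)%VS by apply: add_lineE => //; rewrite t2 (half_dim hF) // ltnW.
have o0 : (0 < order v.+1)%N by lia.
have [_ /memv_imgP[u uA ->] un] := notin_sub (order_pred o0).
have u1 : xp r.-1 u \in perp (F w).
  apply/perpP => f fw; apply/eqP; rewrite betaC beta_xpow0 betaC; apply/eqP.
  by apply: (perpP _ _ uA); apply: xw.
have u2 : xp r u \in perp (F w.+1).
  apply/perpP => f fw; apply/eqP; rewrite -(prednK r0) xpowS betaC beta_xpow0 betaC; apply/eqP.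
  by apply: (perpP _ _ u1); apply: (subvP t3); apply: memv_img.
have := subvP (orderP w.+1) _ (memv_img (xp (order w.+1)) u2).
rewrite EF => /memv_addP[f fw [_ /vlineP[c ->] E]].
have E1 : xp (order v.+1).-1 u = xp r.-1 f + c *: xp r.-1 z.
  rewrite -xpZ -xpDv -E -!xpowD; congr (xp _ u).
  by clear -er o1 o2 o0 r0; lia.
have E2 : xp (order v) u = xp r f + c *: xp r z.
  have -> : order v = (1 + (order v.+1).-1)%N by rewrite -o1 add1n prednK.
  by rewrite xpowD E1 xpDv xpZ -!xpowS prednK.
have c0 : c != 0.
  by apply: contra un => /eqP c0; rewrite E1 c0 scale0r addr0 xw.
case/negP: zn; rewrite -(scalerK c0 (xp r z)) memvZ //.
have -> : c *: xp r z = xp (order v) u - xp r f by rewrite E2 addrC addKr.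
rewrite memvB ?xw' //; apply: (subvP (orderP v)); apply: memv_img.
exact: (subvP (perpS s1)).
Qed.

(** At a cup or ray ending at level 0 the step satisfies the condition of one of
    the two marks, and the mark is chosen accordingly; at positive level it satisfies
    the unmarked condition. *)
Lemma coverage : exists mate mk, [/\ cups m mate, marking m mate mk, nop mate 0 m = k./2 & fits mate mk m F].
Proof.
have [mate [D opE cl ray cnt']] := path_cups level_step level_m.
pose q w := if mate w == w then F w.+1 == ray_space mate (pred1 w) w
  else ~~ (xp (w - mate w).+1./2 @: F w.+1 <= F (mate w))%VS.
have Mk := path_marking (q := q) level_step level_m D cl ray.
set mk := (fun u => _) in Mk; have Nc := level_count cnt'.
exists mate, mk; split=> //; split=> // w wm.
have mkE : (mate w <= w)%N -> mk w = (level w.+1 == 0%N) && q w by move=> h; rewrite /mk (maxn_idPl h).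
have [d] := ubnP w; elim: d w wm mkE => // d IH w wm mkE wd.
have iw : fits mate mk w F.
  split; first exact: half_flagW hF (ltnW wm).
  move=> u uw; apply: IH; [lia| |lia].
  by move=> h; rewrite /mk (maxn_idPl h).
have [_ /(_ w wm)[t1 t2 t3]] := hF.
rewrite /cond; case: ltngtP => [vw|//|ww].
  have vm := ltn_trans vw wm; have [e1 [e2 e3]] := rho_closer D Mk Nc wm vw.
  have cc := closer_concat D Mk Nc iw (leqnn w) wm vw.
  have vl := ltnW vw.
  have eqpre : (xp (w - mate w).+1./2 @: F w.+1 <= F (mate w))%VS -> F w.+1 = pre (w - mate w).+1./2 (F (mate w)).
    rewrite img_sub_pre => h; apply/eqP; rewrite eqEdim h t2 /=.
    by rewrite (fits_dim_pre D Mk Nc (ltnW wm) iw vl) ?e2 // e1 leq_addr.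
  have qE : q w = ~~ (xp (w - mate w).+1./2 @: F w.+1 <= F (mate w))%VS by rewrite /q ltn_eqF.
  have [hl El gt] := cl w wm vw.
  rewrite mkE //; case: eqVneq => /= [l0|l0].
    rewrite qE; case: ifP => [nx|/negbFE]; last exact: eqpre.
    split; last exact: level0_perp.
    have [_ /(_ _ vm)[s1 s2 s3]] := hF.
    apply/esym/eqP; rewrite eq_sym eqEdim s2; apply/andP; split.
      rewrite subv_add s1 img_sub_pre /=.
      have r0 : (0 < (w - mate w).+1./2)%N by rewrite half_gt0 ltnS subn_gt0.
      by move: t3; rewrite img_sub_pre {1}cc pre_pre add1n prednK.
    have [z zx zn] := notin_sub nx.
    apply: leq_trans (_ : \dim (F (mate w) + <[z]>) <= _)%N.
      by rewrite dim_add_line // (half_dim hF) // ltnW.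
    by apply: dimvS; rewrite addvS // -memvE.
  apply: eqpre; apply: (cup_incl _ e2 _ _ cc); first by lia.
    have lv : level (mate w).+1 = (level (mate w)).+1 by have := gt (mate w).+1; have := level_step vm; lia.
    by have := order_level vm; have := order_level (ltnW vm); rewrite lv El; lia.
  by have := order_level wm; have := order_level (ltnW vm); rewrite El; lia.
have Ew := early_at_ray D Mk Nc iw (leqnn w) wm ww.
have [l [el h1 h2 h3 h4]] := ray_sizes D Mk Nc wm ww.
have ck := rho_cnt D Mk Nc (ltnW wm).
have nr : nray mate w.+1 m = level w.+1.
  have cw := closedI_rest D (closedI0m D) (closedI_rayS D wm ww) wm.
  by have := closedI_count D cw; have := cnt' w.+1 wm; lia.
have lw : level w = (level w.+1).+1 by have := opE w wm; have := level_step wm; rewrite ww ltnn; lia.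
have [l0|l0] := posnP (level w.+1); last first.
  (* as the order is large, x^(order w.+1) maps a vector e_j orthogonal to F w.+1 to
     the vector e that has to be in F w.+1 *)
  have npk : p != k.
    apply/negP => /h3[ll pp]; have := order_level wm l0; have := order_level (ltnW wm); rewrite lw.
    have := cnt' 0%N isT; have := cnt' w (ltnW wm); rewrite lw.
    move: Nc ck; have := double_m; lia.
  have nlast : lastray mate w = false.
    apply/negP => /allP h; have : nray mate w.+1 m = 0%N by apply: nray_eq0 => u hu; apply/eqP/h; rewrite mem_iota; lia.
    by rewrite nr; lia.
  have kw : mk w = false by rewrite mkE ?ww //; case: eqP => //; lia.
  have rE : ray_vec mate mk w 0 = ev (w - nop mate 0 w).+1.
    by rewrite /ray_vec /ray_weight (negPf npk) kw nlast scale0r add0r scale1r addn0.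
  rewrite (ray_spaceE D Mk Nc) -Ew; apply: add_lineE => //; first by rewrite t2 (half_dim hF) // ltnW.
    have [op ok] : odd p /\ odd k by case: (two_row_par S) => // e; rewrite e eqxx in npk.
    have lp : (l + k./2 < p./2)%N.
      by case: (h4 npk) => [[e _]|[]] //; move: (cnt' 0%N isT) (cnt' w.+1 wm) nr lw; have := double_m; have := odd_double_half p; have := odd_double_half k; rewrite op ok; move: Nc ck; have := cnt' w (ltnW wm); lia.
    set u := ev (p - (w - nop mate 0 w).+1).
    have uA : u \in perp (F w.+1).
      apply: (subvP (perpS (_ : F w.+1 <= spef (w - nop mate 0 w + 1) (nop mate 0 w + 1) [::])%VS)).
        by rewrite -pre_spef -Ew -img_sub_pre.
      apply: beta_spef => i hi; last by rewrite betaC beta_ev_fv ?npk.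
      by rewrite beta_ev_ev //; apply/orP; right; move: hi el h1; lia.
    have := subvP (orderP w.+1) _ (memv_img (xp (order w.+1)) uA).
    rewrite rE xpow_ev ?leq_subr //.
    suff -> : (p - (w - nop mate 0 w).+1 - order w.+1 = (w - nop mate 0 w).+1)%N by [].
    have a1 := order_level wm l0; have a2 := cnt' w.+1 wm; have a3 := double_m.
    have a4 := rho_cnt D Mk Nc wm; have a5 := odd_double_half k; rewrite ok in a5.
    have a6 : nop mate 0 w.+1 = nop mate 0 w.
      by rewrite (@nop_cat mate 0 w w.+1) // nop1 /opener ww ltnn addn0.
    by clear -a1 a2 a3 a4 a5 a6 el h1 lp; lia.
  by rewrite Ew; apply: (ray_vec_notin D Mk Nc).
(* at level 0 the preimage of F w.+1 is one of the two Lagrangians containing the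
   preimage of F w, and these belong to the two marks of the last ray *)
pose mk0 (_ : nat) := false.
have Mk0 : marking m mate mk0 by [].
have Mk1 : marking m mate (pred1 w).
  move=> u um /eqP ->; rewrite ww maxnn minnn; split; first by rewrite /= eqxx.
    by move=> i im wi ii; have := ray i im ii w.+1 wi; rewrite l0.
  move=> i im [iw' wi]; have [_ /(_ i)] := closedI_ray D wm ww; lia.
have r2 : (w.+1 + (nop mate w.+1 m).*2)%N = m by have := cnt' w.+1 wm; lia.
have rw : nop mate w m = nop mate w.+1 m by rewrite (@nop_cat mate w w.+1) // nop1 /opener ww ltnn.
have rk := rho_le D Mk Nc wm.
pose r := nop mate w.+1 m.
have lag_ray k0 : marking m mate k0 -> lagrangian (pre r (ray_space mate k0 w)) /\ (F w <= ray_space mate k0 w)%VS.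
  move=> M0; have [f1 f2 _] := ray_space_facts D M0 Nc wm ww; split; last first.
    by rewrite Ew (ray_spaceE D M0 Nc) addvSl.
  apply: iso_lag => //; rewrite dim_pre_im //; last by rewrite /r; have := rk; lia.
  by rewrite (dim_ray_space D M0 Nc) // /r; lia.
have [L0 F0] := lag_ray mk0 Mk0; have [L1 F1] := lag_ray _ Mk1.
have E2 : perp (F w.+1) = pre (nop mate w.+1 m).*2 (F w.+1).
  by rewrite level0_perp //; congr (pre _ _); have := r2; lia.
have e2 : (\dim (F w.+1) + (nop mate w.+1 m).*2)%N = m by rewrite t2.
have LF := perp_pre_lag E2 e2 rk.
have dI : (\dim (pre r (F w))).+1 = m.
  by rewrite (fits_dim_pre D Mk Nc (ltnW wm) iw (leqnn w)) ?rw // /r; have := r2; lia.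
have FE k0 : marking m mate k0 -> pre r (F w.+1) = pre r (ray_space mate k0 w) -> F w.+1 = ray_space mate k0 w.
  move=> M0 E; have [f1 _ _] := ray_space_facts D M0 Nc wm ww.
  rewrite -(img_pre f1) -E img_pre //.
  by apply: subv_trans (perp_pre_xim E2 e2) (ximS _); lia.
have dich : F w.+1 = ray_space mate (pred1 w) w \/ F w.+1 = ray_space mate mk0 w.
  have [e|ne] := pselect (pre r (F w.+1) = pre r (ray_space mate (pred1 w) w)); first by left; apply: FE.
  right; apply: FE => //; apply: (two_lag L1 LF L0 _ _ _ dI); try exact: preS.
    by move=> e; apply: ne.
  have [f1 _ _] := ray_space_facts D Mk1 Nc wm ww; have [g1 _ _] := ray_space_facts D Mk0 Nc wm ww.
  move=> e; apply: (ray_space_neq D Mk1 Mk0 Nc wm ww) => //=.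
  by rewrite -(img_pre f1) e img_pre.
have kE : mk w = (F w.+1 == ray_space mate (pred1 w) w) by rewrite mkE ?ww // l0 eqxx /q ww eqxx.
have same k0 : k0 w = mk w -> ray_space mate mk w = ray_space mate k0 w.
  by move=> e; rewrite /ray_space /ray_vec /ray_weight e.
case: dich => E; first by rewrite (same (pred1 w)) //= eqxx kE E eqxx.
rewrite (same mk0) // /mk0 kE; apply/esym/negbTE/eqP => E'.
by apply: (ray_space_neq D Mk1 Mk0 Nc wm ww) => //=; rewrite -E' -E.
Qed.

End Coverage.

(** * Full flags and the spaces at the rays *)
Section FullFlags.
Variable F : nat -> {vspace V}.
Hypothesis fF : full_flag F.

Lemma full_dim i : (i <= n)%N -> \dim (F i) = i.
Proof.
move=> im; have [hf pf] := fF; have m2 := double_m.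
have [le|gt] := leqP i m; first exact: (half_dim hf).
have le : (n - i <= m)%N by lia.
have := dim_perp (F (n - i)%N); rewrite -pf ?leq_subr // subKn // (half_dim hf le).
by lia.
Qed.

Lemma full_step i : (i < n)%N -> (F i <= F i.+1)%VS /\ (xp 1 @: F i.+1 <= F i)%VS.
Proof.
move=> im; have [hf pf] := fF; have m2 := double_m.
have [lt|ge] := ltnP i m; first by have [_ /(_ i lt)[]] := hf.
have E : ((n - i.+1).+1 = n - i)%N by rewrite subnSK.
have [|s1 s2 s3] := proj2 hf (n - i.+1)%N; first by lia.
rewrite E in s1 s2 s3.
have -> : F i = perp (F (n - i)%N) by rewrite -pf ?leq_subr // subKn // ltnW.
have -> : F i.+1 = perp (F (n - i.+1)%N) by rewrite -pf ?leq_subr // subKn.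
by split; [apply: perpS|rewrite img_sub_pre -perp_img; apply: perpS].
Qed.

Lemma full_top : F n = fullv.
Proof. by have [[F0 _] pf] := fF; have := pf 0%N isT; rewrite subn0 F0 perp0. Qed.

End FullFlags.

Lemma spef_addf a b : spef a b.+1 [::] = (spef a b [::] + <[fv b.+1]>)%VS.
Proof.
apply/eqP; rewrite eqEsubv; apply/andP; split.
  apply: spef_sub => l hl; first by apply: (subvP (addvSl _ _)); apply: ev_spef; case/andP: hl.
  have [->|ne] := eqVneq l b.+1; first by apply: (subvP (addvSr _ _)); apply: memv_line.
  by apply: (subvP (addvSl _ _)); apply: fv_spef; lia.
by rewrite subv_add spefS //= -memvE fv_spef.
Qed.

Lemma spef_adde a b : spef a.+1 b [::] = (spef a b [::] + <[ev a.+1]>)%VS.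
Proof.
apply/eqP; rewrite eqEsubv; apply/andP; split.
  apply: spef_sub => l hl; last by apply: (subvP (addvSl _ _)); apply: fv_spef; case/andP: hl.
  have [->|ne] := eqVneq l a.+1; first by apply: (subvP (addvSr _ _)); apply: memv_line.
  by apply: (subvP (addvSl _ _)); apply: ev_spef; lia.
by rewrite subv_add spefS //= -memvE ev_spef.
Qed.

Section RaySpaces.
Variables (mate : nat -> nat) (mk : nat -> bool).
Hypothesis D : cups m mate.
Hypothesis Mk : marking m mate mk.
Hypothesis Nc : nop mate 0 m = k./2.
Variable w : nat.
Hypothesis wm : (w < m)%N.
Hypothesis ww : mate w = w.

Lemma ray_space_eq : p = k ->
  ray_space mate mk w = if mk w then spef w./2 w./2.+1 [::] else spef w./2.+1 w./2 [::].
Proof.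
move=> e; have [l [el h1 h2 h3 h4]] := ray_sizes D Mk Nc wm ww.
have [l0 _] : l = 0%N /\ p = (k./2).*2.+1 by apply: h3; rewrite e.
have c2 : w./2 = nop mate 0 w by rewrite {1}el l0 add0n doubleK.
have wc : (w - nop mate 0 w)%N = nop mate 0 w by rewrite {1}el l0 add0n -addnn addnK.
have -> : ray_space mate mk w = (spef w./2 w./2 [::] + <[ray_vec mate mk w 0]>)%VS by rewrite (ray_spaceE D Mk Nc) c2 wc.
rewrite /ray_vec /ray_weight wc -c2 (introT eqP e) !addn0.
by case: (mk w); rewrite /= scale0r scale1r ?addr0 ?add0r ?spef_addf ?spef_adde.
Qed.

Lemma ray_space_gt : p <> k -> let c := nop mate 0 w in
  ray_space mate mk w = if mk w then spef (w - c) c [:: fv c.+1 + gam *: ev (w - c).+1]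
    else if lastray mate w then spef (w - c) c [:: fv c.+1 - gam *: ev (w - c).+1]
    else spef (w - c).+1 c [::].
Proof.
move=> /eqP npk; rewrite /= /ray_space /ray_vec /ray_weight (negPf npk) !addn0.
case: (mk w); first by rewrite /= scale1r.
case: (lastray mate w); first by rewrite /= scale1r scaleNr.
by rewrite /= scale0r add0r scale1r spef_cat span_seq1 spef_adde.
Qed.

End RaySpaces.

End Space.

(** * The standard two-row space over the complex numbers *)

Lemma shift_antidiag (R : realType) (r s : nat) : r = s ->
  shift_mx R r *m antidiag_mx R r s = - (antidiag_mx R r s *m (shift_mx R s)^T).
Proof.
move=> e; subst s; apply/matrixP => i j; rewrite !mxE.
have -> : \sum_l shift_mx R r i l * antidiag_mx R r r l j =
    if (0 < i)%N && (i + j == r)%N then (-1) ^+ i.-1 else 0.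
  case: i => [[|i] hi] /=.
    by rewrite big1 // => l _; rewrite !mxE /= mul0r.
  rewrite (bigD1 (Ordinal (ltnW hi))) //= !mxE /= eqxx mul1r addSn big1 ?addr0 //.
  move=> l; rewrite -val_eqE /= !mxE eqSS eq_sym => /negPf ->; by rewrite mul0r.
have -> : \sum_l antidiag_mx R r r i l * (shift_mx R r)^T l j =
    if (0 < j)%N && (i + j == r)%N then (-1) ^+ i else 0.
  case: j => [[|j] hj] /=.
    by rewrite big1 // => l _; rewrite !mxE /= mulr0.
  rewrite (bigD1 (Ordinal (ltnW hj))) //= !mxE /= eqxx mulr1 addnS big1 ?addr0 //.
  move=> l; rewrite -val_eqE /= !mxE eqSS eq_sym => /negPf ->; by rewrite mulr0.
case: i j => [[|i] hi] [[|j] hj] /=; rewrite ?oppr0 //.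
- by rewrite add0n ltn_eqF ?oppr0.
- by rewrite addn0 ltn_eqF ?oppr0.
- by case: ifP => _; rewrite ?oppr0 // exprS mulN1r opprK.
Qed.

Lemma antidiagK (R : realType) (r s : nat) : r = s ->
  antidiag_mx R r s *m (antidiag_mx R r s)^T = 1%:M.
Proof.
move=> e; subst s; apply/matrixP => i j; rewrite !mxE.
rewrite (bigD1 (rev_ord i)) //= big1 => [|l]; rewrite !mxE /=; last first.
  rewrite -val_eqE /= => li.
  by have -> : ((i + l).+1 == r) = false; [have := ltn_ord i; lia | rewrite mul0r].
have -> : (i + (r - i.+1)).+1 == r by have := ltn_ord i; lia.
have -> : ((j + (r - i.+1)).+1 == r) = (i == j).
  by rewrite -val_eqE /=; have := ltn_ord i; have := ltn_ord j; lia.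
rewrite addr0; case: eqP => [->|]; last by rewrite mulr0.
by rewrite -expr2 sqrr_sign.
Qed.

Lemma antidiag_sym (R : realType) (r : nat) : odd r ->
  (antidiag_mx R r r)^T = antidiag_mx R r r.
Proof.
move=> ro; apply/matrixP => i j; rewrite !mxE addnC.
case: ifP => // /eqP e; rewrite -signr_odd -[RHS]signr_odd.
by congr (_ ^+ nat_of_bool _); have := congr1 odd e; rewrite ro /= oddD; case: (odd i) (odd j) => [] [].
Qed.

Section Standard.
Variables (R : realType) (p k : nat).
Hypotheses (hkp : (k <= p)%N) (hk0 : (0 < k)%N) (hpar : p = k \/ (odd p /\ odd k)).
Local Notation C := R[i].
Local Notation n := (p + k)%N.
Local Notation V := 'rV[C]_n.
Local Notation Q := (beta_mx R p k).
Local Notation N := (nilp_mx R p k).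
Local Notation xpow := (Defs.xpow R p k).
Local Notation form := (@Defs.beta R p k).
Local Notation evec := (evec R p k).
Local Notation fvec := (fvec R p k).
Implicit Types u v w : V.
Implicit Types U W G H : {vspace V}.

Lemma beta_mx_sym : Q^T = Q.
Proof.
rewrite /beta_mx; case: eqP => [_|npk].
  by rewrite tr_block_mx !trmx0 trmxK.
case: hpar => [//|[op ok]].
by rewrite tr_block_mx !trmx0 !antidiag_sym.
Qed.

Lemma beta_mx_unit : Q \in unitmx.
Proof.
suff h : Q *m Q^T = 1%:M by case: (mulmx1_unit h).
rewrite /beta_mx; case: eqP => [e|npk].
  rewrite tr_block_mx !trmx0 trmxK mulmx_block !mulmx0 !mul0mx !addr0 add0r.
  rewrite antidiagK //.
  have -> : (antidiag_mx R p k)^T *m antidiag_mx R p k = 1%:M.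
    move: (antidiagK R e) => h;
    move: (antidiag_mx R p k) h; rewrite e => A; exact: mulmx1C.
  by rewrite -scalar_mx_block.
rewrite tr_block_mx !trmx0 mulmx_block !mulmx0 !mul0mx !addr0 add0r.
by rewrite !antidiagK // -scalar_mx_block.
Qed.

Lemma nilp_beta_mx : N *m Q = - (Q *m N^T).
Proof.
rewrite /nilp_mx /beta_mx; case: eqP => [e|npk].
  rewrite tr_block_mx !trmx0 !mulmx_block !mulmx0 !mul0mx !addr0 !add0r opp_block_mx.
  rewrite !oppr0 shift_antidiag //; congr block_mx.
  apply: trmx_inj; rewrite trmx_mul trmxK linearN /= trmx_mul !trmxK.
  by rewrite shift_antidiag // opprK.
rewrite tr_block_mx !trmx0 !mulmx_block !mulmx0 !mul0mx !addr0 !add0r opp_block_mx.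
by rewrite !oppr0 !shift_antidiag.
Qed.

Lemma formC u v : form u v = form v u.
Proof.
rewrite /Defs.beta; transitivity ((u *m Q *m v^T)^T 0 0); first by rewrite [RHS]mxE.
by rewrite !trmx_mul trmxK beta_mx_sym mulmxA.
Qed.

Lemma formDr u v w : form u (v + w) = form u v + form u w.
Proof. by rewrite /Defs.beta linearD /= mulmxDr mxE. Qed.
Lemma formZr u c v : form u (c *: v) = c * form u v.
Proof. by rewrite /Defs.beta linearZ /= -scalemxAr mxE. Qed.
Lemma form_sumr u (I : Type) (r : seq I) (F : I -> V) :
  form u (\sum_(i <- r) F i) = \sum_(i <- r) form u (F i).
Proof.
by apply: (big_morph (form u)); [exact: formDr | rewrite -[X in form u X](scale0r 0) formZr mul0r].
Qed.

Lemma xpowE r u : xpow r u = u *m N ^+ r.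
Proof. by rewrite /Defs.xpow lfunE. Qed.

Lemma xpow_0 u : xpow 0 u = u.
Proof. by rewrite xpowE expr0 mulmx1. Qed.

Lemma xpow_add r s u : xpow (r + s) u = xpow r (xpow s u).
Proof. by rewrite !xpowE (addnC r) exprD -mulmxE mulmxA. Qed.

Lemma form_xpow1 u v : form (xpow 1 u) v = - form u (xpow 1 v).
Proof.
rewrite /Defs.beta !xpowE expr1 -(mulmxA u) nilp_beta_mx mulmxN mulNmx mxE; congr (- (_ _)).
by rewrite trmx_mul !mulmxA.
Qed.

(** The orthogonal is the kernel of the map to the pairings with a basis of U, which
    is onto since the form is nondegenerate. *)
Lemma dim_form_perp U : (\dim (Defs.perp U) + \dim U)%N = n.
Proof.
pose B : 'M[C]_(\dim U, n) := \matrix_i (vbasis U)`_i.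
have [D BD] : exists D, B *m D = 1%:M.
  apply/row_freeP; rewrite -kermx_eq0; apply/eqP/row_matrixP => i; rewrite row0.
  have : row i (kermx B) *m B = 0 by rewrite -row_mul mulmx_ker row0.
  move: (row i _) => a aB; apply/rowP => j; rewrite mxE.
  have /freeP fr := basis_free (vbasisP U).
  apply: (fr (fun j => a 0 j)); rewrite -[RHS]aB mulmx_sum_row.
  by apply: eq_bigr => l _; rewrite rowK.
pose f : 'Hom(V, 'rV[C]_(\dim U)) := linfun (mulmxr (Q *m B^T)).
have fE v : f v = v *m (Q *m B^T) by rewrite lfunE.
have -> : Defs.perp U = lker f.
  apply/vspaceP => v; rewrite memv_ker fE; apply/mem_perpP/eqP => [h|h u uU].
    apply/rowP => j; rewrite mulmxA [RHS]mxE -[RHS](h (vbasis U)`_j); last first.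
      by apply: vbasis_mem; apply: mem_nth; rewrite size_tuple.
    rewrite formC /Defs.beta !mxE; apply: eq_bigr => l _; congr (_ * _).
    by rewrite !mxE.
  rewrite formC (coord_vbasis uU) form_sumr big1 //= => i _.
  rewrite formZr; suff -> : form v (vbasis U)`_i = 0 by rewrite mulr0.
  have := h; rewrite mulmxA => /rowP /(_ i); rewrite [RHS]mxE => <-; rewrite /Defs.beta !mxE.
  by apply: eq_bigr => l _; rewrite !mxE.
have fl : limg f = fullv.
  apply/eqP; rewrite eqEsubv subvf /=; apply/subvP => y _.
  apply/memv_imgP; exists (y *m D^T *m invmx Q); rewrite ?memvf //.
  rewrite fE !mulmxA mulmxKV ?beta_mx_unit // -mulmxA -trmx_mul BD trmx1 mulmx1 //.
have := limg_ker_dim f fullv; rewrite capfv fl !dimvf /dim /= !mul1n; exact.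
Qed.

Definition ecoord (i : nat) v : C := oapp (fun j : 'I_p => v 0 (lshift k j)) 0 (insub i).
Definition fcoord (i : nat) v : C := oapp (fun j : 'I_k => v 0 (rshift p j)) 0 (insub i).

Lemma ecoord_ord (j : 'I_p) v : ecoord j v = v 0 (lshift k j).
Proof. by rewrite /ecoord valK. Qed.
Lemma fcoord_ord (j : 'I_k) v : fcoord j v = v 0 (rshift p j).
Proof. by rewrite /fcoord valK. Qed.
Lemma ecoord_out i v : (p <= i)%N -> ecoord i v = 0.
Proof. by move=> h; rewrite /ecoord insubF // ltnNge h. Qed.
Lemma fcoord_out i v : (k <= i)%N -> fcoord i v = 0.
Proof. by move=> h; rewrite /fcoord insubF // ltnNge h. Qed.

Lemma ecoordD i u v : ecoord i (u + v) = ecoord i u + ecoord i v.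
Proof. by rewrite /ecoord; case: insub => [j|] /=; rewrite ?addr0 ?mxE. Qed.
Lemma fcoordD i u v : fcoord i (u + v) = fcoord i u + fcoord i v.
Proof. by rewrite /fcoord; case: insub => [j|] /=; rewrite ?addr0 ?mxE. Qed.
Lemma ecoordZ i c v : ecoord i (c *: v) = c * ecoord i v.
Proof. by rewrite /ecoord; case: insub => [j|] /=; rewrite ?mulr0 ?mxE. Qed.
Lemma fcoordZ i c v : fcoord i (c *: v) = c * fcoord i v.
Proof. by rewrite /fcoord; case: insub => [j|] /=; rewrite ?mulr0 ?mxE. Qed.
Lemma ecoord_ev i j : ecoord i (evec j) = ((i < p)%N && (i.+1 == j))%:R.
Proof.
have [h|h] := ltnP i p; last by rewrite ecoord_out.
by rewrite (ecoord_ord (Ordinal h)) /Defs.evec row_mxEl mxE.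
Qed.
Lemma fcoord_fv i j : fcoord i (fvec j) = ((i < k)%N && (i.+1 == j))%:R.
Proof.
have [h|h] := ltnP i k; last by rewrite fcoord_out.
by rewrite (fcoord_ord (Ordinal h)) /Defs.fvec row_mxEr mxE.
Qed.
Lemma ecoord_fv i j : ecoord i (fvec j) = 0.
Proof.
have [h|h] := ltnP i p; last by rewrite ecoord_out.
by rewrite (ecoord_ord (Ordinal h)) /Defs.fvec row_mxEl mxE.
Qed.
Lemma fcoord_ev i j : fcoord i (evec j) = 0.
Proof.
have [h|h] := ltnP i k; last by rewrite fcoord_out.
by rewrite (fcoord_ord (Ordinal h)) /Defs.evec row_mxEr mxE.
Qed.

Lemma coordP u v : (forall i, ecoord i u = ecoord i v) -> (forall i, fcoord i u = fcoord i v) -> u = v.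
Proof.
move=> he hf; apply/rowP => j; case: (splitP j) => l e.
  by have := he l; rewrite !ecoord_ord; rewrite (_ : lshift k l = j) //; apply/val_inj.
by have := hf l; rewrite !fcoord_ord; rewrite (_ : rshift p l = j) //; apply/val_inj.
Qed.

Lemma antidiag_entry0 r s i j : (i + j != r.+1)%N ->
  ((\row_(l < r) (l.+1 == i)%:R : 'rV[C]_r) *m antidiag_mx R r s *m
    (\row_(l < s) (l.+1 == j)%:R : 'rV[C]_s)^T) 0 0 = 0.
Proof.
move=> ij; rewrite !mxE big1 // => l _; rewrite !mxE big_distrl big1 //= => l' _.
rewrite !mxE; case: eqP => [e|]; last by rewrite !mul0r.
case: (l.+1 =P j) => [e'|]; last by rewrite mulr0.
by rewrite (_ : (_ == r) = false) ?mulr0 ?mul0r //; apply/negP => /eqP; lia.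
Qed.

Lemma form_evec_evec i j : (p == k) || (i + j != p.+1)%N -> form (evec i) (evec j) = 0.
Proof.
rewrite /Defs.beta /beta_mx /Defs.evec; case: eqP => [e _|ne /= h].
  by rewrite mul_row_block tr_row_mx mul_row_col !mulmx0 !trmx0 !mul0mx !mulmx0 !addr0 mul0mx mxE.
rewrite mul_row_block tr_row_mx mul_row_col !mulmx0 !mul0mx !trmx0 !mulmx0 !addr0.
exact: antidiag_entry0.
Qed.

Lemma form_fvec_fvec i j : (p == k) || (i + j != k.+1)%N -> form (fvec i) (fvec j) = 0.
Proof.
rewrite /Defs.beta /beta_mx /Defs.fvec; case: eqP => [e _|ne /= h].
  by rewrite mul_row_block tr_row_mx mul_row_col !mul0mx !mulmx0 !trmx0 !mulmx0 !add0r ?addr0 ?mul0mx mxE.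
rewrite mul_row_block tr_row_mx mul_row_col !mulmx0 !mul0mx !trmx0 !mulmx0 !add0r.
exact: antidiag_entry0.
Qed.

Lemma form_evec_fvec i j : (p != k) || (i + j != p.+1)%N -> form (evec i) (fvec j) = 0.
Proof.
rewrite /Defs.beta /beta_mx /Defs.fvec /Defs.evec; case: eqP => [e /= h|ne _].
  rewrite mul_row_block tr_row_mx mul_row_col !mulmx0 !mul0mx !trmx0 !mulmx0 !addr0 !add0r.
  exact: antidiag_entry0.
by rewrite mul_row_block tr_row_mx mul_row_col !mulmx0 ?mul0mx !trmx0 !mulmx0 ?add0r ?addr0 ?mul0mx mxE.
Qed.

Lemma ray_coef_neq0 : ray_coef R p k != 0.
Proof.
rewrite /ray_coef; case: ifP => _; last exact: oner_neq0.
by rewrite -sqrf_eq0 sqr_i oppr_eq0 oner_eq0.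
Qed.

Lemma form_mid : p <> k -> forall c : C, c ^+ 2 = ray_coef R p k ^+ 2 ->
  let w := fvec (k./2).+1 + c *: evec (p./2).+1 in form w w = 0.
Proof.
move=> npk c hc /=; case: hpar => [//|[op ok]].
have kp : (k < p)%N by rewrite ltn_neqAle hkp andbT eq_sym; apply/eqP.
rewrite (beta_middle _ op ok kp) hc.
have -> : ray_coef R p k ^+ 2 = (-1) ^+ (p + k)./2.
  by rewrite -signr_odd /ray_coef; case: (odd _); rewrite ?sqr_i ?expr1 // expr1n.
rewrite -exprD -signr_odd -[X in _ + X]signr_odd.
have -> : odd ((p + k)./2 + p./2) = ~~ odd k./2.
  have e1 := odd_double_half p; have e2 := odd_double_half k; rewrite op in e1; rewrite ok in e2.
  have -> : ((p + k)./2 + p./2)%N = (k./2 + 1 + (p./2).*2)%N by clear -e1 e2; lia.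
  by rewrite !oddD odd_double addbF addbT.
by case: (odd _); rewrite ?expr0 ?expr1 ?subrr ?addNr.
Qed.

Definition standard : two_row_space V p k :=
  TwoRowSpace hkp hk0 hpar formC formDr formZr (@mem_perpP R p k) dim_form_perp
    xpow_0 xpow_add form_xpow1 ecoordD fcoordD ecoordZ fcoordZ ecoord_ev fcoord_fv
    ecoord_fv fcoord_ev ecoord_out fcoord_out coordP (@xpow1_evec R p k) (@xpow1_fvec R p k)
    form_evec_evec form_fvec_fvec form_evec_fvec ray_coef_neq0 form_mid.

End Standard.

(** * Multihomogeneous functions of the bases of a flag *)
Section Plucker.
Variables (K : fieldType) (n : nat).
Local Notation N := #|{: {set 'I_n}}|.

(** Multihomogeneity with the degrees made explicit. *)
Definition graded (d : nat -> nat) (P : {mpoly K[N]}) :=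
  forall mon : 'X_{1..N}, mon \in msupp P ->
    forall i, (\sum_(s < N | #|enum_val s : {set 'I_n}| == i) mon s)%N = d i.

Definition bases := forall i, 'M[K]_(i, n).
Definition plucker (B : bases) (S : {set 'I_n}) : K :=
  \det (colsub (fun j : 'I_#|S| => enum_val j) (B #|S|)).

(** Functions of bases that are multihomogeneous polynomials in the Pluecker
    coordinates, of degree d i on the exterior power i.  Working with functions of
    bases makes closure under sums, products and determinants immediate. *)
Definition mhom d (Phi : bases -> K) :=
  exists2 P, graded d P & forall B, Phi B = P.@[fun s => plucker B (enum_val s)].

Lemma mhom_ext d d' Phi Phi' : d =1 d' -> Phi =1 Phi' -> mhom d Phi -> mhom d' Phi'.
Proof.
move=> ed eP [P hP vP]; exists P => [mon hm i|B]; first by rewrite hP ?ed.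
by rewrite -eP vP.
Qed.

Lemma mhom0 d : mhom d (fun _ => 0).
Proof. by exists 0 => [mon|B]; rewrite ?msupp0 ?meval0. Qed.

Lemma mhom_const c : mhom (fun _ => 0%N) (fun _ => c).
Proof.
exists c%:MP => [mon|B]; last by rewrite mevalC.
rewrite msuppC; case: eqP => // _; rewrite inE => /eqP -> i.
by apply: big1 => s _; rewrite mnm0E.
Qed.

Lemma mhom_add d Phi Psi : mhom d Phi -> mhom d Psi -> mhom d (fun B => Phi B + Psi B).
Proof.
move=> [P gP hP] [Q gQ hQ]; exists (P + Q) => [mon /msuppD_le|B]; last by rewrite mevalD hP hQ.
by rewrite mem_cat => /orP[/gP|/gQ].
Qed.

Lemma mhom_mul d e Phi Psi : mhom d Phi -> mhom e Psi ->
  mhom (fun i => (d i + e i)%N) (fun B => Phi B * Psi B).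
Proof.
move=> [P gP hP] [Q gQ hQ]; exists (P * Q) => [mon /msuppM_le|B]; last by rewrite mevalM hP hQ.
case/allpairsP=> -[m1 m2] /= [h1 h2 ->] i; rewrite -(gP _ h1) -(gQ _ h2) -big_split /=.
by apply: eq_bigr => s _; rewrite mnmDE.
Qed.

Lemma mhom_scale d c Phi : mhom d Phi -> mhom d (fun B => c * Phi B).
Proof. by move=> /(mhom_mul (mhom_const c)); apply: mhom_ext. Qed.

Lemma mhom_sum (I : Type) (r : seq I) d (Phi : I -> bases -> K) :
  (forall i, mhom d (Phi i)) -> mhom d (fun B => \sum_(i <- r) Phi i B).
Proof.
move=> h; elim: r => [|i r IH].
  by apply: mhom_ext (mhom0 d) => // B; rewrite big_nil.
by apply: mhom_ext (mhom_add (h i) IH) => // B; rewrite big_cons.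
Qed.

Lemma mhom_prod (I : Type) (r : seq I) d (Phi : I -> bases -> K) :
  (forall i, mhom d (Phi i)) -> mhom (fun l => size r * d l)%N (fun B => \prod_(i <- r) Phi i B).
Proof.
move=> h; elim: r => [|i r IH].
  by apply: mhom_ext (mhom_const 1) => // B; rewrite big_nil.
by apply: mhom_ext (mhom_mul (h i) IH) => B; rewrite ?big_cons //= mulSn.
Qed.

Lemma mhom_det j d (Phi : bases -> 'M[K]_j) :
  (forall a b, mhom d (fun B => Phi B a b)) -> mhom (fun l => j * d l)%N (fun B => \det (Phi B)).
Proof.
move=> h; apply: mhom_sum => s0; apply: mhom_scale; set s : {perm 'I_j} := s0.
have := mhom_prod (index_enum 'I_j) (fun i => h i (s i)).
by apply: mhom_ext => // l; rewrite -[index_enum _]/(Finite.enum _) -enumT size_enum_ord.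
Qed.

Lemma mhom_plucker (S : {set 'I_n}) : mhom (fun l => l == #|S| : nat) (fun B => plucker B S).
Proof.
exists 'X_(enum_rank S) => [mon|B]; last by rewrite mevalXU enum_rankK.
rewrite msuppX inE => /eqP -> i; have [->|ne] := eqVneq i #|S|.
  rewrite (bigD1 (enum_rank S)) /= ?enum_rankK // mnm1E eqxx big1 ?addn0 // => s /andP[_ h].
  by rewrite mnm1E eq_sym (negPf h).
apply: big1 => s /eqP hs; rewrite mnm1E; case: eqP => // e.
by move: ne; rewrite -hs -e enum_rankK eqxx.
Qed.

Lemma plucker_card (B : bases) i (S : {set 'I_n}) (e : #|S| = i) :
  plucker B S = \det (colsub (fun j : 'I_i => enum_val (cast_ord (esym e) j) : 'I_n) (B i)).
Proof.
by case: i / e; congr (\det _); apply/matrixP => a b; rewrite !mxE cast_ord_id.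
Qed.

(** The columns of a minor can be sorted at the price of a sign, and the minor
    vanishes if two of them coincide. *)
Lemma mhom_minor i (f : 'I_i -> 'I_n) :
  mhom (fun l => l == i : nat) (fun B => \det (colsub f (B i))).
Proof.
have [fi|/injectivePn[x [y xy fxy]]] := boolP (injectiveb f); last first.
  apply: mhom_ext (mhom0 _) => // B; apply/esym; rewrite -det_tr.
  by apply: (determinant_alternate xy) => l; rewrite !mxE fxy.
move/injectiveP: fi => fi.
have hS : #|[set f j | j in 'I_i]| = i by rewrite card_imset // card_ord.
move: (imset_f f); set S := [set f j | j in 'I_i] in hS * => fS.
have cE B := @plucker_card B i S hS.
have mf j : f j \in S by apply: fS.
pose s j := cast_ord hS (enum_rank_in (mf j) (f j)).
have sE j : enum_val (cast_ord (esym hS) (s j)) = f j.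
  by rewrite /s cast_ordK enum_rankK_in // mf.
have si : injective s by move=> a b e; apply: fi; rewrite -(sE a) -(sE b) e.
apply: mhom_ext (mhom_scale ((-1) ^+ perm si) (mhom_plucker S)) => [l|B]; first by rewrite hS.
rewrite (cE B); set A := colsub _ _.
have -> : colsub f (B i) = col_perm (perm si) A.
  by apply/matrixP => a b; rewrite !mxE permE sE.
by rewrite col_permE det_mulmx det_perm odd_permV mulrC.
Qed.

(** By Cramer's rule, the basis normalized at the columns g has minors as entries. *)
Definition cramer i (g : 'I_i -> 'I_n) (B : bases) : 'M[K]_(i, n) := \adj (colsub g (B i)) *m B i.

Lemma mhom_cramer i (g : 'I_i -> 'I_n) a t : mhom (fun l => l == i : nat) (fun B => cramer g B a t).
Proof.
apply: mhom_ext (mhom_minor (fun j => if j == a then t else g j)) => // B.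
rewrite (expand_det_col _ a) mxE; apply: eq_bigr => b _; rewrite !mxE eqxx mulrC; congr (_ * _).
rewrite /cofactor; congr (_ * \det _); apply/matrixP => c e; rewrite !mxE.
by rewrite eq_sym (negPf (neq_lift _ _)).
Qed.

Lemma mhom_lincomb d (I : finType) (x : I -> K) (Phi : I -> bases -> K) :
  (forall i, mhom d (Phi i)) -> mhom d (fun B => \sum_i Phi i B * x i).
Proof.
move=> h; apply: mhom_sum => i; apply: mhom_ext (mhom_scale (x i) (h i)) => // B; exact: mulrC.
Qed.

(** The steps i and j are orthogonal for Q iff these functions vanish for all g,
    g', a and b. *)
Lemma mhom_incidence i j (Q : 'M[K]_n) (g : 'I_i -> 'I_n) (g' : 'I_j -> 'I_n) a b :
  mhom (fun l => (l == i) + (l == j))%N (fun B => (cramer g B *m Q *m (cramer g' B)^T) a b).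
Proof.
apply: mhom_ext (mhom_sum (index_enum 'I_n)
  (fun t => mhom_mul (mhom_lincomb (fun l => Q l t) (mhom_cramer g a)) (mhom_cramer g' b t))) => //.
by move=> B; rewrite !mxE; apply: eq_bigr => t _; rewrite !mxE.
Qed.

(** Some nonzero vector of the step j is killed by Q iff these functions vanish for
    all g. *)
Lemma mhom_pairing j (Q : 'M[K]_(n, j)) (g : 'I_j -> 'I_n) :
  mhom (fun l => j * (l == j))%N (fun B => \det (cramer g B *m Q)).
Proof.
apply: mhom_det => a b.
apply: mhom_ext (mhom_lincomb (fun l => Q l b) (mhom_cramer g a)) => // B.
by rewrite mxE.
Qed.

Lemma free_minor i (A : 'M[K]_(i, n)) : row_free A -> exists g : 'I_i -> 'I_n, colsub g A \in unitmx.
Proof.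
move=> rA; have fA : row_full A^T by rewrite /row_full mxrank_tr.
exists (fullrankfun fA); rewrite -unitmx_tr.
have -> : (colsub (fullrankfun fA) A)^T = rowsub (fullrankfun fA) A^T by apply/matrixP => a b; rewrite !mxE.
exact: fullrowsub_unit.
Qed.

Lemma cramer_incidence i j (Q : 'M[K]_n) (B : bases) : row_free (B i) -> row_free (B j) ->
  B i *m Q *m (B j)^T != 0 ->
  exists (g : 'I_i -> 'I_n) (g' : 'I_j -> 'I_n) a b, (cramer g B *m Q *m (cramer g' B)^T) a b != 0.
Proof.
move=> /free_minor[g gu] /free_minor[g' gu'] nz.
have cancel h (X : 'M[K]_h) h' (Y : 'M[K]_(h, h')) : X \in unitmx -> \adj X *m Y = 0 -> Y = 0.
  move=> Xu /(congr1 (mulmx X)); rewrite mulmxA mul_mx_adj mulmx0 mul_scalar_mx => /eqP.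
  by rewrite scaler_eq0 => /orP[/eqP d0|/eqP //]; move: Xu; rewrite unitmxE d0 unitr0.
exists g, g'; apply: contrapT => h; case/eqP: nz.
have : cramer g B *m Q *m (cramer g' B)^T = 0.
  apply/matrixP => a b; rewrite [RHS]mxE; apply: contrapT => /eqP ab; apply: h; by exists a, b.
rewrite /cramer -!mulmxA => /(cancel _ _ _ _ gu)/(congr1 trmx); rewrite !trmx_mul trmxK trmx0 -!mulmxA.
move/(cancel _ _ _ _ gu')/(congr1 trmx); by rewrite trmx0 !trmx_mul !trmxK mulmxA.
Qed.

Lemma cramer_pairing j (Q : 'M[K]_(n, j)) (B : bases) : row_free (B j) -> \det (B j *m Q) != 0 ->
  exists g : 'I_j -> 'I_n, \det (cramer g B *m Q) != 0.
Proof.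
move=> /free_minor[g gu] nz; exists g; rewrite /cramer -mulmxA det_mulmx mulf_neq0 //.
apply/negP => /eqP d0; move: gu; rewrite unitmxE unitfE => gu.
have := congr1 determinant (mul_adj_mx (colsub g (B j))).
by rewrite det_mulmx d0 mul0r det_scalar => /esym/eqP; rewrite expf_eq0 (negPf gu) andbF.
Qed.

(** A change of basis multiplies the coordinates on each exterior power by a
    determinant, so vanishing depends on the flag only. *)
Lemma mhom_rescale d Phi (B B' : bases) (T : forall i, 'M[K]_i) : mhom d Phi ->
  (forall i, (i <= n)%N -> T i \in unitmx /\ B' i = T i *m B i) -> Phi B != 0 -> Phi B' != 0.
Proof.
move=> [P gP hP] hT; rewrite !hP.
have cE (S : {set 'I_n}) : plucker B' S = \det (T #|S|) * plucker B S.
  have cS : (#|S| <= n)%N by have := max_card S; rewrite card_ord.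
  rewrite /plucker (proj2 (hT _ cS)) -det_mulmx; congr (\det _).
  by apply/matrixP => a b; rewrite !mxE; apply: eq_bigr => l _; rewrite !mxE.
suff -> : P.@[fun s => plucker B' (enum_val s)] =
    (\prod_(i < n.+1) \det (T i) ^+ d i) * P.@[fun s => plucker B (enum_val s)].
  move=> h; rewrite mulf_neq0 //; apply/prodf_neq0 => i _; rewrite expf_neq0 //.
  by rewrite -unitfE -unitmxE; have [] := hT i (ltn_ord i).
rewrite !mevalE mulr_sumr; apply: eq_big_seq => mon hm; rewrite mulrCA; congr (_ * _).
rewrite (eq_bigr (fun s => \det (T #|enum_val s : {set 'I_n}|) ^+ mon s *
    plucker B (enum_val s) ^+ mon s)) => [|s _]; last by rewrite cE exprMn.
rewrite big_split /=; congr (_ * _).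
have cn (s : 'I_N) : (#|enum_val s : {set 'I_n}| < n.+1)%N.
  by rewrite ltnS; have := max_card (enum_val s : {set 'I_n}); rewrite card_ord.
rewrite (partition_big (fun s => Ordinal (cn s)) xpredT) //=; apply: eq_bigr => i _.
rewrite -(gP _ hm) (eq_bigl (fun s : 'I_N => #|enum_val s : {set 'I_n}| == i)) => [|s]; last by rewrite -val_eqE.
rewrite (eq_bigr (fun s => \det (T i) ^+ mon s)) => [|s /eqP -> //].
by rewrite prodrXr.
Qed.

End Plucker.

Local Open Scope classical_set_scope.
Local Open Scope ring_scope.

(** * Components of a finite cover *)
Section FiniteCover.
Variables (T : Type) (closed : set T -> Prop).
Hypothesis closed0 : closed set0.
Hypothesis closedU : forall Z1 Z2, closed Z1 -> closed Z2 -> closed (Z1 `|` Z2).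

Lemma irreducible_cover (I : eqType) (s : seq I) (Z : I -> set T) (A : set T) :
  (forall i, closed (Z i)) -> irreducible closed A ->
  (forall x, A x -> exists2 i, i \in s & Z i x) -> exists2 i, i \in s & (A `<=` Z i).
Proof.
move=> cZ [[x0 Ax0] hA] cov.
have cs (s' : seq I) : closed [set x | exists2 i, i \in s' & Z i x].
  elim: s' => [|i s' IH].
    by rewrite (_ : [set x | _] = set0) //; apply/seteqP; split => // x [].
  rewrite (_ : [set x | _] = (Z i `|` [set x | exists2 j, j \in s' & Z j x])); first exact: closedU.
  apply/seteqP; split => x /= => [[j]|[zi|[j js zj]]].
  - by rewrite inE => /orP[/eqP ->|js zj]; [left|right; exists j].
  - by exists i; rewrite ?inE ?eqxx.
  - by exists j; rewrite ?inE ?js ?orbT.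
elim: s cov => [|i s IH] cov; first by have [] := cov _ Ax0.
have [|h|h] := hA (Z i) [set x | exists2 j, j \in s & Z j x] (cZ i) (cs s).
- by move=> x /cov[j]; rewrite inE => /orP[/eqP ->|js zj]; [left|right; exists j].
- by exists i; rewrite ?inE ?eqxx.
- by have [j js Aj] := IH h; exists j; rewrite ?inE ?js ?orbT.
Qed.

Lemma finite_components (X : set T) (I : finType) (D : set I) (A : I -> set T) :
  (forall i, D i -> (A i `<=` X) /\ irreducible closed (A i)) ->
  (forall i, D i -> exists2 Z, closed Z & A i = (X `&` Z)) ->
  (forall i j, D i -> D j -> (A i `<=` A j) -> A i = A j) ->
  (forall x, X x -> exists2 i, D i & A i x) ->
  irreducible_components closed X = [set A i | i in D]%classic.
Proof.
move=> hA hZ hinc cov.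
have exZ i : exists Z, closed Z /\ (D i -> A i = (X `&` Z)) /\ (~ D i -> Z = set0).
  by case: (pselect (D i)) => [Di|nDi]; [have [Z] := hZ i Di; exists Z|exists set0].
have [Z /all_and2[cZ ZE]] := choice exZ.
have main B : (B `<=` X) -> irreducible closed B -> exists2 i, D i & (B `<=` A i).
  move=> BX iB; have [|i _ Bi] := @irreducible_cover I (enum I) Z B cZ iB.
    move=> x /BX Xx; have [i Di Ax] := cov x Xx; exists i; rewrite ?mem_enum //.
    by move: Ax; rewrite (proj1 (ZE i) Di) => -[].
  have Di : D i.
    by apply: contrapT => /(proj2 (ZE i)) Z0; have [[x Bx] _] := iB; have := Bi x Bx; rewrite Z0.
  by exists i => // x Bx; rewrite (proj1 (ZE i) Di); split; [apply: BX|apply: Bi].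
apply/seteqP; split => [B [BX iB maxB]|_ [i Di <-]] /=.
  have [i Di Bi] := main B BX iB; exists i => //.
  by have [AX iA] := hA i Di; apply: maxB.
have [AX iA] := hA i Di; split=> // B BX iB AB.
have [j Dj Bj] := main B BX iB; have E := hinc i j Di Dj (subset_trans AB Bj).
by apply/seteqP; split => //; rewrite E.
Qed.

End FiniteCover.

(** * The Zariski topology on flags *)
Section Rows.
Variables (K : fieldType) (n : nat).
Local Notation V := 'rV[K]_n.
Local Notation rows A := [seq row r A | r <- enum 'I_ _].

Lemma rows_mem i (A : 'M[K]_(i, n)) (u : V) : reflect (exists a, u = a *m A) (u \in <<rows A>>%VS).
Proof.
apply: (iffP idP) => [/(coord_span (X := in_tuple (rows A))) ->|[a ->]]; last first.
  rewrite mulmx_sum_row; apply: memv_suml => j _; apply/memvZ/memv_span.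
  by apply: map_f; rewrite mem_enum.
elim/big_ind: _ => [|_ _ [a ->] [b ->]|j _]; first by exists 0; rewrite mul0mx.
  by exists (a + b); rewrite mulmxDl.
have /mapP[r _ ->] := mem_nth 0 (ltn_ord j).
by exists (coord (in_tuple (rows A)) j u *: delta_mx 0 r); rewrite -scalemxAl -rowE.
Qed.

Lemma rows_free i (A : 'M[K]_(i, n)) U : basis_of U (rows A) -> row_free A.
Proof.
move=> bA; have fr := basis_free bA; rewrite -kermx_eq0; apply/eqP/row_matrixP => r; rewrite row0.
have : row r (kermx A) *m A = 0 by rewrite -row_mul mulmx_ker row0.
move: (row r _) => a; rewrite mulmx_sum_row => aA; apply/rowP => j; rewrite mxE.
have sz : size (rows A) = i by rewrite size_map size_enum_ord.
have /freeP h : free (Tuple (introT eqP sz)) by [].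
apply: (h (fun j => a 0 j)) => /=; rewrite -[RHS]aA; apply: eq_bigr => l _.
by rewrite (nth_map l) ?size_enum_ord // nth_ord_enum.
Qed.

Lemma rows_basis_mem i (A : 'M[K]_(i, n)) U : basis_of U (rows A) ->
  forall u, reflect (exists a, u = a *m A) (u \in U).
Proof. by move=> /andP[/eqP <- _] u; exact: rows_mem. Qed.

Lemma rows_rebase i (A A' : 'M[K]_(i, n)) U : basis_of U (rows A) -> basis_of U (rows A') ->
  exists T, T \in unitmx /\ A' = T *m A.
Proof.
move=> bA bA'.
have sub : (A' <= A)%MS.
  apply/row_subP => r; have : row r A' \in U.
    by apply: (basis_mem bA'); apply: map_f; rewrite mem_enum.
  by move/(rows_basis_mem bA)=> [a ->]; apply: submxMl.
have [T E] := submxP sub; exists T; split=> //.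
have := rows_free bA'; rewrite E => /row_freeP[D'].
by rewrite -mulmxA => /mulmx1_unit[].
Qed.

Lemma rows_basis_ex i U : \dim U = i -> exists A : 'M[K]_(i, n), basis_of U (rows A).
Proof.
move=> <-; exists (\matrix_r (vbasis U)`_r).
have -> : rows (\matrix_(r < \dim U) (vbasis U)`_r) = vbasis U; last exact: vbasisP.
apply: (@eq_from_nth _ 0); first by rewrite size_map size_enum_ord size_tuple.
move=> j; rewrite size_map size_enum_ord => jU.
by rewrite (nth_map (Ordinal jU)) ?size_enum_ord // rowK nth_enum_ord.
Qed.

End Rows.

Lemma rows_span (K : numFieldType) n i (b : nat -> 'rV[K]_n) : \dim (spanb b i) = i ->
  basis_of (spanb b i) [seq row r (\matrix_(r < i) b r) | r <- enum 'I_i].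
Proof.
have -> : [seq row r (\matrix_(r < i) b r) | r <- enum 'I_i] = mkseq b i.
  apply: (@eq_from_nth _ 0); first by rewrite size_map size_enum_ord size_mkseq.
  move=> j; rewrite size_map size_enum_ord => jU.
  by rewrite (nth_map (Ordinal jU)) ?size_enum_ord // rowK nth_enum_ord // nth_mkseq.
by move=> d; rewrite basisEdim subvv d size_mkseq /=.
Qed.

Lemma mhom_polyK (K : numFieldType) n d (Phi : bases K n -> K) (B : K -> bases K n) : mhom d Phi ->
  (forall i r c, polyK (fun t => B t i r c)) -> polyK (fun t => Phi (B t)).
Proof.
move=> [P _ hP] pB.
have ps (s : 'I_#|{: {set 'I_n}}|) : polyK (fun t => plucker (B t) (enum_val s)).
  by apply: polyK_det => r c; apply: (polyK_ext _ (pB _ r (enum_val c))) => t; rewrite mxE.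
have [Q hQ] := choice ps.
exists (\sum_(mon <- msupp P) (P@_mon)%:P * \prod_s Q s ^+ (mon : 'X_{1.. _}) s) => t.
rewrite hP mevalE horner_sum; apply: eq_bigr => mon _.
rewrite hornerM hornerC; congr (_ * _); rewrite horner_prod; apply: eq_bigr => s _.
by rewrite horner_exp hQ.
Qed.

Section Zariski.
Variables (R : realType) (p k : nat).
Local Notation C := R[i].
Local Notation n := (p + k)%N.
Local Notation V := 'rV[C]_n.
Local Notation flag := (flag R p k).
Implicit Types F G : flag.

Definition bases_of F (B : bases C n) := forall i, (i <= n)%N ->
  basis_of (step F i) [seq row r (B i) | r <- enum 'I_i].

Lemma flag_dim F i : is_flag F -> (i <= n)%N -> \dim (step F i) = i.
Proof.
move=> [F0 hF Fn] le_in.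
have up j d : (j + d <= n)%N -> (\dim (step F j) + d <= \dim (step F (j + d)))%N.
  elim: d => [|d IH] jd; first by rewrite !addn0.
  rewrite addnS in jd *; have [sub ne] := hF _ jd.
  rewrite addnS; apply: leq_trans (_ : \dim (step F (j + d)) < _)%N; first by rewrite ltnS IH // ltnW.
  rewrite ltn_neqAle dimvS // andbT; apply/negP => /eqP e; apply: ne; apply/eqP.
  by rewrite eqEdim sub e leqnn.
apply/eqP; rewrite eqn_leq; apply/andP; split; last by have := up 0%N i le_in; rewrite F0 dimv0.
have := up i (n - i)%N; rewrite subnKC // Fn dimvf /dim /= mul1n => /(_ (leqnn _)) h.
by rewrite -(leq_add2r (n - i)) subnKC.
Qed.

Lemma bases_ex F : is_flag F -> exists B, bases_of F B.
Proof.
move=> fF.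
have ex i : exists A : 'M[C]_(i, n), (i <= n)%N -> basis_of (step F i) [seq row r A | r <- enum 'I_i].
  have [le|] := leqP i n; last by exists 0.
  by have [A hA] := rows_basis_ex (flag_dim fF le); exists A.
by exists (fun i => projT1 (cid (ex i))) => i le; case: (cid (ex i)) => A /= /(_ le).
Qed.

Lemma bases_nonzero F B B' d (Phi : bases C n -> C) : bases_of F B -> bases_of F B' -> mhom d Phi ->
  Phi B != 0 -> Phi B' != 0.
Proof.
move=> bB bB' hP.
have ex i : exists T : 'M[C]_i, (i <= n)%N -> T \in unitmx /\ B' i = T *m B i.
  have [le|] := leqP i n; last by exists 0.
  by have [T hT] := rows_rebase (bB i le) (bB' i le); exists T.
exact: (mhom_rescale (T := fun i => projT1 (cid (ex i))) hP (fun i => projT2 (cid (ex i)))).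
Qed.

Lemma plucker_zeroP F B d (P : {mpoly C[nvars p k]}) : bases_of F B -> graded d P ->
  plucker_zero P F <-> P.@[fun s => plucker B (enum_val s)] = 0.
Proof.
move=> bB gP; split=> [zP|zB c [B' [bB' cE]]]; first by apply: zP; exists B.
have hP : mhom d (fun B => P.@[fun s => plucker B (enum_val s)]) by exists P.
apply: contrapT => /eqP nz.
have : P.@[fun s => plucker B' (enum_val s)] != 0.
  by rewrite (meval_eq (v2 := fun s => c (enum_val s))) // => s; rewrite cE.
by move/(bases_nonzero bB' bB hP); rewrite zB eqxx.
Qed.

Lemma zariski_closed0 : @zariski_closed R p k set0.
Proof.
exists [set 1]; split.
  by move=> _ ->; exists (fun _ => 0%N) => mon; rewrite msupp1 inE => /eqP -> i; apply: big1 => s _; rewrite mnm0E.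
apply/seteqP; split => // F [fF /(_ 1 erefl) z1]; have [B bB] := bases_ex fF.
have /z1 : plucker_coords F (plucker B) by exists B.
by rewrite meval1 => /eqP; rewrite oner_eq0.
Qed.

Lemma graded_mul d e (P Q : {mpoly C[nvars p k]}) : graded d P -> graded e Q ->
  graded (fun i => (d i + e i)%N) (P * Q).
Proof.
move=> gP gQ mon /msuppM_le /allpairsP[[m1 m2] /= [h1 h2 ->]] i.
by rewrite -(gP _ h1) -(gQ _ h2) -big_split /=; apply: eq_bigr => s _; rewrite mnmDE.
Qed.

(** The union is cut out by the products of equations; by [plucker_zeroP] a single
    choice of coordinates serves both factors. *)
Lemma zariski_closedU (Z1 Z2 : set flag) : zariski_closed Z1 -> zariski_closed Z2 ->
  zariski_closed (Z1 `|` Z2).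
Proof.
move=> [Ps1 [h1 ->]] [Ps2 [h2 ->]].
exists [set P | exists P1 P2, [/\ Ps1 P1, Ps2 P2 & P = P1 * P2]]; split.
  move=> _ [P1 [P2 [/h1[d1 g1] /h2[d2 g2] ->]]].
  by exists (fun i => (d1 i + d2 i)%N); apply: graded_mul.
apply/seteqP; split => F /=.
  case=> -[fF z]; split=> // _ [P1 [P2 [i1 i2 ->]]] c cF; rewrite mevalM.
    by rewrite (z P1 i1 c cF) mul0r.
  by rewrite (z P2 i2 c cF) mulr0.
move=> [fF z]; have [B bB] := bases_ex fF; apply: contrapT => /not_orP[n1 n2].
have [P1 [i1 z1]] : exists P, Ps1 P /\ ~ plucker_zero P F.
  by apply: contrapT => h; apply: n1; split=> // P iP; apply: contrapT => nz; apply: h; exists P.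
have [P2 [i2 z2]] : exists P, Ps2 P /\ ~ plucker_zero P F.
  by apply: contrapT => h; apply: n2; split=> // P iP; apply: contrapT => nz; apply: h; exists P.
have [d1 g1] := h1 _ i1; have [d2 g2] := h2 _ i2.
have : plucker_zero (P1 * P2) F by apply: z; exists P1, P2.
move/(plucker_zeroP bB (graded_mul g1 g2)); rewrite mevalM => /eqP; rewrite mulf_eq0.
by case/orP=> /eqP e; [apply: z1; apply/(plucker_zeroP bB g1)|apply: z2; apply/(plucker_zeroP bB g2)].
Qed.

(** A set is closed in X as soon as every flag of X outside it is separated from
    it by a multihomogeneous function. *)
Lemma zariski_closed_in (X A : set flag) : (A `<=` X) -> (forall F, X F -> is_flag F) ->
  (forall F, X F -> ~ A F -> exists d Phi B, [/\ mhom d Phi, bases_of F B, Phi B != 0 &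
     forall G B', A G -> bases_of G B' -> Phi B' = 0]) ->
  exists2 Z, zariski_closed Z & A = (X `&` Z).
Proof.
move=> AX fX sep; pose Ps := [set P | multihomogeneous P /\ forall G, A G -> @plucker_zero R p k P G].
exists [set F | is_flag F /\ forall P, Ps P -> plucker_zero P F].
  by exists Ps; split=> // P [].
apply/seteqP; split=> [F AF|F [XF [fF z]]]; first by split; [exact: AX|split; [exact/fX/AX|move=> P [_]; apply]].
apply: contrapT => /(sep F XF)[d [Phi [B [[P gP hP] bB nz van]]]].
have : plucker_zero P F.
  apply: z; split=> [|G AG]; first by exists d.
  have [B' bB'] := bases_ex (fX G (AX G AG)).
  by apply/(plucker_zeroP bB' gP); rewrite -hP; apply: van bB'.
by move/(plucker_zeroP bB gP); rewrite -hP => e; rewrite e eqxx in nz.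
Qed.

(** Two flags of A joined by a polynomial curve of bases whose generic members
    are in A cannot lie in two different pieces of a closed cover. *)
Lemma zariski_irreducible (A : set flag) : (A !=set0) -> (forall F, A F -> is_flag F) ->
  (forall F G, A F -> A G -> exists b : nat -> C -> V, [/\ forall s, polyV (b s),
     forall i, (i <= n)%N -> spanb (b^~ 0) i = step F i,
     forall i, (i <= n)%N -> spanb (b^~ 1) i = step G i &
     gen (fun t => exists2 F', A F' & forall i, (i <= n)%N -> spanb (b^~ t) i = step F' i)]) ->
  irreducible (@zariski_closed R p k) A.
Proof.
move=> A0 fA cA; split=> // Z1 Z2 [Ps1 [h1 ->]] [Ps2 [h2 ->]] cov.
apply: contrapT => /not_orP[n1 n2].
have out Ps : ~ (A `<=` [set F | is_flag F /\ forall P, Ps P -> plucker_zero P F]) ->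
    exists F P, [/\ A F, Ps P & ~ plucker_zero P F].
  move=> h; apply: contrapT => h'; apply: h => F AF; split; first exact: fA.
  by move=> P iP; apply: contrapT => nz; apply: h'; exists F, P.
have [F [P1 [AF i1 z1]]] := out _ n1; have [G [P2 [AG i2 z2]]] := out _ n2.
have [d1 g1] := h1 _ i1; have [d2 g2] := h2 _ i2.
have [b [pb b0 b1 gb]] := cA F G AF AG.
pose B t : bases C n := fun i => \matrix_(r < i) b r t.
have bB t H : A H -> (forall i, (i <= n)%N -> spanb (b^~ t) i = step H i) -> bases_of H (B t).
  move=> AH E i le; rewrite -E //; apply: rows_span; rewrite E //.
  exact: flag_dim (fA _ AH) le.
pose phi (P : {mpoly C[nvars p k]}) (B : bases C n) := P.@[fun s => plucker B (enum_val s)].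
have pB i r c : polyK (fun t => B t i r c).
  apply: (@polyK_ext _ (fun t => b r t 0 c)) => [t|]; first by rewrite mxE.
  by apply: (polyV_fun (phi := fun v : V => v 0 c)) => // *; rewrite mxE.
have gz d P t0 H : graded d P -> A H -> (forall i, (i <= n)%N -> spanb (b^~ t0) i = step H i) ->
    ~ plucker_zero P H -> gen (fun t => phi P (B t) != 0).
  move=> gP AH E nz; apply: (gen_neq0 (t0 := t0)).
    by apply: (mhom_polyK (d := d) (Phi := phi P)) => //; exists P.
  by apply/eqP => e; apply: nz; apply/(plucker_zeroP (bB t0 H AH E) gP).
have := gen_and gb (gen_and (gz _ _ _ _ g1 AF b0 z1) (gz _ _ _ _ g2 AG b1 z2)).
case/gen_exists=> t [[H AH E] [nz1 nz2]]; have bH := bB t H AH E.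
case: (cov H AH) => -[_ z].
  by case/eqP: nz1; apply/(plucker_zeroP bH g1); apply: z.
by case/eqP: nz2; apply/(plucker_zeroP bH g2); apply: z.
Qed.

End Zariski.

(** * Marked cup diagrams and their sets of flags *)
Section Translation.
Variables (R : realType) (p k : nat).
Hypotheses (hkp : (k <= p)%N) (hk0 : (0 < k)%N) (hpar : p = k \/ (odd p /\ odd k)).
Local Notation C := R[i].
Local Notation n := (p + k)%N.
Local Notation m := ((p + k)./2).
Local Notation V := 'rV[C]_n.
Local Notation flag := (flag R p k).
Local Notation S := (standard R hkp hk0 hpar).
Local Notation diagram := (marked_cup_diagram m).

(** Beyond the middle, inclusions and x-stability follow by taking orthogonals. *)
Lemma springer_full (F : flag) : springer_fiber F <-> full_flag S (step F).
Proof.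
have m2 := double_m S.
split=> [[fF pF xF]|fF].
  have [F0 hF Fn] := fF; split=> //; split=> // s sm.
  have sn : (s < n)%N by rewrite -m2 -addnn ltn_addr.
  have [sub _] := hF s sn; split=> //; first exact: flag_dim fF sn.
  by have := xF s.+1; rewrite /= sn => /(_ isT).
have [hf pf] := fF; split; first split.
- by case: hf.
- move=> i im; split; first by have [] := full_step fF im.
  move=> e; have := full_dim fF (ltnW im); rewrite e (full_dim fF im) => /eqP.
  by rewrite gtn_eqF.
- exact: full_top fF.
- by move=> i im; exact: pf.
- by case=> // i /= im; have [] := full_step fF im.
Qed.

Section Diagram.
Variable a : diagram.

(** Vertices outside the diagram are fixed and unmarked. *)
Definition mate_of v := oapp (fun i : 'I_m => val (partner a i)) v (insub v).
Definition mark_of v := oapp (fun i : 'I_m => i \in marked a) false (insub v).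

Lemma mate_ofE (i : 'I_m) : mate_of i = partner a i.
Proof. by rewrite /mate_of valK. Qed.
Lemma mark_ofE (i : 'I_m) : mark_of i = (i \in marked a).
Proof. by rewrite /mark_of valK. Qed.

Lemma mate_of_cups : cups m mate_of.
Proof.
have lt v u : (v < m)%N -> (v < u < mate_of v)%N -> (u < m)%N.
  move=> vm /andP[_ h]; apply: ltn_trans h _; by rewrite -[v]/(val (Ordinal vm)) mate_ofE.
split=> [v vm|v vm|v u vm hu|v u vm hu].
- by rewrite -[v]/(val (Ordinal vm)) mate_ofE.
- by rewrite -[v]/(val (Ordinal vm)) !mate_ofE partnerK.
- have um := lt v u vm hu; rewrite -[u]/(val (Ordinal um)) mate_ofE => /val_inj e.
  move: hu; rewrite -[v]/(val (Ordinal vm)) mate_ofE => hu.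
  by have := @no_ray_under_cup _ a (Ordinal vm) (Ordinal um) hu; rewrite e eqxx.
- have um := lt v u vm hu; move: hu.
  rewrite -[u]/(val (Ordinal um)) -[v]/(val (Ordinal vm)) !mate_ofE; exact: non_crossing.
Qed.

Lemma mark_of_marking : marking m mate_of mark_of.
Proof.
move=> v vm; rewrite -[v]/(val (Ordinal vm)) !mate_ofE !mark_ofE => mv.
have [h1 h2] := marked_accessible mv; split; first exact: marked_partner.
- move=> u um hu; rewrite -[u]/(val (Ordinal um)) !mate_ofE => /val_inj e.
  by have := h1 (Ordinal um) hu; rewrite e eqxx.
- by move=> u um; rewrite -[u]/(val (Ordinal um)) !mate_ofE; apply: h2.
Qed.

Lemma nop_card s : (s <= m)%N -> nop mate_of 0 s = #|[pred l : 'I_m | (l < partner a l)%N && (l < s)%N]|.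
Proof.
move=> sm; rewrite /nop subn0 -sum1_count -sum1_card -[s in iota 0 s]subn0 -[LHS]/(\sum_(0 <= l < s | opener mate_of l) 1)%N.
rewrite (big_nat_widen 0 s m) // big_mkord; apply: eq_bigl => l.
by rewrite /opener mate_ofE inE.
Qed.

Lemma nop_num_cups : nop mate_of 0 m = num_cups a.
Proof. by rewrite nop_card //; apply: eq_card => l; rewrite !inE ltn_ord andbT. Qed.

(** No cup passes over a ray, so left endpoints left of i belong to cups left of i. *)
Lemma nop_num_cups_left (i : 'I_m) : partner a i = i -> nop mate_of 0 i = num_cups_left a i.
Proof.
move=> ii; rewrite nop_card ?(ltnW (ltn_ord i)) //; apply: eq_card => l; rewrite !inE.
apply: andb_id2l => lo; apply/idP/idP => [li|]; last exact: ltn_trans.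
have := @no_ray_under_cup _ a l i; rewrite li /= ii eqxx.
case: ltngtP => // [_ /(_ isT) //|e _]; move/val_inj: e => e.
by move: li; rewrite -ii e partnerK ltnn.
Qed.

Lemma lastray_rightmost (i : 'I_m) : partner a i = i ->
  (lastray p k mate_of i <-> rightmost_ray a i).
Proof.
move=> ii; split=> [/allP h j jj|h].
  rewrite leqNgt; apply/negP => ij; have := h j; rewrite mem_iota ij subnKC // ltn_ord => /(_ isT).
  by rewrite mate_ofE jj eqxx.
apply/allP => u; rewrite mem_iota subnKC // => /andP[iu um].
rewrite -[u]/(val (Ordinal um)) mate_ofE; apply/negP => /eqP/val_inj e.
by have := h _ e; rewrite leqNgt /= iu.
Qed.

Hypothesis aD : diagrams a.
Local Notation D := mate_of_cups.
Local Notation Mk := mark_of_marking.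
Let Nc : nop mate_of 0 m = k./2. Proof. by rewrite nop_num_cups. Qed.

(** The uniform description of the spaces at rays specializes to the two cases of
    the definition. *)
Lemma ray_condP (F : flag) (i : 'I_m) : partner a i = i ->
  (step F i.+1 = ray_space S mate_of mark_of i <->
   (p = k -> (i \in marked a -> step F i.+1 = span_ef ((i.+1 - 1)./2) ((i.+1 + 1)./2) [::]) /\
     (i \notin marked a -> step F i.+1 = span_ef ((i.+1 + 1)./2) ((i.+1 - 1)./2) [::])) /\
   ((k < p)%N -> let c := num_cups_left a i in
     [/\ i \in marked a ->
          step F i.+1 = span_ef (i.+1 - c - 1) c [:: fvec R p k c.+1 + ray_coef R p k *: evec R p k (i.+1 - c)],
        i \notin marked a -> rightmost_ray a i ->
          step F i.+1 = span_ef (i.+1 - c - 1) c [:: fvec R p k c.+1 - ray_coef R p k *: evec R p k (i.+1 - c)] &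
        i \notin marked a -> ~ rightmost_ray a i -> step F i.+1 = span_ef (i.+1 - c) c [::]])).
Proof.
move=> ii; have wi : mate_of i = i by rewrite mate_ofE ii.
have [pk|npk] := pselect (p = k).
  rewrite (ray_space_eq S D Mk Nc (ltn_ord i) wi pk) mark_ofE subn1 addn1 /=.
  have nkp : (k < p)%N = false by rewrite pk ltnn.
  split=> [E|[/(_ pk)[h1 h2] _]]; last by case: ifP => [/h1|/negbT/h2].
  by split=> [_|]; [split=> ia; rewrite E; [rewrite ia|rewrite (negPf ia)]|rewrite nkp].
have kp : (k < p)%N by rewrite ltn_neqAle hkp andbT; apply/eqP => e; apply: npk.
rewrite (ray_space_gt S D Mk Nc (ltn_ord i) wi npk) mark_ofE (nop_num_cups_left ii).
have ci : (num_cups_left a i <= i)%N.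
  rewrite -(nop_num_cups_left ii); have [l [el _ _ _ _]] := ray_sizes S D Mk Nc (ltn_ord i) wi.
  by rewrite {2}el -addnn addnA leq_addl.
have e1 : (i.+1 - num_cups_left a i = (i - num_cups_left a i).+1)%N by rewrite subSn.
rewrite /= e1 !subn1 /=.
split=> [E|[_ /(_ kp)[h1 h2 h3]]].
  split=> // _; split=> [ia|ia /(lastray_rightmost ii) la|ia la]; rewrite E.
  - by rewrite ia.
  - by rewrite (negPf ia) la.
  - by rewrite (negPf ia) ifF //; apply/negP => /(lastray_rightmost ii).
case: ifP => [/h1 //|/negbT ia]; case: ifPn => [/(lastray_rightmost ii)|/negP la]; first exact: h2.
by apply: h3 => // /(lastray_rightmost ii).
Qed.

Lemma componentP (F : flag) : component a F <-> full_flag S (step F) /\ fits S mate_of mark_of m (step F).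
Proof.
have m2 := double_m S.
have half_sub (j : nat) : ((n - 2 * j)./2 = m - j)%N.
  by rewrite -{1}m2 mul2n -doubleB doubleK.
split=> [[sF uc mc re rg]|[fF [hf hc]]].
  have fF := proj1 (springer_full F) sF; split=> //; split; first by case: fF.
  move=> w wm; rewrite /cond; set i := Ordinal wm.
  have wE : mate_of w = partner a i by rewrite -mate_ofE.
  case: ltngtP => [|//|ww]; last first.
    have ii : partner a i = i by apply: val_inj; rewrite /= -wE.
    by apply/(ray_condP F ii); split=> h; [exact: re h i ii|exact: rg h i ii].
  rewrite wE => vw; have pv : partner a (partner a i) = i by rewrite partnerK.
  have kE : (partner a i \in marked a) = mark_of w.
    rewrite -[w]/(val i) mark_ofE; apply/idP/idP; last exact: marked_partner.
    by move/marked_partner; rewrite pv.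
  have e1 : (i.+1 - (partner a i).+1 + 1)%N = (w - partner a i).+1 by rewrite subSS addn1.
  case: ifP => mw.
    have := mc (partner a i) i vw pv; rewrite kE mw => /(_ isT).
    by rewrite /= e1 subn1 /= half_sub.
  have := uc (partner a i) i vw pv; rewrite kE mw => /(_ isT).
  by rewrite /= e1 subn1.
have key (i0 j0 : 'I_m) : (i0 < j0)%N -> partner a i0 = j0 ->
   cond S mate_of mark_of (step F) j0 -> (i0 \in marked a) = mark_of j0 /\
   if mark_of j0 then (step F i0 + Defs.xpow R p k (j0 - i0).+1./2 @: step F j0.+1)%VS = step F i0.+1 /\
      Defs.perp (step F j0.+1) = (Defs.xpow R p k (m - j0.+1) @^-1: step F j0.+1)%VS
   else step F j0.+1 = (Defs.xpow R p k (j0 - i0).+1./2 @^-1: step F i0)%VS.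
  move=> ij pi; have jE : mate_of j0 = i0 by rewrite mate_ofE -pi partnerK.
  rewrite /cond jE ij => h; split=> //; rewrite mark_ofE -pi; apply/idP/idP; first exact: marked_partner.
  by move/marked_partner; rewrite partnerK.
split; first exact/springer_full.
- move=> i0 j0 ij pi ni /=; have [kE] := key _ _ ij pi (hc j0 (ltn_ord j0)).
  by rewrite -kE (negPf ni) subn1 subSS addn1.
- move=> i0 j0 ij pi ni /=; have [kE] := key _ _ ij pi (hc j0 (ltn_ord j0)).
  by rewrite -kE ni subn1 subSS addn1 half_sub.
- move=> e i ii; have wi : mate_of i = i by rewrite mate_ofE ii.
  have := hc i (ltn_ord i); rewrite /cond wi ltnn eqxx => /(ray_condP F ii)[h _]; exact: h.
- move=> e i ii; have wi : mate_of i = i by rewrite mate_ofE ii.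
  have := hc i (ltn_ord i); rewrite /cond wi ltnn eqxx => /(ray_condP F ii)[_ h]; exact: h.
Qed.

End Diagram.

(** * Irreducible components *)

Lemma diagram_of mate mk : cups m mate -> marking m mate mk ->
  exists a : diagram, (forall w, (w < m)%N -> mate_of a w = mate w) /\
    (forall w, (w < m)%N -> mark_of a w = mk w).
Proof.
move=> D Mk; pose f (i : 'I_m) := Ordinal (mate_lt D (ltn_ord i)).
have fK : involutive f by move=> i; apply: val_inj; rewrite /= (mateK D).
have nr (i j : 'I_m) : (i < j < f i)%N -> f j != j.
  move=> h; apply/eqP => /(congr1 val) /=; exact: (cups_no_ray D (ltn_ord i) h).
have nc (i j : 'I_m) : (i < j < f i)%N -> (i < f j < f i)%N by apply: (cups_nest D (ltn_ord i)).
have mp (i : 'I_m) : i \in [set j : 'I_m | mk j]%SET -> f i \in [set j : 'I_m | mk j]%SET.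
  by rewrite !inE => /(Mk i (ltn_ord i))[].
have ma (i : 'I_m) : i \in [set j : 'I_m | mk j]%SET -> accessible f i.
  rewrite inE => /(Mk i (ltn_ord i))[_ h1 h2]; split=> [j hj|l]; last exact: h2 (ltn_ord l).
  by apply/eqP => /(congr1 val) /=; apply: h1.
exists (MarkedCupDiagram fK nr nc mp ma); split=> w wm; rewrite -[w]/(val (Ordinal wm)).
  by rewrite mate_ofE.
by rewrite mark_ofE inE.
Qed.

Lemma diagram_ext (a b : diagram) : (forall w, (w < m)%N -> mate_of a w = mate_of b w) ->
  (forall w, (w < m)%N -> mark_of a w = mark_of b w) -> a = b.
Proof.
move=> hp hm.
have ep : partner a = partner b.
  by apply/funext => i; apply: val_inj; rewrite /= -!mate_ofE hp.
have em : marked a = marked b by apply/setP => i; rewrite -!mark_ofE hm.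
case: a b ep em {hp hm} => [f A h1 h2 h3 h4 h5] [g B k1 k2 k3 k4 k5] /= ep em; subst g B.
by rewrite (Prop_irrelevance h1 k1) (Prop_irrelevance h2 k2) (Prop_irrelevance h3 k3)
  (Prop_irrelevance h4 k4) (Prop_irrelevance h5 k5).
Qed.

Lemma full_flag_eq H H' : (forall i, (i <= n)%N -> H i = H' i) -> full_flag S H -> full_flag S H'.
Proof.
move=> E [hf pf]; have m2 := double_m S; split=> [|i im]; last by rewrite -!E ?leq_subr //; apply: pf.
by apply: half_flag_eq hf => s sm; apply: E; rewrite -m2 -addnn (leq_trans sm) // leq_addr.
Qed.

Lemma flag_of (H : nat -> {vspace V}) : exists F : flag, forall i, (i <= n)%N -> H i = step F i.
Proof.
exists (Tuple (introT eqP (size_mkseq H n.+1))) => i im.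
by rewrite /step /= nth_mkseq.
Qed.

Lemma springer_perp (F : flag) i : springer_fiber F -> (i <= n)%N ->
  step F i = Defs.perp (step F (n - i)).
Proof. by case=> _ pF _ im; rewrite -pF ?leq_subr // subKn. Qed.

Section Component.
Variable a : diagram.
Hypothesis aD : diagrams a.
Local Notation D := (mate_of_cups a).
Local Notation Mk := (mark_of_marking (a := a)).
Let Nc : nop (mate_of a) 0 m = k./2. Proof. by rewrite nop_num_cups. Qed.

Lemma flag_of_component H : full_flag S H -> fits S (mate_of a) (mark_of a) m H ->
  exists2 F : flag, component a F & forall i, (i <= n)%N -> H i = step F i.
Proof.
move=> fH iH; have [F E] := flag_of H; exists F => //; apply/(componentP aD); split.
  exact: full_flag_eq fH.
apply: (fits_eq D Mk Nc _ iH) => s sm; apply: E.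
by rewrite -(double_m S) -addnn (leq_trans sm) // leq_addr.
Qed.

Lemma component_springer : component a `<=` @springer_fiber R p k.
Proof. by move=> F []. Qed.

Lemma component_closed : exists2 Z, zariski_closed Z & component a = @springer_fiber R p k `&` Z.
Proof.
apply: zariski_closed_in; [exact: component_springer|by move=> F []|].
move=> F XF nF; have fF := proj1 (springer_full F) XF.
have ffl : is_flag F by case: XF.
have ninv : ~ fits S (mate_of a) (mark_of a) m (step F).
  by move=> iF; apply: nF; apply/(componentP aD).
have [B bB] := bases_ex ffl.
have fr (G : flag) B' i : bases_of G B' -> (i <= n)%N -> row_free (B' i).
  by move=> bG le; apply: rows_free (bG i le).
have [[L [i [j [le_in le_jn nLF LF]]]]|[j [y [le_jn nd dg]]]] := separation D Mk Nc fF ninv.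
  pose Q := beta_mx R p k *m (lin1_mx L)^T.
  have betaE (u v : V) : Defs.beta v (L u) = (v *m Q *m u^T) 0 0.
    by rewrite /Defs.beta -(mul_rV_lin1 L) trmx_mul /Q !mulmxA.
  clearbody Q.
  have nz : B (n - j)%N *m Q *m (B i)^T != 0.
    apply/eqP => z0; case/negP: nLF; apply/subvP => _ /memv_imgP[u uF ->].
    rewrite (springer_perp XF le_jn).
    apply/mem_perpP => v vF; rewrite betaE.
    have [c ->] := rows_basis_mem (bB _ (leq_subr _ _)) _ vF.
    have [d ->] := rows_basis_mem (bB _ le_in) _ uF.
    by rewrite trmx_mul !mulmxA -(mulmxA c) -(mulmxA c) z0 mulmx0 mul0mx mxE.
  have [g [g' [s [t st]]]] := cramer_incidence (fr _ _ _ bB (leq_subr _ _)) (fr _ _ _ bB le_in) nz.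
  exists (fun l => (l == (n - j)%N) + (l == i))%N, (fun B => (cramer g B *m Q *m (cramer g' B)^T) s t), B; split; [exact: (mhom_incidence Q g g' s t)|by []|by []|].
  move=> G B' aG bG; have [fG iG] := proj1 (componentP aD G) aG.
  suff z : B' (n - j)%N *m Q *m (B' i)^T = 0.
    have -> : cramer g B' *m Q *m (cramer g' B')^T =
        \adj (colsub g (B' (n - j)%N)) *m (B' (n - j)%N *m Q *m (B' i)^T) *m (\adj (colsub g' (B' i)))^T.
      by rewrite /cramer trmx_mul !mulmxA.
    by rewrite z mulmx0 mul0mx mxE.
  apply/matrixP => c d; rewrite [RHS]mxE.
  have -> : (B' (n - j)%N *m Q *m (B' i)^T) c d = Defs.beta (row c (B' (n - j)%N)) (L (row d (B' i))).
    rewrite betaE -row_mul [LHS]mxE [RHS]mxE; apply: eq_bigr => l _; by rewrite !mxE.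
  have uG : row d (B' i) \in step G i.
    by apply: (basis_mem (bG i le_in)); apply: map_f; rewrite mem_enum.
  have vG : row c (B' (n - j)%N) \in step G (n - j).
    by apply: (basis_mem (bG _ (leq_subr _ _))); apply: map_f; rewrite mem_enum.
  have := subvP (LF _ fG iG) _ (memv_img L uG).
  rewrite (springer_perp (component_springer aG) le_jn).
  by move/mem_perpP; apply.
pose Q := beta_mx R p k *m (\matrix_r y r)^T.
have betaE (b : V) : b *m Q = 0 <-> forall r, Defs.beta b (y r) = 0.
  have E r : (b *m Q) 0 r = Defs.beta b (y r).
    by rewrite /Defs.beta /Q mulmxA [LHS]mxE [RHS]mxE; apply: eq_bigr => l _; rewrite !mxE.
  split=> [/rowP h r|h]; first by rewrite -E h mxE.
  by apply/rowP => r; rewrite E h mxE.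
clearbody Q; have nz : \det (B j *m Q) != 0.
  apply/negP => /det0P[c c0]; rewrite mulmxA => /betaE h.
  have b0 : c *m B j = 0.
    by apply: nd => //; apply/(rows_basis_mem (bB _ le_jn)); exists c.
  have /row_freeP[X BX] := fr _ _ _ bB le_jn.
  by move/eqP: c0; apply; rewrite -(mulmx1 c) -BX mulmxA b0 mul0mx.
have [g gz] := cramer_pairing (fr _ _ _ bB le_jn) nz.
exists (fun l => j * (l == j))%N, (fun B => \det (cramer g B *m Q)), B; split; [exact: (mhom_pairing Q g)|by []|by []|].
move=> G B' aG bG; have [fG iG] := proj1 (componentP aD G) aG.
have [b [bGj b0 hb]] := dg _ fG iG.
have [c cE] := rows_basis_mem (bG _ le_jn) _ bGj.
rewrite /cramer -mulmxA det_mulmx; suff -> : \det (B' j *m Q) = 0 by rewrite mulr0.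
apply/eqP/det0P; exists c; last by rewrite mulmxA -cE; apply/betaE.
by apply: contra b0 => /eqP c0; rewrite cE c0 mul0mx.
Qed.

Lemma component_irreducible : irreducible (@zariski_closed R p k) (component a).
Proof.
have m2 := double_m S.
apply: zariski_irreducible => [|F [[]] //|F G].
  have [b ib] := fits_nonempty S D Mk Nc.
  have [H fH E] := full_flag_ex D Mk Nc ib.
  have iH : fits S (mate_of a) (mark_of a) m H by apply: (fits_eq D Mk Nc _ ib) => s /E.
  by have [F aF _] := flag_of_component fH iH; exists F.
move=> /(componentP aD)[fF iF] /(componentP aD)[fG iG].
have [b [pb b0 b1 gb]] := curve D Mk Nc iF iG.
have ends t H : full_flag S H -> (forall i, (i <= m)%N -> spanb (b^~ t) i = H i /\
    spanb (b^~ t) (n - i) = Defs.perp (H i)) -> forall i, (i <= n)%N -> spanb (b^~ t) i = H i.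
  move=> fH E i le; have [im|mi] := leqP i m; first by have [] := E i im.
  have im : (n - i <= m)%N by clear -m2 mi; lia.
  by have [_] := E _ im; rewrite subKn // => ->; have := proj2 fH _ (leq_subr i n); rewrite subKn // => ->.
exists b; split=> //; [exact: ends fF b0|exact: ends fG b1|].
apply: gen_imp gb => t [it ot].
have ft : full_flag S (spanb (b^~ t)).
  split=> [|i le]; first by case: it.
  have [im|mi] := leqP i m; first exact: ot.
  have im : (n - i <= m)%N by clear -m2 mi; lia.
  by have := ot _ im; rewrite subKn // => ->; rewrite perpK.
by have [F' aF' E] := flag_of_component ft it; exists F'.
Qed.

End Component.

Lemma component_cover F : @springer_fiber R p k F -> exists2 a, diagrams a & component a F.
Proof.
move=> /springer_full fF; have [mate [mk [D Mk Nc iF]]] := coverage fF.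
have [a [mE kE]] := diagram_of D Mk; have aD : diagrams a.
  rewrite /diagrams /= -nop_num_cups -Nc /nop; apply: eq_in_count => w; rewrite mem_iota subn0 => /andP[_ wm].
  by rewrite /opener mE.
exists a; first exact: aD.
apply: (proj2 (componentP aD F)); split; first exact: fF.
exact: (fits_ext mE kE iF).
Qed.

Lemma component_sub_eq (a b : diagram) : diagrams a -> diagrams b -> component (R := R) (p := p) (k := k) a `<=` component b -> a = b.
Proof.
move=> aD bD sub.
have Na : nop (mate_of a) 0 m = k./2 by rewrite nop_num_cups.
have Nb : nop (mate_of b) 0 m = k./2 by rewrite nop_num_cups.
have [|mE kE] := diagrams_agree (mate_of_cups a) (mark_of_marking (a := a)) Na
  (mate_of_cups b) (mark_of_marking (a := b)) Nb (S := S).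
  move=> H fH iH; have [F aF E] := flag_of_component aD fH iH.
  have [_ iF] := proj1 (componentP bD F) (sub F aF).
  apply: (fits_eq (mate_of_cups b) (mark_of_marking (a := b)) Nb _ iF) => s sm; rewrite E //.
  by rewrite -(double_m S) -addnn (leq_trans sm) // leq_addr.
by apply: diagram_ext => w wm; rewrite ?mE ?kE.
Qed.

(** Diagrams are indexed by the finite type of their partner functions and marks. *)
Lemma springer_components :
  [set component a | a in @diagrams p k] = irreducible_components (@zariski_closed R p k) (@springer_fiber R p k).
Proof.
pose I := ({ffun 'I_m -> 'I_m} * {set 'I_m})%type.
pose code (a : diagram) : I := ([ffun i => partner a i], marked a).
have codeI : injective code.
  move=> a b [/ffunP ep em]; apply: diagram_ext => w wm; rewrite -[w]/(val (Ordinal wm)).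
    by rewrite !mate_ofE; have := ep (Ordinal wm); rewrite !ffunE => ->.
  by rewrite !mark_ofE em.
pose A (i : I) : set flag := [set F | exists a, [/\ diagrams a, code a = i & component a F]].
have AE a : diagrams a -> A (code a) = component a.
  move=> aD; apply/seteqP; split=> F /= => [[b [_ /codeI -> //]]|aF]; by exists a.
rewrite (@finite_components _ (@zariski_closed R p k) (@zariski_closed0 R p k) (@zariski_closedU R p k)
  _ I [set code a | a in @diagrams p k] A).
- apply/seteqP; split=> [_ [a aD <-]|_ [_ [a aD <-] <-]] /=; last by exists a => //; rewrite AE.
  by exists (code a); [exists a|rewrite AE].
- by move=> _ [a aD <-]; rewrite AE //; split; [exact: component_springer|exact: component_irreducible].
- by move=> _ [a aD <-]; rewrite AE //; exact: component_closed.
- by move=> _ _ [a aD <-] [b bD <-]; rewrite !AE // => /component_sub_eq ->.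
- by move=> F /component_cover[a aD aF]; exists (code a); [exists a|rewrite AE].
Qed.

End Translation.

Theorem theorem2p16 (R : realType) (m n k : nat)
  (hm : (0 < m)%N) (hn : n = (2 * m)%N)
  (hk : (1 <= k)%N) (hkn : (k <= n - k)%N)
  (hpar : (n - k = k /\ k = m)%N \/ (odd (n - k) /\ odd k)) :
  [set @component R (n - k) k a | a in @diagrams (n - k) k] =
  irreducible_components (@zariski_closed R (n - k) k) (@springer_fiber R (n - k) k).
Proof.
by apply: springer_components => //; case: hpar => [[]|]; [left|right].
Qed.
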